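(* Let $\mathsf{A}$ and $\mathsf{B}$ be finite essential square matrices with entries in $\mathbb{N}$. Then $\mathsf{A}$ and $\mathsf{B}$ are strong shift equivalent if and only if their associated C*-correspondences $X(\mathsf{A})$ and $X(\mathsf{B})$ are strong shift equivalent.
   Context: Here $\mathbb{N}=\{0,1,2,\dots\}$; a matrix is essential if it has no zero rows and no zero columns. Strong shift equivalence of matrices: $\mathsf{A}$ and $\mathsf{B}$ are strong shift equivalent with lag $m\ge1$ if there are finite rectangular matrices $\mathsf{R}_1,\dots,\mathsf{R}_m,\mathsf{S}_1,\dots,\mathsf{S}_m$ with entries in $\mathbb{N}$ such that $\mathsf{A}=\mathsf{R}_1\mathsf{S}_1$, $\mathsf{S}_m\mathsf{R}_m=\mathsf{B}$ and $\mathsf{S}_i\mathsf{R}_i=\mathsf{R}_{i+1}\mathsf{S}_{i+1}$ for $i=1,\dots,m-1$; they are strong shift equivalent if this holds for some $m$. C*-correspondences: an $\mathcal{A}$-$\mathcal{B}$-correspondence is a right Hilbert $\mathcal{B}$-module $X$ with a $*$-homomorphism $\phi_X:\mathcal{A}\to\mathcal{L}(X)$; all correspondences are assumed non-degenerate (closed linear span of $\phi_X(\mathcal{A})X$ is $X$). An $\mathcal{A}$-correspondence is an $\mathcal{A}$-$\mathcal{A}$-correspondence. $\otimes$ is the interior tensor product; $\cong$ is unitary isomorphism (surjective inner-product-preserving bimodule map). An $\mathcal{A}$-correspondence $X$ and a $\mathcal{B}$-correspondence $Y$ are strong shift equivalent with lag $m$ if there are C*-algebras $\mathcal{C}_0=\mathcal{A},\mathcal{C}_1,\dots,\mathcal{C}_m=\mathcal{B}$,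 $\mathcal{C}_{i-1}$-$\mathcal{C}_i$-correspondences $R_i$ and $\mathcal{C}_i$-$\mathcal{C}_{i-1}$-correspondences $S_i$ ($1\le i\le m$) with $X\cong R_1\otimes S_1$, $S_m\otimes R_m\cong Y$ and $S_i\otimes R_i\cong R_{i+1}\otimes S_{i+1}$ for $1\le i\le m-1$; strong shift equivalent means this for some $m\ge1$. Graph correspondence: for a finite $V\times V$ matrix $\mathsf{A}$ with entries in $\mathbb{N}$, let $c(V)$ be the C*-algebra of functions $V\to\mathbb{C}$, $E_{\mathsf{A}}=\{(v,\alpha,w): v,w\in V,\ 0\le\alpha<\mathsf{A}_{vw}\}$, and $X(\mathsf{A})$ the space of functions $E_{\mathsf{A}}\to\mathbb{C}$, a $c(V)$-correspondence via $(a\cdot\xi\cdot b)(v,\alpha,w)=a(v)\xi(v,\alpha,w)b(w)$ and $\langle\xi,\eta\rangle(w)=\sum_{(v,\alpha,w)\in E_{\mathsf{A}}}\overline{\xi(v,\alpha,w)}\eta(v,\alpha,w)$. *)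

(* Defs.v *)
From HB Require Import structures.
From mathcomp Require Import all_boot all_order all_algebra.
From mathcomp Require Import all_classical all_reals all_analysis.
From mathcomp Require Import complex ring.
Set Implicit Arguments.
Unset Strict Implicit.
Unset Printing Implicit Defensive.
Import Order.TTheory GRing.Theory Num.Theory.
Import numFieldTopology.Exports numFieldNormedType.Exports.
Local Open Scope classical_set_scope.
Local Open Scope ring_scope.

(* C*-algebras are not assumed to be unital, so they are not built on the ring
   structures of MathComp. *)
HB.mixin Record isCStarAlgebra (R : realType) A
    of CompleteNormedModule R[i] A := {
  cmul : A -> A -> A;
  star : A -> A;
  cmulA : forall a b c, cmul a (cmul b c) = cmul (cmul a b) c;
  cmul_linearl : forall (l : R[i]) a b c,
    cmul (l *: a + b) c = l *: cmul a c + cmul b c;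
  cmul_linearr : forall (l : R[i]) a b c,
    cmul a (l *: b + c) = l *: cmul a b + cmul a c;
  star_antilinear : forall (l : R[i]) a b,
    star (l *: a + b) = Num.conj l *: star a + star b;
  starM : forall a b, star (cmul a b) = cmul (star b) (star a);
  starK : forall a, star (star a) = a;
  norm_cmul_le : forall a b, `|cmul a b| <= `|a| * `|b|;
  cstar_identity : forall a, `|cmul (star a) a| = `|a| ^+ 2
}.

#[short(type="cstarType")]
HB.structure Definition CStarAlgebra (R : realType) :=
  { A of CompleteNormedModule R[i] A & isCStarAlgebra R A }.

Definition cpositive (R : realType) (B : cstarType R) (b : B) : Prop :=
  exists c : B, b = cmul (star c) c.

(* The inner product is linear in its second argument. The norm of the module
   is the one given by the inner product, so completeness is completeness in
   the norm |x| = |<x, x>|^(1/2). *)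
HB.mixin Record isHilbertModule (R : realType) (B : cstarType R) X
    of CompleteNormedModule R[i] X := {
  ract : X -> B -> X;
  inner : X -> X -> B;
  ract_linearl : forall (l : R[i]) x y b,
    ract (l *: x + y) b = l *: ract x b + ract y b;
  ract_linearr : forall (l : R[i]) x b c,
    ract x (l *: b + c) = l *: ract x b + ract x c;
  ractM : forall x b c, ract x (cmul b c) = ract (ract x b) c;
  inner_linearr : forall (l : R[i]) x y z,
    inner x (l *: y + z) = l *: inner x y + inner x z;
  inner_ract : forall x y b, inner x (ract y b) = cmul (inner x y) b;
  inner_star : forall x y, inner y x = star (inner x y);
  inner_positive : forall x, cpositive (inner x x);
  inner_definite : forall x, inner x x = 0 -> x = 0;
  normr_inner : forall x, `|x| ^+ 2 = `|inner x x|
}.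

#[short(type="hilbertModuleType")]
HB.structure Definition HilbertModule (R : realType) (B : cstarType R) :=
  { X of CompleteNormedModule R[i] X & isHilbertModule R B X }.

Definition linear_span (K : numFieldType) (V : lmodType K) (S : set V) : set V :=
  [set v | exists n (c : 'I_n -> K) (w : 'I_n -> V),
     (forall i, S (w i)) /\ v = \sum_(i < n) c i *: w i].

(* lact is the *-homomorphism from A to the adjointable operators on X:
   lact_adjoint says that each lact a is adjointable (hence linear over B),
   with adjoint lact (star a). *)
HB.mixin Record isCorrespondence (R : realType) (A B : cstarType R) X
    of HilbertModule R B X := {
  lact : A -> X -> X;
  lact_linear : forall (l : R[i]) a b x,
    lact (l *: a + b) x = l *: lact a x + lact b x;
  lactM : forall a b x, lact (cmul a b) x = lact a (lact b x);
  lact_adjoint : forall a x y,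
    inner (lact a x) y = inner x (lact (star a) y) :> B;
  lact_nondegenerate :
    closure (linear_span [set lact p.1 p.2 | p in [set: A * X]]) = [set: X]
}.

#[short(type="correspondenceType")]
HB.structure Definition Correspondence (R : realType) (A B : cstarType R) :=
  { X of HilbertModule R B X & isCorrespondence R A B X }.

Local Notation normc := ComplexField.Normc.normc.

Lemma coordinate_complete_real (R : realType) (V : normedModType R[i])
    (J : finType) (ev : J -> V -> R) (rebuild : (J -> R) -> V) :
  (forall j f g, ev j (f - g) = ev j f - ev j g) ->
  (forall j f, (`|ev j f|%:C)%C <= `|f|) ->
  (forall f, `|f| <= ((\sum_j `|ev j f|)%:C)%C) ->
  (forall g j, ev j (rebuild g) = g j) ->
  forall F : set_system V, ProperFilter F -> cauchy F -> cvg F.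
Proof.
move=> evB ev_le le_ev evK F FF Fc.
have Rcvg j : cvg (ev j @ F).
  apply: R_complete; apply: cauchy_exP => _/posnumP[e].
  have eC : (0 : R[i]) < (e%:num%:C)%C by rewrite ltcR.
  have /cauchyP/(_ _ eC)[x Fx] := Fc.
  exists (ev j x); change (F (ev j @^-1` ball (ev j x) e%:num)); apply: filterS Fx => y.
  rewrite -ball_normE /= => xy; change (`|ev j x - ev j y| < e%:num); rewrite -evB.
  by rewrite -ltcR; apply: le_lt_trans (ev_le _ _) xy.
pose l := rebuild (fun j => lim (ev j @ F)).
apply/cvg_ex; exists l; apply/cvgrPdist_lt => e e0.
have [r re r0] : exists2 r : R, e = (r%:C)%C & 0 < r.
  move: e0; rewrite ltcE => /andP[/eqP ie re]; exists (complex.Re e) => //.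
  by case: e ie re => a b /= ->.
pose d := r / (#|J|.+1)%:R.
have d0 : 0 < d by rewrite divr_gt0.
have : \forall f \near F, forall j, `|lim (ev j @ F) - ev j f| < d.
  apply: filter_forall => j.
  by have /cvgrPdist_lt/(_ _ d0) := Rcvg j.
apply: filterS => f fd; apply: le_lt_trans (le_ev _) _.
rewrite re ltcR; apply: (@le_lt_trans _ _ (\sum_(j : J) d)).
  by apply: ler_sum => j _; rewrite evB evK; exact: ltW.
rewrite sumr_const -(mulr_natr d) -[r in ltRHS](divfK (_ : (#|J|.+1)%:R != 0)) ?pnatr_eq0 //.
by rewrite ltr_pM2l // ltr_nat; exact: ltnSn.
Qed.

Lemma coordinate_complete (R : realType) (V : normedModType R[i])
    (I : finType) (ev : I -> V -> R[i]) (rebuild : (I -> R[i]) -> V) :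
  (forall i f g, ev i (f - g) = ev i f - ev i g) ->
  (forall i f, `|ev i f| <= `|f|) ->
  (forall f, `|f| <= \sum_i `|ev i f|) ->
  (forall g i, ev i (rebuild g) = g i) ->
  forall F : set_system V, ProperFilter F -> cauchy F -> cvg F.
Proof.
move=> evB ev_le le_ev evK.
pose ev' (j : I + I) f :=
  match j with inl i => complex.Re (ev i f) | inr i => complex.Im (ev i f) end.
pose rebuild' (g : I + I -> R) := rebuild (fun i => Complex (g (inl i)) (g (inr i))).
have normIm (z : R[i]) : (`|complex.Im z|%:C)%C <= `|z|.
  by case: z => a b; rewrite lecR -sqrtr_sqr ler_wsqrtr // lerDr sqr_ge0.
have norm_le (z : R[i]) : `|z| <= ((`|complex.Re z| + `|complex.Im z|)%:C)%C.
  case: z => a b; rewrite lecR /= -[leRHS]ger0_norm ?addr_ge0//.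
  rewrite -sqrtr_sqr ler_wsqrtr // sqrrD !real_normK ?num_real//.
  by rewrite lerD2r lerDl mulrn_wge0 // mulr_ge0.
apply: (@coordinate_complete_real _ _ _ ev' rebuild').
- by case=> i f g /=; rewrite evB raddfB.
- case=> i f /=; apply: le_trans (ev_le i f); last exact: normIm.
  exact: normc_ge_Re.
- move=> f; apply: le_trans (le_ev f) _; rewrite big_sumType /= -big_split /=.
  rewrite rmorph_sum; apply: ler_sum => i _; exact: norm_le.
- by move=> g [] i; rewrite /= evK.
Qed.

Section complex_norm_facts.
Variable R : realType.
Implicit Types x y : R[i].

Lemma normc_ge0 x : 0 <= normc x.
Proof. by case: x => a b; exact: sqrtr_ge0. Qed.

Lemma normcE_real x : `|x| = ((normc x)%:C)%C.
Proof. by []. Qed.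

Lemma normc_conj x : normc (Num.conj x) = normc x.
Proof. by case: x => a b /=; rewrite sqrrN. Qed.

Lemma conj_mul_normc x : Num.conj x * x = ((normc x ^+ 2)%:C)%C.
Proof. by rewrite rmorphXn /= -normcE_real normCKC. Qed.

Lemma normc_real (r : R) : 0 <= r -> normc (r%:C)%C = r.
Proof. by move=> r0 /=; rewrite expr0n addr0 sqrtr_sqr ger0_norm. Qed.

Lemma bigmax_sqr (I : finType) (F : I -> R) : (forall i, 0 <= F i) ->
  (\big[Num.max/0]_i F i) ^+ 2 = \big[Num.max/0]_i F i ^+ 2.
Proof.
move=> F0.
suff [_ ->//] : 0 <= \big[Num.max/0]_i F i /\
  (\big[Num.max/0]_i F i) ^+ 2 = \big[Num.max/0]_i F i ^+ 2.
apply: (big_ind2 (fun a b => 0 <= a /\ a ^+ 2 = b)); first by rewrite expr0n.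
- move=> a b c d [a0 <-] [c0 <-]; split; first by rewrite le_max a0.
  case: (leP a c) => ac; first by rewrite max_r // ler_sqr ?nnegrE.
  by rewrite max_l // ltW // ltr_sqr ?nnegrE.
- by move=> i _; split.
Qed.

Lemma l2_triangle (I : finType) (P : pred I) (a b : I -> R) :
  (forall i, 0 <= a i) -> (forall i, 0 <= b i) ->
  Num.sqrt (\sum_(i | P i) (a i + b i) ^+ 2) <=
  Num.sqrt (\sum_(i | P i) a i ^+ 2) + Num.sqrt (\sum_(i | P i) b i ^+ 2).
Proof.
move=> a0 b0.
set Sa := \sum_(i | P i) a i ^+ 2; set Sb := \sum_(i | P i) b i ^+ 2.
pose Sab := \sum_(i | P i) a i * b i.
have Sa0 : 0 <= Sa by apply: sumr_ge0 => i _; exact: sqr_ge0.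
have Sb0 : 0 <= Sb by apply: sumr_ge0 => i _; exact: sqr_ge0.
have Sab0 : 0 <= Sab by apply: sumr_ge0 => i _; exact: mulr_ge0.
have CS : Sab ^+ 2 <= Sa * Sb.
  have : 0 <= \sum_(i | P i) (Sb * a i - Sab * b i) ^+ 2.
    by apply: sumr_ge0 => i _; exact: sqr_ge0.
  have -> : \sum_(i | P i) (Sb * a i - Sab * b i) ^+ 2 =
      Sb * (Sa * Sb - Sab ^+ 2).
    have E (s t : R) : \sum_(i | P i) (s * a i - t * b i) ^+ 2 =
        s ^+ 2 * Sa - (s * t) *+ 2 * Sab + t ^+ 2 * Sb.
      rewrite /Sa /Sab /Sb !mulr_sumr -sumrB -big_split /=.
      by apply: eq_bigr => i _; ring.
    by rewrite E; ring.
  have [Sb_eq0 _|Sb_neq0] := eqVneq Sb 0; last first.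
    by rewrite pmulr_rge0 ?subr_ge0// lt0r Sb_neq0.
  have bz i : P i -> b i = 0.
    move=> Pi; apply/eqP; rewrite -sqrf_eq0; apply/eqP.
    apply: (psumr_eq0P _ Sb_eq0) => // j _; exact: sqr_ge0.
  rewrite Sb_eq0 mulr0 /Sab big1 ?expr0n// => i Pi; by rewrite bz ?mulr0.
rewrite -[leRHS]ger0_norm ?addr_ge0 ?sqrtr_ge0// -sqrtr_sqr ler_wsqrtr//.
rewrite sqrrD !sqr_sqrtr// -sqrtrM//.
have -> : \sum_(i | P i) (a i + b i) ^+ 2 = Sa + Sab *+ 2 + Sb.
  rewrite /Sa /Sb /Sab -sumrMnl -!big_split /=.
  by apply: eq_bigr => i _; rewrite sqrrD.
rewrite lerD2r lerD2l lerMn2r /=.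
by rewrite -[leLHS]ger0_norm// -sqrtr_sqr ler_wsqrtr.
Qed.

End complex_norm_facts.

Definition cfun (R : realType) (V : finType) : Type := {ffun V -> R[i]}.

HB.instance Definition _ (R : realType) (V : finType) :=
  GRing.Lmodule.copy (cfun R V) {ffun V -> R[i]^o}.

Section cfun_cstar.
Variables (R : realType) (V : finType).
Implicit Types (a b c : cfun R V) (l : R[i]).

Definition cfun_norm a : R[i] := ((\big[Num.max/0]_v normc (a v))%:C)%C.
Definition cfun_mul a b : cfun R V := [ffun v => a v * b v].
Definition cfun_star a : cfun R V := [ffun v => Num.conj (a v)].

Fact cfun_normD a b : cfun_norm (a + b) <= cfun_norm a + cfun_norm b.
Proof.
rewrite /cfun_norm -rmorphD lecR; apply/bigmax_leP; split=> [|v _].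
  by rewrite addr_ge0// bigmax_ge_id.
rewrite ffunE; apply: le_trans (le_normcD _ _) _.
by apply: lerD; exact: le_bigmax.
Qed.

Fact cfun_normZ l a : cfun_norm (l *: a) = `|l| * cfun_norm a.
Proof.
rewrite /cfun_norm normcE_real -rmorphM /=; congr (_%:C)%C.
rewrite -[LHS](@eq_bigr _ _ _ _ _ _ (fun v => normc l * normc (a v))); last first.
  by move=> v _; rewrite ffunE ComplexField.Normc.normcM.
apply/esym/(big_morph (fun r => normc l * r)); last exact: mulr0.
by move=> x y; rewrite maxr_pMr// normc_ge0.
Qed.

Fact cfun_norm_eq0 a : cfun_norm a = 0 -> a = 0.
Proof.
move=> /complexI a0; apply/ffunP => v; rewrite ffunE.
apply: ComplexField.Normc.eq0_normc; apply/eqP.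
by rewrite eq_le normc_ge0 andbT -a0 le_bigmax.
Qed.

HB.instance Definition _ :=
  Lmodule_isNormed.Build R[i] (cfun R V) cfun_normD cfun_normZ cfun_norm_eq0.

Fact cfun_complete (F : set_system (cfun R V)) :
  ProperFilter F -> cauchy F -> cvg F.
Proof.
apply: (@coordinate_complete R (cfun R V) V (fun v a => a v)
          (fun g => [ffun v => g v])).
- by move=> v f g; rewrite !ffunE.
- by move=> v f; rewrite normcE_real lecR le_bigmax.
- move=> f; rewrite -(rmorph_sum (real_complex R)) lecR.
  apply/bigmax_leP; split=> [|v _]; first by apply: sumr_ge0 => i _; exact: normc_ge0.
  by rewrite (bigD1 v)//= lerDl sumr_ge0// => i _; exact: normc_ge0.
- by move=> g v; rewrite ffunE.
Qed.

HB.instance Definition _ := Uniform_isComplete.Build (cfun R V) cfun_complete.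

Fact cfun_mulA a b c :
  cfun_mul a (cfun_mul b c) = cfun_mul (cfun_mul a b) c.
Proof. by apply/ffunP => v; rewrite !ffunE mulrA. Qed.

Fact cfun_mul_linearl l a b c :
  cfun_mul (l *: a + b) c = l *: cfun_mul a c + cfun_mul b c.
Proof. by apply/ffunP => v; rewrite !ffunE mulrDl scalerAl. Qed.

Fact cfun_mul_linearr l a b c :
  cfun_mul a (l *: b + c) = l *: cfun_mul a b + cfun_mul a c.
Proof. by apply/ffunP => v; rewrite !ffunE mulrDr scalerAr. Qed.

Fact cfun_star_antilinear l a b :
  cfun_star (l *: a + b) = Num.conj l *: cfun_star a + cfun_star b.
Proof. by apply/ffunP => v; rewrite !ffunE rmorphD rmorphM. Qed.

Fact cfun_starM a b :
  cfun_star (cfun_mul a b) = cfun_mul (cfun_star b) (cfun_star a).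
Proof. by apply/ffunP => v; rewrite !ffunE rmorphM mulrC. Qed.

Fact cfun_starK a : cfun_star (cfun_star a) = a.
Proof. by apply/ffunP => v; rewrite !ffunE conjCK. Qed.

Fact cfun_norm_mul_le a b : `|cfun_mul a b| <= `|a| * `|b|.
Proof.
rewrite -[`|a|]/(cfun_norm a) -[`|b|]/(cfun_norm b).
rewrite -rmorphM lecR; apply/bigmax_leP; split=> [|v _].
  by rewrite mulr_ge0// bigmax_ge_id.
rewrite ffunE ComplexField.Normc.normcM.
by rewrite ler_pM ?normc_ge0//; exact: le_bigmax.
Qed.

Fact cfun_cstar_identity a : `|cfun_mul (cfun_star a) a| = `|a| ^+ 2.
Proof.
rewrite -[`|a|]/(cfun_norm a) -rmorphXn /= bigmax_sqr; last first.
  by move=> v; exact: normc_ge0.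
congr (_%:C)%C; apply: eq_bigr => v _.
by rewrite !ffunE conj_mul_normc normc_real// sqr_ge0.
Qed.

HB.instance Definition _ := isCStarAlgebra.Build R (cfun R V)
  cfun_mulA cfun_mul_linearl cfun_mul_linearr cfun_star_antilinear
  cfun_starM cfun_starK cfun_norm_mul_le cfun_cstar_identity.

End cfun_cstar.

(* The edge (v, alpha, w) is Tagged _ (alpha : 'I_(A v w)) over the pair (v, w). *)
Definition edge (m n : nat) (A : 'M[nat]_(m, n)) : finType :=
  {p : 'I_m * 'I_n & 'I_(A p.1 p.2)}.

Definition esource m n (A : 'M[nat]_(m, n)) (e : edge A) : 'I_m := (tag e).1.
Definition erange m n (A : 'M[nat]_(m, n)) (e : edge A) : 'I_n := (tag e).2.

Definition edge_fun (R : realType) m n (A : 'M[nat]_(m, n)) : Type :=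
  {ffun edge A -> R[i]}.

HB.instance Definition _ (R : realType) m n (A : 'M[nat]_(m, n)) :=
  GRing.Lmodule.copy (edge_fun R A) {ffun edge A -> R[i]^o}.

Section edge_fun_correspondence.
Variables (R : realType) (m n : nat) (A : 'M[nat]_(m, n)).
Local Notation X := (edge_fun R A).
Local Notation cV := (cfun R 'I_m).
Local Notation cW := (cfun R 'I_n).
Implicit Types (x y z : X) (l : R[i]).

Definition edge_fun_norm x : R[i] :=
  ((\big[Num.max/0]_w
      Num.sqrt (\sum_(e | erange e == w) normc (x e) ^+ 2))%:C)%C.
Definition edge_fun_lact (a : cV) x : X := [ffun e => a (esource e) * x e].
Definition edge_fun_ract x (b : cW) : X := [ffun e => x e * b (erange e)].
Definition edge_fun_inner x y : cW :=
  [ffun w => \sum_(e | erange e == w) Num.conj (x e) * y e].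

Fact edge_fun_normD x y :
  edge_fun_norm (x + y) <= edge_fun_norm x + edge_fun_norm y.
Proof.
rewrite /edge_fun_norm -rmorphD lecR; apply/bigmax_leP; split=> [|w _].
  by rewrite addr_ge0// bigmax_ge_id.
apply: le_trans (lerD (le_bigmax _ _ w) (le_bigmax _ _ w)).
apply: le_trans (l2_triangle _ _ _); last 2 first.
- by move=> e; exact: normc_ge0.
- by move=> e; exact: normc_ge0.
rewrite ler_wsqrtr//; apply: ler_sum => e _; rewrite ffunE.
by rewrite ler_sqr ?nnegrE ?addr_ge0 ?normc_ge0// le_normcD.
Qed.

Fact edge_fun_normZ l x : edge_fun_norm (l *: x) = `|l| * edge_fun_norm x.
Proof.
rewrite /edge_fun_norm normcE_real -rmorphM /=; congr (_%:C)%C.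
rewrite -[LHS](@eq_bigr _ _ _ _ _ _ (fun w => normc l *
   Num.sqrt (\sum_(e | erange e == w) normc (x e) ^+ 2))); last first.
  move=> w _; rewrite -[in LHS](ger0_norm (normc_ge0 l)) -sqrtr_sqr.
  rewrite -sqrtrM ?sqr_ge0// mulr_sumr; congr Num.sqrt; apply: eq_bigr => e _.
  by rewrite ffunE ComplexField.Normc.normcM exprMn.
apply/esym/(big_morph (fun r => normc l * r)); last exact: mulr0.
by move=> a b; rewrite maxr_pMr// normc_ge0.
Qed.

Fact edge_fun_norm_ge x e : ((normc (x e))%:C)%C <= edge_fun_norm x.
Proof.
rewrite lecR; apply: le_trans (le_bigmax _ _ (erange e)).
rewrite -[leLHS]ger0_norm ?normc_ge0// -sqrtr_sqr ler_wsqrtr//.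
by rewrite (bigD1 e)//= lerDl sumr_ge0// => f _; exact: sqr_ge0.
Qed.

Fact edge_fun_norm_eq0 x : edge_fun_norm x = 0 -> x = 0.
Proof.
move=> x0; apply/ffunP => e; rewrite ffunE.
apply: ComplexField.Normc.eq0_normc; apply/eqP.
by rewrite eq_le normc_ge0 andbT -lecR -[leRHS]x0 edge_fun_norm_ge.
Qed.

HB.instance Definition _ := Lmodule_isNormed.Build R[i] X
  edge_fun_normD edge_fun_normZ edge_fun_norm_eq0.

Fact edge_fun_complete (F : set_system X) :
  ProperFilter F -> cauchy F -> cvg F.
Proof.
apply: (@coordinate_complete R X (edge A) (fun e x => x e)
          (fun g => [ffun e => g e])).
- by move=> e f g; rewrite !ffunE.
- by move=> e f; exact: edge_fun_norm_ge.
- move=> f; rewrite -(rmorph_sum (real_complex R)) lecR.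
  apply/bigmax_leP; split=> [|w _].
    by apply: sumr_ge0 => i _; exact: normc_ge0.
  rewrite -[leRHS]ger0_norm; last by apply: sumr_ge0 => i _; exact: normc_ge0.
  rewrite -sqrtr_sqr ler_wsqrtr// expr2 mulr_suml.
  apply: (@le_trans _ _ (\sum_e normc (f e) ^+ 2)).
    rewrite [leRHS](bigID (fun e => erange e == w))/= lerDl sumr_ge0// => e _.
    exact: sqr_ge0.
  apply: ler_sum => e _; rewrite expr2 ler_wpM2l ?normc_ge0//.
  by rewrite (bigD1 e)//= lerDl sumr_ge0// => i _; exact: normc_ge0.
- by move=> g e; rewrite ffunE.
Qed.

HB.instance Definition _ := Uniform_isComplete.Build X edge_fun_complete.

Fact edge_fun_ract_linearl l x y b :
  edge_fun_ract (l *: x + y) b = l *: edge_fun_ract x b + edge_fun_ract y b.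
Proof. by apply/ffunP => e; rewrite !ffunE mulrDl scalerAl. Qed.

Fact edge_fun_ract_linearr l x (b c : cW) :
  edge_fun_ract x (l *: b + c) = l *: edge_fun_ract x b + edge_fun_ract x c.
Proof. by apply/ffunP => e; rewrite !ffunE mulrDr scalerAr. Qed.

Fact edge_fun_ractM x (b c : cW) :
  edge_fun_ract x (cmul b c) = edge_fun_ract (edge_fun_ract x b) c.
Proof. by apply/ffunP => e; rewrite !ffunE mulrA. Qed.

Fact edge_fun_inner_linearr l x y z :
  edge_fun_inner x (l *: y + z) = l *: edge_fun_inner x y + edge_fun_inner x z.
Proof.
apply/ffunP => w; rewrite !ffunE scaler_sumr -big_split /=.
by apply: eq_bigr => e _; rewrite !ffunE mulrDr scalerAr.
Qed.

Fact edge_fun_inner_ract x y b :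
  edge_fun_inner x (edge_fun_ract y b) = cmul (edge_fun_inner x y) b.
Proof.
apply/ffunP => w; rewrite !ffunE mulr_suml; apply: eq_bigr => e /eqP <-.
by rewrite !ffunE mulrA.
Qed.

Fact edge_fun_inner_star x y : edge_fun_inner y x = star (edge_fun_inner x y).
Proof.
apply/ffunP => w; rewrite !ffunE rmorph_sum; apply: eq_bigr => e _ /=.
by rewrite rmorphM /= conjCK mulrC.
Qed.

Lemma edge_fun_innerE x w : edge_fun_inner x x w =
  ((\sum_(e | erange e == w) normc (x e) ^+ 2)%:C)%C.
Proof.
by rewrite ffunE rmorph_sum; apply: eq_bigr => e _; rewrite conj_mul_normc.
Qed.

Fact edge_fun_inner_positive x : cpositive (edge_fun_inner x x).
Proof.
exists [ffun w => ((Num.sqrt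
  (\sum_(e | erange e == w) normc (x e) ^+ 2))%:C)%C].
apply/ffunP => w; rewrite edge_fun_innerE !ffunE conj_mul_normc.
rewrite normc_real ?sqrtr_ge0// sqr_sqrtr//.
by apply: sumr_ge0 => e _; exact: sqr_ge0.
Qed.

Fact edge_fun_normr_inner x : `|x| ^+ 2 = `|edge_fun_inner x x|.
Proof.
rewrite -[`|x|]/(edge_fun_norm x) -rmorphXn /= bigmax_sqr; last first.
  by move=> w; exact: sqrtr_ge0.
congr (_%:C)%C; apply: eq_bigr => w _.
have S0 : 0 <= \sum_(e | erange e == w) normc (x e) ^+ 2.
  by apply: sumr_ge0 => e _; exact: sqr_ge0.
by rewrite edge_fun_innerE normc_real// sqr_sqrtr.
Qed.

Fact edge_fun_inner_definite x : edge_fun_inner x x = 0 -> x = 0.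
Proof.
move=> x0; apply/eqP; rewrite -normr_eq0 -sqrf_eq0 edge_fun_normr_inner.
by rewrite x0 normr0.
Qed.

HB.instance Definition _ := isHilbertModule.Build R cW X
  edge_fun_ract_linearl edge_fun_ract_linearr edge_fun_ractM
  edge_fun_inner_linearr edge_fun_inner_ract edge_fun_inner_star
  edge_fun_inner_positive edge_fun_inner_definite edge_fun_normr_inner.

Fact edge_fun_lact_linear l (a b : cV) x :
  edge_fun_lact (l *: a + b) x = l *: edge_fun_lact a x + edge_fun_lact b x.
Proof. by apply/ffunP => e; rewrite !ffunE mulrDl scalerAl. Qed.

Fact edge_fun_lactM (a b : cV) x :
  edge_fun_lact (cmul a b) x = edge_fun_lact a (edge_fun_lact b x).
Proof. by apply/ffunP => e; rewrite !ffunE mulrA. Qed.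

Fact edge_fun_lact_adjoint (a : cV) x y :
  inner (edge_fun_lact a x) y = inner x (edge_fun_lact (star a) y) :> cW.
Proof.
apply/ffunP => w; rewrite !ffunE; apply: eq_bigr => e _.
by rewrite !ffunE rmorphM mulrA (mulrC (Num.conj (x e))).
Qed.

Fact edge_fun_lact_nondegenerate :
  closure (linear_span [set edge_fun_lact p.1 p.2 | p in [set: cV * X]])
    = [set: X].
Proof.
rewrite -subTset => x _; apply: subset_closure.
exists 1%N, (fun=> 1), (fun=> x); split; last by rewrite big_ord1 scale1r.
move=> _; exists ([ffun=> 1], x) => //=.
by apply/ffunP => e; rewrite !ffunE mul1r.
Qed.

HB.instance Definition _ := isCorrespondence.Build R cV cW X
  edge_fun_lact_linear edge_fun_lactM edge_fun_lact_adjoint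
  edge_fun_lact_nondegenerate.

End edge_fun_correspondence.

(* Square matrices give the graph correspondence X(A); the same formulas make
   sense for rectangular ones. *)
Definition graph_correspondence (R : realType) m n (A : 'M[nat]_(m, n)) :
  correspondenceType (cfun R 'I_m) (cfun R 'I_n) := edge_fun R A.

Record is_unitary (R : realType) (A B : cstarType R)
    (X Y : correspondenceType A B) (U : X -> Y) : Prop := IsUnitary {
  unitary_linear : forall (l : R[i]) x y, U (l *: x + y) = l *: U x + U y;
  unitary_lact : forall (a : A) x, U (lact a x) = lact a (U x);
  unitary_ract : forall x (b : B), U (ract x b) = ract (U x) b;
  unitary_inner : forall x y, inner (U x) (U y) = inner x y :> B;
  unitary_surjective : forall y, exists x, U x = y
}.

Definition unitarily_isomorphic (R : realType) (A B : cstarType R)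
    (X Y : correspondenceType A B) : Prop :=
  exists U : X -> Y, is_unitary U.

(* The interior tensor product of X and Y over B is the Hausdorff completion of
   the algebraic tensor product for the semi-inner product
   <x (x) y, x' (x) y'> = <y, <x, x'> y'>, with the actions of A on the first
   and D on the second factor. It is represented by any such completion Z,
   given by the canonical map t(x, y) = x (x) y: t is bilinear and balanced,
   thus a map on the algebraic tensor product, which carries the semi-inner
   product and the actions to those of Z and has dense range. *)
Record is_tensor_map (R : realType) (A B D : cstarType R)
    (X : correspondenceType A B) (Y : correspondenceType B D)
    (Z : correspondenceType A D) (t : X -> Y -> Z) : Prop := IsTensorMap {
  tensor_linearl : forall (l : R[i]) x x' y,
    t (l *: x + x') y = l *: t x y + t x' y;
  tensor_linearr : forall (l : R[i]) x y y',
    t x (l *: y + y') = l *: t x y + t x y';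
  tensor_balanced : forall x (b : B) y, t (ract x b) y = t x (lact b y);
  tensor_lact : forall (a : A) x y, t (lact a x) y = lact a (t x y);
  tensor_ract : forall x y (d : D), t x (ract y d) = ract (t x y) d;
  tensor_inner : forall x y x' y',
    inner (t x y) (t x' y') = inner y (lact (inner x x' : B) y') :> D;
  tensor_dense :
    closure (linear_span [set t p.1 p.2 | p in [set: X * Y]]) = [set: Z]
}.

Definition is_interior_tensor (R : realType) (A B D : cstarType R)
    (X : correspondenceType A B) (Y : correspondenceType B D)
    (Z : correspondenceType A D) : Prop :=
  exists t : X -> Y -> Z, is_tensor_map t.

(* With lag m = k + 1, the correspondences R_(i+1) and S_(i+1) are P i and Q i
   for 0 <= i <= k, and PQ i, QP i are models of the interior tensor products
   R_(i+1) (x) S_(i+1) and S_(i+1) (x) R_(i+1). Entries of the families beyond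
   the index k (k + 1 for C) are irrelevant. *)
Inductive correspondence_sse_lag (R : realType) : nat ->
    forall A B : cstarType R,
      correspondenceType A A -> correspondenceType B B -> Prop :=
| CorrespondenceSSELag k (C : nat -> cstarType R)
    (P : forall i, correspondenceType (C i) (C i.+1))
    (Q : forall i, correspondenceType (C i.+1) (C i))
    (PQ : forall i, correspondenceType (C i) (C i))
    (QP : forall i, correspondenceType (C i.+1) (C i.+1))
    (X : correspondenceType (C 0%N) (C 0%N))
    (Y : correspondenceType (C k.+1) (C k.+1)) :
    (forall i, (i <= k)%N -> is_interior_tensor (P i) (Q i) (PQ i)) ->
    (forall i, (i <= k)%N -> is_interior_tensor (Q i) (P i) (QP i)) ->
    unitarily_isomorphic X (PQ 0%N) ->
    (forall i, (i < k)%N -> unitarily_isomorphic (QP i) (PQ i.+1)) ->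
    unitarily_isomorphic (QP k) Y ->
    correspondence_sse_lag k.+1 X Y.

Definition correspondence_sse (R : realType) (A B : cstarType R)
    (X : correspondenceType A A) (Y : correspondenceType B B) : Prop :=
  exists2 m, (1 <= m)%N & correspondence_sse_lag m X Y.

Inductive matrix_sse_lag : nat ->
    forall p q, 'M[nat]_p -> 'M[nat]_q -> Prop :=
| MatrixSSELag k (d : nat -> nat)
    (P : forall i, 'M[nat]_(d i, d i.+1))
    (Q : forall i, 'M[nat]_(d i.+1, d i))
    (A : 'M[nat]_(d 0%N)) (B : 'M[nat]_(d k.+1)) :
    A = P 0%N *m Q 0%N ->
    (forall i, (i < k)%N -> Q i *m P i = P i.+1 *m Q i.+1) ->
    Q k *m P k = B ->
    matrix_sse_lag k.+1 A B.

Definition matrix_sse p q (A : 'M[nat]_p) (B : 'M[nat]_q) : Prop :=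
  exists2 m, (1 <= m)%N & matrix_sse_lag m A B.

Definition essential_matrix m n (A : 'M[nat]_(m, n)) : Prop :=
  (forall i, row i A <> 0) /\ (forall j, col j A <> 0).

(* Main.v *)
Require Import Defs.
From mathcomp Require Import all_boot all_order all_algebra.
From mathcomp Require Import all_classical all_reals all_analysis.
From mathcomp Require Import complex ring.

(* For matrices, X(P) (x) X(Q) is X(PQ), as the edges of PQ correspond to the
   pairs of composable edges of P and Q.

   For the converse the intermediate algebras C_i are arbitrary, and the matrices
   are found by counting dimensions. Let T_i = P_0 (x) ... (x) P_(i-1), a right
   Hilbert module over C_i, and call a representation H of C_i good when
   T_i (x) H is finite dimensional and the finite rank operators on T_i act on it
   through their action on T_i (x) Q_(i-1) (x) ... (x) Q_0 (x) l^2(V). The image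
   of these operators is then a finite dimensional *-algebra, so that, as far as
   T_i can see, every good representation is a direct sum of finitely many L_b,
   the multiplicity of L_b in H being the dimension of the range of a minimal
   projection p_b on T_i (x) H. Tensoring with P_i and Q_i preserves goodness;
   let R_i and S_i be the matrices of the multiplicities in P_i (x) L_b and
   Q_i (x) L_b. Multiplicities are additive, so that R_i S_i and S_i R_i are the
   multiplicities in P_i (x) Q_i (x) L_b and Q_i (x) P_i (x) L_b, whence
   S_i R_i = R_(i+1) S_(i+1). At the two ends the L_b may be chosen to be the
   evaluations at the vertices, which gives the matrices A and B; at the far end
   it takes the essentiality of B to see that these are good and do occur.

   Completions are avoided: Hilbert spaces are replaced by sets of generators with
   a semi-inner product. *)

Set Implicit Arguments.
Unset Strict Implicit.
Unset Printing Implicit Defensive.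
Import Order.TTheory GRing.Theory Num.Theory.
Import numFieldTopology.Exports numFieldNormedType.Exports.
Local Open Scope classical_set_scope.
Local Open Scope ring_scope.

(** * Star algebras of matrices *)

(** The algebras [C i] may be wild and the modules need not be full, so only the part of [C i]
    reached by the inner products of [Tm i] is under control; every multiplicity is therefore
    measured on T_i (x) H. Finite dimension alone would not do: two representations could have
    unrelated finite dimensional images, without a common list of the L_b. The reference [Nm i],
    obtained from the faithful l^2(V), supplies one image through which all the others factor.

    Representations are compared through the elements that they annihilate. These do not change
    under an isometry with dense range, and those of X (x) H depend only on those of H, so that P_i
    (x) Q_i and its model Y_i are interchangeable without completing anything.

    The positivity of the form on T (x) H must be obtained by hand: the algebras need not have a
    unit, and it rests on square roots of 1 - a written without 1.

    At the far end, the absence of zero rows keeps every vertex alive in Q_k (x) ... (x) Q_0 (x)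
    l^2(V), and the absence of zero columns lets the last [Tm] reach every vertex. *)

Section star_algebra.
Local Open Scope sesquilinear_scope.
Variable C : numClosedFieldType.

Lemma adjmxM m n p (A : 'M[C]_(m, n)) (B : 'M[C]_(n, p)) :
  (A *m B)^t* = B^t* *m A^t*.
Proof. by rewrite trmx_mul map_mxM. Qed.

Lemma sum_mul_adj_eq0 m n p (s : seq 'M[C]_(n, p)) (u : 'M[C]_(m, n)) :
  u *m (\sum_(a <- s) a *m a^t*) = 0 -> forall a, a \in s -> u *m a = 0.
Proof.
move=> u0 a sa; apply/matrixP => i j; rewrite [RHS]mxE.
have : (u *m (\sum_(a <- s) a *m a^t*) *m u^t*) i i = 0 by rewrite u0 mul0mx mxE.
rewrite mulmx_sumr mulmx_suml summxE.
under eq_bigr => b _ do rewrite mulmxA -mulmxA -adjmxM mxE.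
move=> E; have F b : 0 <= \sum_k (u *m b) i k * (u *m b)^t* k i.
  by apply: sumr_ge0 => k _; rewrite !mxE mul_conjC_ge0.
have {}E : \sum_k (u *m a) i k * (u *m a)^t* k i = 0.
  move: E sa => + /seq_tnthP[l ->]; rewrite big_tnth => E.
  by apply: (psumr_eq0P _ E) => // b _; exact: F.
have /eqP : (u *m a) i j * (u *m a)^t* j i = 0.
  by apply: (psumr_eq0P _ E) => // k _; rewrite !mxE mul_conjC_ge0.
by rewrite [X in _ * X]mxE [X in _ * (Num.conj X)]mxE mul_conjC_eq0 => /eqP.
Qed.

Lemma mul_adj_eq0 m n (a : 'M[C]_(m, n)) : a *m a^t* = 0 -> a = 0.
Proof.
move=> a0; rewrite -[a]mul1mx; apply: (@sum_mul_adj_eq0 _ _ _ [:: a]).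
  by rewrite big_seq1 mul1mx.
exact: mem_head.
Qed.

Record star_algebra n (A : 'M[C]_n -> Prop) : Prop := StarAlgebra {
  sa0 : A 0;
  saD : forall a b, A a -> A b -> A (a + b);
  saZ : forall l a, A a -> A (l *: a);
  saM : forall a b, A a -> A b -> A (a *m b);
  saS : forall a, A a -> A (a^t*)
}.

Lemma exists_argmin_rank m n (A : 'M[C]_(m, n) -> Prop) a0 : A a0 ->
  exists2 a, A a & forall b, A b -> (\rank a <= \rank b)%N.
Proof.
move=> Aa0; have ex : exists r, `[< exists2 a, A a & \rank a = r >].
  by exists (\rank a0); apply/asboolP; exists a0.
case: (ex_minnP ex) => r /asboolP[a Aa <-] minr; exists a => // b Ab.
by apply: minr; apply/asboolP; exists b.
Qed.

(* [h] is positive, so that it annihilates any vector annihilated by one of its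
   powers; a polynomial in [h] without constant term is then the projection on
   its range. *)
Lemma star_algebra_unit n (A : 'M[C]_n -> Prop) : star_algebra A ->
  exists2 e, A e & e^t* = e /\ forall a, A a -> e *m a = a /\ a *m e = a.
Proof.
move=> AA.
pose h (s : seq 'M[C]_n) := \sum_(a <- s) a *m a^t*.
pose P r := `[< exists2 s, (forall a, a \in s -> A a) & \rank (h s) = r >].
have exP : exists r, P r by exists (\rank (h [::])); apply/asboolP; exists [::].
have ubP r : P r -> (r <= n)%N by move=> /asboolP[s _ <-]; exact: rank_leq_row.
case: (ex_maxnP exP ubP) => r /asboolP[s As <-] maxr.
have hA : A (h s).
  rewrite /h; elim: s As {maxr} => [|a s IH] As; first by rewrite big_nil; exact: sa0.
  rewrite big_cons; apply: (saD AA); last by apply: IH => b bs; apply: As; rewrite inE bs orbT.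
  by apply: (saM AA); last apply: (saS AA); apply: As; exact: mem_head.
have hS : (h s)^t* = h s.
  rewrite /h raddf_sum /= (raddf_sum (map_mx Num.conj)) /=; apply: eq_bigr => a _.
  by rewrite adjmxM trmxCK.
(* Adding [a] to [s] can only shrink the left kernel of [h s]; as the rank of [h s] is maximal, the
   kernel stays the same, and it annihilates [a]. *)
have kerA a : A a -> (kermx (h s) *m a = 0).
  move=> Aa.
  have kle : (kermx (h (a :: s)) <= kermx (h s))%MS.
    apply/sub_kermxP; rewrite {2}/h big_seq mulmx_sumr big1 // => b bs.
    rewrite mulmxA (@sum_mul_adj_eq0 _ _ _ (a :: s) _ _ b) ?mul0mx ?inE ?bs ?orbT //.
    exact: mulmx_ker.
  have kge : (kermx (h s) <= kermx (h (a :: s)))%MS.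
    rewrite -(mxrank_leqif_sup kle) eqn_leq mxrankS // !mxrank_ker leq_sub2l //.
    apply: maxr; apply/asboolP; exists (a :: s) => // b.
    by rewrite inE => /predU1P[->//|/As].
  have /submxP[D ->] := kge.
  rewrite -mulmxA (@sum_mul_adj_eq0 _ _ _ (a :: s) _ _ a) ?mulmx0 ?mem_head //.
  exact: mulmx_ker.
suff [e Ae eh] : exists2 e, A e & e *m h s = h s.
  have ea a : A a -> e *m a = a.
    move=> Aa; apply/eqP; rewrite -subr_eq0 -{2}[a]mul1mx -mulmxBl; apply/eqP.
    have /sub_kermxP/submxP[D ->] : (e - 1%:M) *m h s = 0.
      by rewrite mulmxBl mul1mx eh subrr.
    by rewrite -mulmxA kerA // mulmx0.
  have ae a : A a -> a *m e^t* = a.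
    by move=> Aa; rewrite -[a]trmxCK -adjmxM ea ?trmxCK//; exact: saS.
  have eS : e^t* = e by rewrite -[LHS]ea ?ae //; exact: saS.
  by exists e => //; split=> // a Aa; split; [exact: ea|rewrite -{2}(ae _ Aa) eS].
case: n A AA h P exP ubP s As maxr hA hS kerA => [|n] A AA h P exP ubP s As maxr hA hS kerA.
  by exists 0; [exact: sa0|rewrite [RHS]flatmx0 [LHS]flatmx0].
have hker (u : 'M[C]_n.+1) k : u * h s ^+ k.+1 = 0 -> u * h s = 0.
  elim: k => // k IH u0; apply: IH; apply: mul_adj_eq0.
  have -> : (u * h s ^+ k.+1)^t* = h s ^+ k.+1 * u^t*.
    rewrite [LHS]adjmxM; congr (_ *m _); elim: k {u0} => // k IH.
    by rewrite exprS [LHS]adjmxM IH hS -[_ *m _]/(_ * _) -exprSr.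
  have -> : u * h s ^+ k.+1 *m (h s ^+ k.+1 * u^t*) =
      u * h s ^+ k.+2 * (h s ^+ k * u^t*).
    have E : h s ^+ k.+1 * h s ^+ k.+1 = h s ^+ k.+2 * h s ^+ k.
      by rewrite -exprD -[RHS]exprD [in RHS]addSnnS.
    rewrite -[LHS]/(u * h s ^+ k.+1 * (h s ^+ k.+1 * u^t*)).
    by rewrite -[LHS]mulrA -[RHS]mulrA; congr (_ * _); rewrite !mulrA E.
  by rewrite u0 mul0r.
(* Dividing the characteristic polynomial by its power of ['X] leaves [q] with a nonzero constant
   term; by Cayley-Hamilton and [hker], [q] evaluated at [h s] kills [h s]. Solving for the constant
   term yields [e]. *)
have [m [q q0 pE]] := multiplicity_XsubC (char_poly (h s)) 0.
have {}q0 : q.[0] != 0.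
  by move: q0; rewrite -size_poly_eq0 size_char_poly /= /root.
have hq : horner_mx (h s) q * h s = 0.
  have := Cayley_Hamilton (h s); rewrite pE subr0 rmorphM rmorphXn /= horner_mx_X.
  by case: m {pE} => [|m]; [rewrite expr0 mulr1 => ->; rewrite mul0r|exact: hker].
have [t tE] : exists t, q = t * 'X + (q.[0])%:P.
  have /factor_theorem[t E] : root (q - q.[0]%:P) 0.
    by rewrite /root !hornerE subrr.
  by exists t; rewrite -[q in LHS](subrK q.[0]%:P) E subr0.
exists (- q.[0]^-1 *: horner_mx (h s) (t * 'X)).
  apply: saZ => //; elim/poly_ind: t {tE} => [|t c IH].
    by rewrite mul0r rmorph0; exact: sa0.
  rewrite mulrDl rmorphD rmorphM /= horner_mx_X; apply: (saD AA).
    exact: (saM AA).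
  by rewrite mul_polyC linearZ /= horner_mx_X; apply: (saZ AA).
move: hq; rewrite {1}tE rmorphD /= horner_mx_C mulrDl => /eqP.
rewrite addr_eq0 => /eqP E; rewrite -[_ *m _]/(_ * _) -scalerAl E scaleNr scalerN opprK.
by rewrite -[_ * _]/(_ *m _) mul_scalar_mx scalerA mulVf // scale1r.
Qed.

(** If [e] is the unit of [A], all of [A] kills the columns of [1%:M - e]. *)
Lemma star_algebra_one n (A : 'M[C]_n -> Prop) : star_algebra A ->
  (forall v : 'cV_n, (forall a, A a -> a *m v = 0) -> v = 0) -> A 1%:M.
Proof.
move=> AA nd; have [e Ae [_ eA]] := star_algebra_unit AA.
suff -> : 1%:M = e by [].
apply/eqP; rewrite -subr_eq0; apply/eqP/matrixP => i j.
have /matrixP/(_ i 0) : col j (1%:M - e) = 0; last by rewrite !mxE.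
apply: nd => a Aa; by rewrite colE mulmxA mulmxBr mulmx1 (eA _ Aa).2 subrr mul0mx.
Qed.

(** Pairwise inequivalent minimal projections: compression by [p l] is scalar, given by the vector
    state of [v l], and no element of [A] connects two distinct ones. *)
Definition minimal_projections n (A : 'M[C]_n -> Prop) (L : finType)
    (p : L -> 'M[C]_n) (v : L -> 'cV[C]_n) : Prop :=
  [/\ forall l, [/\ A (p l), (p l)^t* = p l & p l *m p l = p l],
      forall l, p l *m v l = v l /\ (v l)^t* *m v l = 1%:M,
      forall l a, A a -> p l *m a *m p l = ((v l)^t* *m a *m v l) 0 0 *: p l &
      forall l l' a, l != l' -> A a -> p l *m a *m p l' = 0].

(** The two-sided ideal generated by the [p l], presented as finite sums so that membership can be
    lifted term by term to operators. *)
Inductive in_ideal n (A : 'M[C]_n -> Prop) (L : Type) (p : L -> 'M[C]_n) :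
    'M[C]_n -> Prop :=
| in_ideal0 : in_ideal A p 0
| in_idealD a b l x : A a -> A b -> in_ideal A p x ->
    in_ideal A p (a *m p l *m b + x).

Section ideal.
Variables (n : nat) (A : 'M[C]_n -> Prop) (L : Type) (p : L -> 'M[C]_n).
Hypotheses (AA : star_algebra A) (Ap : forall l, A (p l)).
Hypothesis pS : forall l, (p l)^t* = p l.
Local Notation J := (in_ideal A p).

Lemma in_ideal_sub x : J x -> A x.
Proof.
by elim=> [|a b l y Aa Ab _ Ay]; [exact: sa0|apply/(saD AA) => //; do 2?apply/(saM AA)].
Qed.

Lemma in_idealMr x y : A y -> J x -> J (x *m y).
Proof.
move=> Ay; elim=> [|a b l z Aa Ab _ Jz]; first by rewrite mul0mx; exact: in_ideal0.
by rewrite mulmxDl -mulmxA; apply: in_idealD => //; exact: (saM AA).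
Qed.

Lemma in_ideal_algebra : star_algebra J.
Proof.
have JD x y : J x -> J y -> J (x + y).
  by move=> Jx Jy; elim: Jx => [|a b l z Aa Ab _ Jz]; rewrite ?add0r// -addrA; exact: in_idealD.
split=> //; first exact: in_ideal0.
- move=> c x; elim=> [|a b l z Aa Ab _ Jz]; first by rewrite scaler0; exact: in_ideal0.
  by rewrite scalerDr !scalemxAl; apply: in_idealD => //; exact: saZ.
- by move=> x y Jx /in_ideal_sub Ay; exact: in_idealMr.
- move=> x; elim=> [|a b l z Aa Ab _ Jz].
    have -> : (0 : 'M[C]_n)^t* = 0 by apply/matrixP => i j; rewrite !mxE conjC0.
    exact: in_ideal0.
  rewrite raddfD /= (raddfD (map_mx Num.conj)) /= !adjmxM pS mulmxA.
  by apply: in_idealD => //; exact: saS.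
Qed.

End ideal.

Lemma orthonormal_card n (L : finType) (v : L -> 'cV[C]_n) :
  (forall l l', ((v l)^t* *m v l') = (l == l')%:R%:M) -> (#|L| <= n)%N.
Proof.
move=> vo; pose V : 'M[C]_(n, #|L|) := \matrix_(i, j) v (enum_val j) i 0.
have E : V^t* *m V = 1%:M.
  apply/matrixP => i j; have /matrixP/(_ 0 0) := vo (enum_val i) (enum_val j).
  rewrite !mxE (inj_eq enum_val_inj) eqxx mulr1n => <-.
  by apply: eq_bigr => k _; rewrite !mxE.
have := mxrankM_maxr (V^t*) V; rewrite E mxrank1 => /leq_trans; apply.
exact: rank_leq_row.
Qed.

(* [q a q] and [q ^ 2] are proportional when [q] has minimal rank, as a suitable
   combination of them has smaller rank. *)
Lemma exists_minimal_projection n (A : 'M[C]_n -> Prop) (e : 'M[C]_n) :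
  star_algebra A -> A 1%:M -> A e -> e *m e = e -> e <> 1%:M ->
  exists p (v : 'cV_n), [/\ A p, p^t* = p, p *m p = p & e *m p = 0] /\
    [/\ p *m v = v, (v)^t* *m v = 1%:M &
      forall a, A a -> p *m a *m p = ((v)^t* *m a *m v) 0 0 *: p].
Proof.
move=> AA A1 Ae ee e1.
pose B x := [/\ A x, e *m x = 0 & x <> 0].
have B1 : B (1%:M - e).
  split; first by rewrite -scaleN1r; apply: (saD AA) => //; exact: saZ.
    by rewrite mulmxBr mulmx1 ee subrr.
  by move=> /eqP; rewrite subr_eq0 eq_sym => /eqP.
have [x [Ax ex x0] minx] := exists_argmin_rank B1.
have [q qdef] : exists q, q = x *m x^t* by exists (x *m x^t*).
have qS : q^t* = q by rewrite qdef adjmxM trmxCK.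
have Bq : B q.
  rewrite qdef; split; [by apply: (saM AA) => //; exact: saS|by rewrite mulmxA ex mul0mx|].
  by move=> /mul_adj_eq0.
have qx : \rank q = \rank x.
  by apply/eqP; rewrite eqn_leq {1}qdef mxrankM_maxl /=; exact: minx.
have qq0 : q *m q <> 0 by rewrite -{2}qS => /mul_adj_eq0; case: Bq.
have Aq : A q by case: Bq.
have Bqq : B (q *m q).
  by split=> //; [exact: saM|case: Bq => _ eq _; rewrite mulmxA eq mul0mx].
(* A full rank factorization turns [q *m a *m q] into the small matrix [D *m a *m E]; minimality of
   the rank makes [D *m E] invertible. *)
have [r [D [E [qE rE]]]] :
    exists r (D : 'M[C]_(r, n)) (E : 'M[C]_(n, r)), q = E *m D /\ r = \rank q.
  by exists (\rank q), (row_base q), (col_base q); rewrite mulmx_base.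
have DEu : D *m E \in unitmx.
  have qqE : q *m q = E *m (D *m E *m D) by rewrite {1 2}qE !mulmxA.
  rewrite -row_full_unit -col_leq_rank; apply: leq_trans (mxrankM_maxl _ D).
  apply: leq_trans (mxrankM_maxr E _); rewrite -qqE.
  by rewrite {1}rE qx; exact: minx.
have r0 : (0 < r)%N by rewrite rE lt0n mxrank_eq0; case: Bq => _ _ /eqP.
(* Subtracting from [D *m a *m E] the multiple of [D *m E] given by an eigenvalue lowers the rank,
   and below the minimal rank there is only zero. *)
have scal a : A a -> exists l, q *m a *m q = l *: (q *m q).
  move=> Aa; have [l /eigenvalueP[w wl w0]] :=
    eigenvalue_closed (D *m a *m E *m invmx (D *m E)) r0.
  exists l; apply/eqP; rewrite -subr_eq0; apply/eqP.
  set y := _ - _; have yE : y = E *m (D *m a *m E - l *: (D *m E)) *m D.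
    by rewrite /y qE mulmxBr mulmxBl -scalemxAr -scalemxAl !mulmxA.
  apply: contrapT => y0.
  have /minx : B y.
    split=> //.
      apply: (saD AA); first by do 2!apply: (saM AA) => //.
      by rewrite -scaleNr; apply: (saZ AA); exact: (saM AA).
    by case: Bq => _ eq _; rewrite mulmxBr -scalemxAr !mulmxA eq !mul0mx scaler0 subr0.
  rewrite -qx -rE yE leqNgt => /negP; apply.
  apply: leq_ltn_trans (mxrankM_maxl _ _) _; apply: leq_ltn_trans (mxrankM_maxr _ _) _.
  rewrite ltn_neqAle rank_leq_row andbT; apply/negP => yr.
  have : w *m (D *m a *m E - l *: (D *m E)) = 0.
    move/(congr1 (mulmx^~ (D *m E))): wl; rewrite -scalemxAl -!mulmxA mulVmx // mulmx1.
    by move=> wl; rewrite mulmxBr -scalemxAr -wl subrr.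
  by move/eqP; rewrite mulmx_free_eq0 ?(negPf w0).
have [l lE] := scal _ Aq.
have {}lE : q *m q = l *: q.
  (* As [y *m q = 0] and [y^t*] has [q] as left factor, [y *m y^t*] vanishes. *)
  apply/eqP; rewrite -subr_eq0; apply/eqP; set y := _ - _.
  have yq : y *m q = 0 by rewrite mulmxBl -scalemxAl lE subrr.
  apply: mul_adj_eq0; have -> : y^t* = q *m (q - l%:M)^t*.
    rewrite -[X in _ = X *m _]qS -adjmxM; congr (_^t*).
    by rewrite mulmxBl mul_scalar_mx.
  by rewrite mulmxA yq mul0mx.
have l0 : l != 0 by apply: contra_notN qq0 => /eqP l0; rewrite lE l0 scale0r.
have lr : Num.conj l = l.
  have : (q *m q)^t* = q *m q by rewrite adjmxM qS.
  rewrite lE linearZ /= map_mxZ qS => /eqP; rewrite -subr_eq0 -scalerBl scaler_eq0.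
  by rewrite subr_eq0; case: Bq => _ _ /eqP/negPf ->; rewrite orbF => /eqP.
have [p pE] : exists p, p = l^-1 *: q by exists (l^-1 *: q).
have pS : p^t* = p.
  rewrite pE linearZ /= map_mxZ qS; congr (_ *: _); rewrite -{2}lr; exact: fmorphV.
have pp : p *m p = p.
  by rewrite pE -scalemxAl -scalemxAr lE !scalerA -mulrA mulVf // mulr1.
have [i [j pij]] : exists i j, p i j != 0.
  apply: contrapT => H; case: Bq => _ _; apply.
  have : p = 0.
    apply/matrixP => i j; rewrite [RHS]mxE; apply/eqP/negPn/negP => pij; apply: H.
    by exists i, j.
  by move/eqP; rewrite pE scaler_eq0 invr_eq0 (negPf l0) /= => /eqP.
pose u := col j p.
have pu : p *m u = u by rewrite /u colE mulmxA pp.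
pose N := (u^t* *m u) 0 0.
have N0 : 0 < N.
  rewrite /N mxE (bigD1 i) //= ltr_wpDr //.
    by apply: sumr_ge0 => k _; rewrite !mxE mulrC mul_conjC_ge0.
  by rewrite !mxE mulrC mul_conjC_gt0.
pose v := (sqrtC N)^-1 *: u.
have sr : Num.conj (sqrtC N)^-1 = (sqrtC N)^-1.
  by apply/CrealP; rewrite rpredV realE sqrtC_ge0 ltW.
have vv : v^t* *m v = 1%:M.
  have -> : v^t* = (sqrtC N)^-1 *: u^t* by rewrite /v linearZ /= map_mxZ; congr (_ *: _); exact: sr.
  rewrite /v -scalemxAl -scalemxAr scalerA -invfM -expr2 sqrtCK.
  by apply/matrixP => a b; rewrite !ord1 [LHS]mxE mulVf ?gt_eqF // mxE.
have pv : p *m v = v by rewrite -scalemxAr pu.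
exists p, v; split; split=> //.
- by rewrite pE; exact: saZ.
- by case: Bq => _ eq _; rewrite pE -scalemxAr eq scaler0.
move=> a Aa; have [m mE] := scal a Aa.
have pap : p *m a *m p = m *: p.
  by rewrite pE -!scalemxAl -!scalemxAr mE lE !scalerA; congr (_ *: _); field.
rewrite pap; congr (_ *: p).
rewrite -{1}pv -{2}pv adjmxM pS -!mulmxA [p *m (a *m _)]mulmxA [p *m a *m _]mulmxA.
by rewrite pap -scalemxAl pv -scalemxAr vv !mxE eqxx mulr1.
Qed.

(** As long as the unit [e] of the ideal generated by the projections found so far is not one, a
    minimal projection orthogonal to [e] can be added. The vectors [v l] are orthonormal, which
    bounds their number by [n]; in [H], [m] is the fuel. *)
Theorem exists_minimal_projections n (A : 'M[C]_n -> Prop) :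
  star_algebra A -> A 1%:M ->
  exists (L : finType) p (v : L -> 'cV_n),
    minimal_projections A p v /\ in_ideal A p 1%:M.
Proof.
move=> AA A1.
suff H m (L : finType) p (v : L -> 'cV_n) : (n < #|L| + m)%N ->
    minimal_projections A p v ->
    exists (L : finType) p (v : L -> 'cV_n),
    minimal_projections A p v /\ in_ideal A p 1%:M.
  apply: (H n.+1 void (fun=> 0) (fun=> 0)).
    by rewrite card_void.
  by split=> -[].
elim: m L p v => [|m IH] L p v Lm [pA pv pap papx].
  exfalso; move: Lm; rewrite addn0 ltnNge => /negP; apply.
  apply: (@orthonormal_card _ _ v) => l l'.
  have [<-|ll'] := eqVneq l l'; first exact: (pv l).2.
  rewrite -(pv l).1 -(pv l').1 adjmxM; case: (pA l) => _ -> _.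
  by rewrite -!mulmxA [p l *m (p l' *m _)]mulmxA -[p l]mulmx1 papx // mul0mx mulmx0 raddf0.
have Ap l : A (p l) by case: (pA l).
have pS l : (p l)^t* = p l by case: (pA l).
have JA := in_ideal_algebra AA Ap pS.
have [e Je [eS eJ]] := star_algebra_unit JA.
have [e1|e1] := pselect (e = 1%:M); first by exists L, p, v; rewrite -e1.
have Ae := in_ideal_sub AA Ap Je.
have [p0 [v0 [[Ap0 p0S p0p0 ep0] [p0v0 v0v0 p0a]]]] :=
  exists_minimal_projection AA A1 Ae (eJ _ Je).1 e1.
pose p' (o : option L) := if o is Some l then p l else p0.
pose v' (o : option L) := if o is Some l then v l else v0.
(* [a *m p l] lies in the ideal, hence is fixed by [e] on the left, and [p0 *m e = 0]. *)
have p0a0 l a : A a -> p0 *m a *m p l = 0.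
  move=> Aa; rewrite -mulmxA; have Jal : in_ideal A p (a *m p l).
    rewrite -[_ *m _]addr0 -[_ *m _]mulmx1.
    by apply: in_idealD => //; exact: in_ideal0.
  rewrite -(eJ _ Jal).1 mulmxA -[p0]p0S -eS -adjmxM ep0.
  by rewrite trmx0 map_mx0 mul0mx.
apply: (IH (option L) p' v'); first by rewrite card_option addSnnS.
split.
- by case=> [l|] /=; [exact: pA|].
- by case=> [l|] /=; [exact: pv|].
- by case=> [l|] /=; [exact: pap|].
case=> [l|] [l'|] a //= ll' Aa; first exact: papx.
  have : p0 *m a^t* *m p l = 0 by apply: p0a0; exact: saS.
  by move/(congr1 (fun x => x^t*)); rewrite !adjmxM trmxCK p0S pS trmx0 map_mx0 mulmxA.
exact: p0a0.
Qed.
End star_algebra.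

(** * Semi-inner product spaces *)

Section preHilbert.
Local Open Scope sesquilinear_scope.
Variable K : numClosedFieldType.

(* The vector space axioms are only required to hold under the form, so that
   finite sequences of simple tensors make up such a space. *)
Record preHilbert := PreHilbert {
  pcar :> Type;
  pz : pcar;
  pD : pcar -> pcar -> pcar;
  pZ : K -> pcar -> pcar;
  pf : pcar -> pcar -> K;
  pfz : forall x, pf x pz = 0;
  pfD : forall x y z, pf x (pD y z) = pf x y + pf x z;
  pfZ : forall x l y, pf x (pZ l y) = l * pf x y;
  pfC : forall x y, pf y x = Num.conj (pf x y);
  pf_ge0 : forall x, 0 <= pf x x
}.
Arguments pz {p}.

Implicit Types V W : preHilbert.

(** Equality in the quotient by the null vectors, which is never formed. *)
Definition peq V (x y : V) := forall z, pf z x = pf z y.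
Definition pB V (x y : V) := pD x (pZ (-1) y).

Lemma pfB V (x y z : V) : pf x (pB y z) = pf x y - pf x z.
Proof. by rewrite pfD pfZ mulN1r. Qed.

Lemma pfDl V (x y z : V) : pf (pD x y) z = pf x z + pf y z.
Proof. by rewrite pfC pfD rmorphD /= -!pfC. Qed.

Lemma pfZl V l (x z : V) : pf (pZ l x) z = Num.conj l * pf x z.
Proof. by rewrite pfC pfZ rmorphM /= -!pfC. Qed.

Lemma pfBl V (x y z : V) : pf (pB x y) z = pf x z - pf y z.
Proof. by rewrite pfC pfB rmorphB /= -!pfC. Qed.

Lemma pfzl V (z : V) : pf pz z = 0.
Proof. by rewrite pfC pfz conjC0. Qed.

Lemma peql V (x y z : V) : peq x y -> pf x z = pf y z.
Proof. by move=> xy; rewrite pfC xy -pfC. Qed.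

Lemma cauchy_schwarz V (x y : V) : `|pf x y| ^+ 2 <= pf x x * pf y y.
Proof.
have [x0|x0] := eqVneq (pf x x) 0; last first.
  have xp : 0 < pf x x by rewrite lt_def x0 pf_ge0.
  have := pf_ge0 (pB (pZ (pf x x) y) (pZ (pf x y) x)).
  rewrite pfB !pfBl !pfZ !pfZl.
  rewrite -(pfC x x) -(pfC x y) normCK -(pfC x y) => H.
  rewrite -subr_ge0 -(pmulr_rge0 _ xp).
  by apply: le_trans H _; rewrite le_eqVlt; apply/orP; left; apply/eqP; ring.
have [->|xy] := eqVneq (pf x y) 0; first by rewrite normr0 expr0n x0 mul0r.
exfalso; have c0 : 0 < `|pf x y| ^+ 2 by rewrite exprn_gt0 // normr_gt0.
(* With [x] null, this [t] gives [y - t <x, y> x] the square norm -1. *)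
pose t : K := (pf y y + 1) / (2 * `|pf x y| ^+ 2).
have := pf_ge0 (pB y (pZ (t * pf x y) x)).
have tr : Num.conj t = t.
  by rewrite geC0_conj // divr_ge0 ?addr_ge0 ?pf_ge0// mulr_ge0 ?exprn_ge0.
rewrite pfB !pfBl !pfZ !pfZl x0 rmorphM /= tr -(pfC x y).
rewrite (_ : _ - _ = pf y y - 2 * t * (pf x y * pf y x)); last by ring.
rewrite (pfC x y) -normCK /t.
rewrite (_ : _ - _ = -1); first by rewrite oppr_ge0 ler10.
by field; rewrite normr_eq0.
Qed.

Lemma null_pf V (x y : V) : pf x x = 0 -> pf y x = 0.
Proof.
move=> x0; apply/eqP; rewrite -normr_eq0 -sqrf_eq0 eq_le exprn_ge0 // andbT.
by apply: le_trans (cauchy_schwarz _ _) _; rewrite x0 mulr0.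
Qed.

Lemma null_peq V (x y : V) : pf (pB x y) (pB x y) = 0 -> peq x y.
Proof. by move=> n z; apply/eqP; rewrite -subr_eq0 -pfB null_pf. Qed.

Definition pcomb V (s : seq (K * V)) : V :=
  foldr (fun a x => pD (pZ a.1 a.2) x) pz s.

Lemma pf_comb V (z : V) s : pf z (pcomb s) = \sum_(a <- s) a.1 * pf z a.2.
Proof.
by elim: s => [|a s IH]; rewrite ?big_nil ?pfz// big_cons /= pfD pfZ IH.
Qed.

Definition isometry V W (f : V -> W) := forall x y, pf (f x) (f y) = pf x y.

(** An isometry is not assumed linear but is so modulo null vectors: the difference between [f v]
    and the combination is orthogonal to the range of [f], hence to itself. *)
Lemma isometry_comb V W (f : V -> W) (v : V) (s : seq (K * V)) : isometry f ->
  (forall z, pf z v = \sum_(a <- s) a.1 * pf z a.2) ->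
  forall z, pf z (f v) = \sum_(a <- s) a.1 * pf z (f a.2).
Proof.
move=> fi vs z; pose t := [seq (a.1, f a.2) | a <- s].
suff /null_peq -> : pf (pB (f v) (pcomb t)) (pB (f v) (pcomb t)) = 0.
  by rewrite pf_comb big_map.
have fx0 x : pf (f x) (pB (f v) (pcomb t)) = 0.
  rewrite pfB fi vs pf_comb big_map; under [X in _ - X]eq_bigr do rewrite /= fi.
  by rewrite subrr.
rewrite pfBl fx0 (pfC _ (pcomb t)) pf_comb big_map big1 ?conjC0 ?subr0 // => a _ /=.
by rewrite pfC fx0 conjC0 mulr0.
Qed.

Lemma isometry_peq V W (f : V -> W) (x y : V) :
  isometry f -> peq x y -> peq (f x) (f y).
Proof.
move=> fi xy z.
rewrite (@isometry_comb _ _ f x [:: (1, y)] fi) ?big_seq1 ?mul1r // => z'.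
by rewrite big_seq1 mul1r.
Qed.

Definition adherent V W (f : V -> W) (y : W) :=
  forall e : K, 0 < e -> exists x, pf (pB y (f x)) (pB y (f x)) < e.

Definition dense V W (f : V -> W) := forall y, adherent f y.

Lemma adherent_peq V W (f : V -> W) x y : peq y (f x) -> adherent f y.
Proof.
by move=> yx e e0; exists x; rewrite pfB !pfBl !yx (peql _ yx) !subrr.
Qed.

Lemma norm_parallel V (x y z : V) :
  peq z (pD x y) -> pf z z <= 2 * pf x x + 2 * pf y y.
Proof.
move=> zE; rewrite zE (peql _ zE) pfD !pfDl.
have := pf_ge0 (pB x y); rewrite pfB !pfBl => H; rewrite -subr_ge0.
by apply: le_trans H _; rewrite le_eqVlt; apply/orP; left; apply/eqP; ring.
Qed.

Lemma isometryD V W (f : V -> W) (x y : V) : isometry f ->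
  peq (f (pD x y)) (pD (f x) (f y)).
Proof.
move=> fi z; rewrite (@isometry_comb _ _ f _ [:: (1, x); (1, y)] fi).
  by rewrite big_cons big_seq1 !mul1r pfD.
by move=> z'; rewrite big_cons big_seq1 !mul1r pfD.
Qed.

Lemma adherentD V W (f : V -> W) y y' : isometry f ->
  adherent f y -> adherent f y' -> adherent f (pD y y').
Proof.
move=> fi fy fy' e e0; have e4 : 0 < e / 4 by rewrite divr_gt0.
have [x xe] := fy _ e4; have [x' x'e] := fy' _ e4; exists (pD x x').
apply: le_lt_trans (@norm_parallel _ (pB y (f x)) (pB y' (f x')) _ _) _.
  move=> z; rewrite pfD !pfB pfD (isometryD _ _ fi) pfD; ring.
by rewrite [ltRHS](_ : e = 2 * (e / 4) + 2 * (e / 4)) ?ltrD ?ltr_pM2l //; field.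
Qed.

Lemma adherent_pz V W (f : V -> W) : isometry f -> adherent f pz.
Proof. by move=> fi e e0; exists pz; rewrite pfB pfz pfBl pfzl fi pfz !subr0. Qed.

(** The distance from [y] to a vector orthogonal to it is at least the norm of [y]. *)
Lemma dense_orth V W (f : V -> W) (y : W) :
  dense f -> (forall x, pf (f x) y = 0) -> pf y y = 0.
Proof.
move=> fd fy; apply/eqP/negPn/negP => yn.
have y0 : 0 < pf y y by rewrite lt_def yn pf_ge0.
have [x] := fd y _ y0; rewrite pfB !pfBl fy (pfC (f x) y) fy conjC0 subr0 sub0r opprK.
have /le_lt_trans H : pf y y <= pf y y + pf (f x) (f x) by rewrite lerDl pf_ge0.
by move/H; rewrite ltxx.
Qed.

Record subspace V (S : V -> Prop) : Prop := Subspace {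
  sub_z : S pz;
  sub_D : forall x y, S x -> S y -> S (pD x y);
  sub_Z : forall l x, S x -> S (pZ l x)
}.

Lemma sub_B V (S : V -> Prop) x y : subspace S -> S x -> S y -> S (pB x y).
Proof. by move=> SS Sx Sy; apply: (sub_D SS) => //; exact: sub_Z. Qed.

Lemma sub_comb V (S : V -> Prop) (I : Type) (s : seq I) (c : I -> K) (w : I -> V) :
  subspace S -> (forall i, S (w i)) -> S (pcomb [seq (c i, w i) | i <- s]).
Proof.
move=> SS Sw; elim: s => [|i s IH] /=; first exact: sub_z.
by apply: (sub_D SS) => //; exact: sub_Z.
Qed.

Definition full V (_ : V) := True.

Lemma subspace_full V : subspace (@full V). Proof. by []. Qed.

Definition orthonormal V (I : finType) (w : I -> V) :=
  forall a b, pf (w a) (w b) = (a == b)%:R.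

Definition onb V (S : V -> Prop) (I : finType) (w : I -> V) :=
  [/\ forall a, S (w a), orthonormal w &
      forall v, S v -> (forall a, pf (w a) v = 0) -> pf v v = 0].

Definition sdim V (S : V -> Prop) n := exists w : 'I_n -> V, onb S w.

Lemma onb_sdim V (S : V -> Prop) (I : finType) (w : I -> V) :
  onb S w -> sdim S #|I|.
Proof.
move=> [wS wo wt]; exists (w \o enum_val); split=> /=.
- by move=> a; exact: wS.
- by move=> a b; rewrite /= wo (inj_eq enum_val_inj).
move=> v Sv w0; apply: wt => // a.
by have := w0 (enum_rank a); rewrite /= enum_rankK.
Qed.

Lemma onb_expand V (S : V -> Prop) (I : finType) (w : I -> V) v :
  subspace S -> onb S w -> S v ->
  forall z, pf z v = \sum_a pf (w a) v * pf z (w a).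
Proof.
move=> SS [wS wo wt] Sv z.
pose u := pcomb [seq (pf (w a) v, w a) | a <- index_enum I].
have uE x : pf x u = \sum_a pf (w a) v * pf x (w a) by rewrite pf_comb big_map.
rewrite -uE; apply: (@null_peq _ v u); apply: wt.
  by apply: sub_B => //; exact: sub_comb.
move=> a; rewrite pfB uE (bigD1 a) //= wo eqxx mulr1 big1 ?addr0 ?subrr // => b ba.
by rewrite wo eq_sym (negPf ba) mulr0.
Qed.

Lemma orthonormal_le V (S : V -> Prop) (I : finType) n (w : I -> V) (w' : 'I_n -> V) :
  subspace S -> onb S w' -> (forall a, S (w a)) -> orthonormal w -> (#|I| <= n)%N.
Proof.
move=> SS w'o Sw wo.
apply: (@orthonormal_card _ n I (fun a => \col_c pf (w' c) (w a))) => a b.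
apply/matrixP => i j; rewrite !ord1 !mxE -(wo a b) (onb_expand SS w'o (Sw b)).
rewrite mulr1n; apply: eq_bigr => c _; rewrite !mxE mulrC; congr (_ * _).
by rewrite -pfC.
Qed.

Lemma sdim_unique V (S : V -> Prop) n m : subspace S ->
  sdim S n -> sdim S m -> n = m.
Proof.
move=> SS [w wo] [w' wo']; apply/eqP; rewrite eqn_leq.
have [[wS won _] [wS' won' _]] := (wo, wo').
have := orthonormal_le SS wo' wS won; have := orthonormal_le SS wo wS' won'.
by rewrite !card_ord => -> ->.
Qed.

Lemma sdim_exists V (S : V -> Prop) N : subspace S ->
  (forall n (w : 'I_n -> V), (forall a, S (w a)) -> orthonormal w -> (n <= N)%N) ->
  exists n, sdim S n.
Proof.
move=> SS bound.
pose P n := `[< exists w : 'I_n -> V, (forall a, S (w a)) /\ orthonormal w >].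
have exP : exists n, P n.
  by exists 0%N; apply/asboolP; exists (fun=> pz); split=> -[].
have ubP n : P n -> (n <= N)%N by move=> /asboolP[w [wS wo]]; exact: bound wS wo.
case: (ex_maxnP exP ubP) => n /asboolP[w [wS wo]] maxn; exists n, w; split=> // v Sv v0.
apply/eqP/negPn/negP => vn.
have vp : 0 < pf v v by rewrite lt_def vn pf_ge0.
have sp : 0 < sqrtC (pf v v) by rewrite sqrtC_gt0.
pose u := pZ (sqrtC (pf v v))^-1 v.
pose w' (i : 'I_n.+1) := if unlift ord0 i is Some j then w j else u.
suff /maxn : P n.+1 by rewrite ltnn.
apply/asboolP; exists w'; split=> [a|a b]; rewrite /w'.
  by case: unliftP => [j _|_] //; exact: sub_Z.
have wu j : pf (w j) u = 0 by rewrite pfZ v0 mulr0.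
case: unliftP => [j ->|->]; case: unliftP => [k ->|->].
- by rewrite wo (inj_eq lift_inj).
- by rewrite wu eq_sym (negPf (neq_lift _ _)).
- by rewrite pfC wu conjC0 (negPf (neq_lift _ _)).
rewrite eqxx pfZ pfZl (_ : Num.conj _ = (sqrtC (pf v v))^-1); last first.
  by rewrite geC0_conj // invr_ge0 ltW.
by rewrite mulrA -invfM -expr2 sqrtCK mulVf.
Qed.

Lemma sdim_sub V (S S' : V -> Prop) n : subspace S -> subspace S' ->
  (forall v, S v -> S' v) -> sdim S' n -> exists m, sdim S m.
Proof.
move=> SS SS' SS'_ [w wo]; apply: (sdim_exists (N := n)) => // m u uS uo.
by rewrite -[m]card_ord (orthonormal_le SS' wo _ uo) // => a; exact: SS'_.
Qed.

Definition findim V := exists n, sdim (@full V) n.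

Lemma findim_isometry V W (f : V -> W) : isometry f -> findim W -> findim V.
Proof.
move=> fi [n [w wo]]; apply: (sdim_exists (N := n)) => [|m u _ uo]; first by [].
rewrite -[m]card_ord (orthonormal_le (subspace_full W) wo (w := f \o u)) //.
by move=> a b; rewrite /= fi.
Qed.

Lemma findim_dense V W (f : V -> W) : isometry f -> dense f -> findim V -> findim W.
Proof.
move=> fi fd [n [w [_ wo wt]]]; exists n, (f \o w); split=> //.
  by move=> a b; rewrite /= fi.
move=> v _ v0; apply: (dense_orth fd) => x.
rewrite pfC (isometry_comb (s := [seq (pf (w a) x, w a) | a <- index_enum 'I_n]) fi).
  rewrite big_map big1 ?conjC0 // => a _ /=.
  by rewrite (pfC (f (w a))) (v0 a : pf (f (w a)) v = 0) conjC0 mulr0.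
by move=> z; rewrite big_map; exact: (onb_expand (subspace_full V)).
Qed.

(** The projection of [y] on the finite dimensional range of [f] differs from [y] by a vector
    orthogonal to that range, which density makes null. *)
Lemma findim_dense_surj V W (f : V -> W) y : isometry f -> dense f -> findim V ->
  exists x, peq y (f x).
Proof.
move=> fi fd [n [w [_ wo wt]]].
pose s := [seq (pf (f (w a)) y, w a) | a <- index_enum 'I_n].
have fE z : pf z (f (pcomb s)) = \sum_a pf (f (w a)) y * pf z (f (w a)).
  by rewrite (isometry_comb (s := s) fi) ?big_map // => z'; rewrite pf_comb.
exists (pcomb s); apply: null_peq; apply: (dense_orth fd) => x.
have fw a : pf (f (w a)) (pB y (f (pcomb s))) = 0.
  rewrite pfB fE (bigD1 a) //= fi wo eqxx mulr1 big1 ?addr0 ?subrr // => b ba.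
  by rewrite fi wo eq_sym (negPf ba) mulr0.
rewrite pfC (isometry_comb (s := [seq (pf (w a) x, w a) | a <- index_enum 'I_n]) fi).
  rewrite big_map big1 ?conjC0 // => a _ /=.
  by rewrite (pfC (f (w a))) fw conjC0 mulr0.
by move=> z; rewrite big_map; exact: (onb_expand (subspace_full V)).
Qed.

Lemma dense_comp (U : preHilbert) V W (f : U -> V) (g : V -> W) : isometry g ->
  dense f -> dense g -> dense (g \o f).
Proof.
move=> gi fd gd y e e0; have e4 : 0 < e / 4 by rewrite divr_gt0.
have [x xe] := gd y _ e4; have [u ue] := fd x _ e4; exists u.
have gE : pf (pB (g x) (g (f u))) (pB (g x) (g (f u))) = pf (pB x (f u)) (pB x (f u)).
  by rewrite !pfB !pfBl !gi.
apply: le_lt_trans (@norm_parallel _ (pB y (g x)) (pB (g x) (g (f u))) _ _) _.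
  by move=> z; rewrite /= pfD !pfB; ring.
by rewrite gE [ltRHS](_ : e = 2 * (e / 4) + 2 * (e / 4)) ?ltrD ?ltr_pM2l //; field.
Qed.

(** With more orthonormal vectors than members of [u], some nontrivial combination of them would be
    orthogonal to all of [u], hence null. *)
Lemma findim_total V (I : finType) (u : I -> V) :
  (forall v, (forall a, pf (u a) v = 0) -> pf v v = 0) -> findim V.
Proof.
move=> ut; apply: (sdim_exists (N := #|I|)) => // m w _ wo.
pose M : 'M[K]_(m, #|I|) := \matrix_(b, a) pf (u (enum_val a)) (w b).
suff : row_free M by rewrite /row_free => /eqP <-; exact: rank_leq_col.
rewrite -kermx_eq0; apply/negPn/negP => /rowV0Pn[c /sub_kermxP cM c0].
pose v := pcomb [seq (c 0 b, w b) | b <- index_enum 'I_m].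
have vE z : pf z v = \sum_b c 0 b * pf z (w b) by rewrite pf_comb big_map.
have v0 : pf v v = 0.
  apply: ut => a; rewrite vE; have /matrixP/(_ 0 (enum_rank a)) := cM.
  rewrite !mxE => E; rewrite -[RHS]E; apply: eq_bigr => b _; by rewrite mxE enum_rankK.
move/eqP: c0; apply; apply/rowP => b; rewrite mxE -[RHS](null_pf (w b) v0) vE.
rewrite (bigD1 b) //= wo eqxx mulr1 big1 ?addr0 // => b' b'b.
by rewrite wo eq_sym (negPf b'b) mulr0.
Qed.

End preHilbert.
Arguments pz {K p}.

(** * Representations and Hilbert modules *)

Section cstar.
Variables (R : realType) (A : cstarType R).
Local Notation K := R[i].
Implicit Types a b c : A.

Lemma cmulDl a b c : cmul (a + b) c = cmul a c + cmul b c.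
Proof. by have := cmul_linearl 1 a b c; rewrite !scale1r. Qed.

Lemma cmulDr a b c : cmul a (b + c) = cmul a b + cmul a c.
Proof. by have := cmul_linearr 1 a b c; rewrite !scale1r. Qed.

Lemma cmul0l c : cmul 0 c = 0.
Proof. by apply: (addIr (cmul 0 c)); rewrite -cmulDl !add0r. Qed.

Lemma cmul0r c : cmul c 0 = 0.
Proof. by apply: (addIr (cmul c 0)); rewrite -cmulDr !add0r. Qed.

Lemma cmulZl (l : K) a b : cmul (l *: a) b = l *: cmul a b.
Proof. by rewrite -[l *: a]addr0 cmul_linearl cmul0l addr0. Qed.

Lemma cmulZr (l : K) a b : cmul a (l *: b) = l *: cmul a b.
Proof. by rewrite -[l *: b]addr0 cmul_linearr cmul0r addr0. Qed.

Lemma cmulNl a b : cmul (- a) b = - cmul a b.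
Proof. by rewrite -scaleN1r cmulZl scaleN1r. Qed.

Lemma cmulNr a b : cmul a (- b) = - cmul a b.
Proof. by rewrite -scaleN1r cmulZr scaleN1r. Qed.

Lemma starD a b : star (a + b) = star a + star b.
Proof. by have := star_antilinear 1 a b; rewrite !scale1r rmorph1 scale1r. Qed.

Lemma star0 : star (0 : A) = 0.
Proof. by apply: (addIr (star 0)); rewrite -starD !add0r. Qed.

Lemma starZ (l : K) a : star (l *: a) = Num.conj l *: star a.
Proof. by rewrite -[l *: a]addr0 star_antilinear star0 addr0. Qed.

Lemma norm_star a : `|star a| = `|a|.
Proof.
have H c : `|c| <= `|star c|.
  have [->|c0] := eqVneq c 0; first by rewrite star0.
  have cp : 0 < `|c| by rewrite normr_gt0.
  rewrite -(ler_pM2r cp) -expr2 -cstar_identity; exact: norm_cmul_le.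
by apply/eqP; rewrite eq_le H -{2}[a]starK H.
Qed.

Definition sqr_half a b := 2^-1 *: (a + cmul b b).

Lemma sqr_half_lipschitz a b c :
  `|sqr_half a b - sqr_half a c| <= 2^-1 * (`|b| + `|c|) * `|b - c|.
Proof.
rewrite /sqr_half -scalerBr normrZ opprD addrACA subrr add0r.
rewrite ger0_norm ?invr_ge0 // -mulrA ler_pM2l ?invr_gt0 //.
have -> : cmul b b - cmul c c = cmul b (b - c) + cmul (b - c) c.
  by rewrite cmulDr cmulDl cmulNr cmulNl addrA subrK.
apply: le_trans (ler_normD _ _) _; rewrite mulrDl.
apply: lerD; first exact: norm_cmul_le.
by rewrite [leRHS]mulrC; exact: norm_cmul_le.
Qed.

Lemma exists_exp2_lt (e : K) : 0 < e -> exists n, (2^-1 : K) ^+ n < e.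
Proof.
case: e => r s; rewrite ltcE /= => /andP[/eqP -> r0].
exists (Num.bound r^-1); rewrite exprVn -[(2 : K)]/(2%:R) -natrX.
have rn : r^-1 < (2 ^ Num.bound r^-1)%:R.
  apply: lt_le_trans (archi_boundP _) _; first by rewrite invr_ge0 ltW.
  by rewrite ler_nat ltnW // ltn_expl.
rewrite -[_%:R](rmorph_nat (real_complex R)) -(fmorphV (real_complex R)).
by rewrite ltcR invf_plt ?posrE // ltr0n expn_gt0.
Qed.

Lemma cauchy_seq_cvg (y : nat -> A) :
  (forall n m, `|y n - y (n + m)%N| <= (2^-1 : K) ^+ n) -> cvg (y @ \oo).
Proof.
move=> yc; apply: cauchy_cvg; apply: cauchy_exP => e e0.
have [n ne] := exists_exp2_lt e0; exists (y n).
exists n => // m /= nm; rewrite -ball_normE /=.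
by apply: le_lt_trans ne; rewrite -(subnKC nm).
Qed.

(* [(1 - b) ^ 2 = 1 - a] without a unit: [b] is a fixed point of
   [b |-> (a + b ^ 2) / 2], a contraction of the ball of radius 1/2. *)
Lemma exists_sqr_half_fixed a : `|a| <= 2^-1 ->
  exists2 b, sqr_half a b = b & `|b| < 1.
Proof.
move=> a2; pose y n := iter n (sqr_half a) 0.
have yb n : `|y n| <= 2^-1.
  elim: n => [|n IH]; first by rewrite normr0 invr_ge0.
  rewrite /= -/(y n) /sqr_half normrZ ger0_norm ?invr_ge0 //.
  rewrite -[leRHS]mulr1 ler_pM2l ?invr_gt0 //.
  apply: le_trans (ler_normD _ _) _; rewrite [leRHS](splitr 1) mul1r lerD //.
  apply: le_trans (norm_cmul_le _ _) _; apply: le_trans (ler_pM _ _ IH IH) _ => //.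
  by rewrite -[leRHS]mul1r ler_pM2r ?invr_gt0 // invf_le1 // ler1n.
have lip b c : `|b| <= 2^-1 -> `|c| <= 2^-1 ->
    `|sqr_half a b - sqr_half a c| <= 2^-1 * `|b - c|.
  move=> b2 c2; apply: le_trans (sqr_half_lipschitz _ _ _) _.
  apply: ler_wpM2r => //; rewrite -[leRHS]mulr1 ler_pM2l ?invr_gt0 //.
  by rewrite [leRHS](splitr 1) mul1r lerD.
have yc n m : `|y n - y (n + m)%N| <= 2^-1 ^+ n.
  elim: n => [|n IH]; last first.
    rewrite addSn /= exprS; apply: le_trans (lip _ _ (yb n) (yb (n + m)%N)) _.
    by rewrite ler_pM2l ?invr_gt0.
  by rewrite sub0r normrN add0n expr0 (le_trans (yb m)) // invf_le1 ?ler1n.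
have /cvg_ex[l /cvgrPdist_lt yl] := cauchy_seq_cvg yc.
have yl' e : 0 < e -> exists n, `|l - y n| < e /\ `|l - y n.+1| < e.
  move=> e0; have [n _ H] := yl _ e0; exists n.
  by split; apply: H => //=.
have l1 : `|l| < 1.
  have h0 : 0 < 2^-1 :> K by rewrite invr_gt0.
  have [n [ln _]] := yl' _ h0.
  rewrite -[l](subrK (y n)); apply: le_lt_trans (ler_normD _ _) _.
  by rewrite [ltRHS](splitr 1) mul1r ltr_leD.
exists l => //; apply/eqP; rewrite -subr_eq0 -normr_eq0; apply/negPn/negP => d0.
have dp : 0 < `|sqr_half a l - l| by rewrite lt_def d0 /=.
have h0 : 0 < 2^-1 * `|sqr_half a l - l| by rewrite mulr_gt0 // invr_gt0.
have [n [ln ln1]] := yl' _ h0.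
suff : `|sqr_half a l - l| < `|sqr_half a l - l| by rewrite ltxx.
rewrite {1}(_ : _ - l = (sqr_half a l - sqr_half a (y n)) + (y n.+1 - l)); last first.
  by rewrite addrA subrK.
apply: le_lt_trans (ler_normD _ _) _; rewrite [ltRHS]splitr ![_ / 2]mulrC.
rewrite (distrC (y n.+1)) ler_ltD //.
apply: le_trans (sqr_half_lipschitz _ _ _) _.
apply: (@le_trans _ _ (1 * `|l - y n|)); last by rewrite mul1r ltW.
apply: ler_wpM2r => //; rewrite -[leRHS](mulVf (_ : 2 != 0 :> K)) ?pnatr_eq0 //.
rewrite ler_pM2l ?invr_gt0 // -[leRHS]/(1 + 1) lerD ?ltW //.
by apply: le_lt_trans (yb n) _; rewrite invf_lt1 ?ltr1n.
Qed.

Lemma sqr_half_fixed_unique a b c : `|b| < 1 -> `|c| < 1 ->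
  sqr_half a b = b -> sqr_half a c = c -> b = c.
Proof.
move=> b1 c1 bE cE; apply/eqP; rewrite -subr_eq0 -normr_eq0; apply/negPn/negP => d0.
have dp : 0 < `|b - c| by rewrite lt_def d0 /=.
have := sqr_half_lipschitz a b c; rewrite bE cE -[leLHS]mul1r ler_pM2r //.
rewrite -(ler_pM2l (_ : 0 < 2 :> K)) // mulr1 mulrA divff ?pnatr_eq0 // mul1r.
by move/le_lt_trans/(_ (ltrD b1 c1)); rewrite -[2]/(1 + 1) ltxx.
Qed.

(** [star b] is a fixed point too, and fixed points of norm less than 1 are unique, so that [b] is
    self-adjoint. *)
Lemma exists_sqrt_one_minus a : star a = a -> `|a| <= 2^-1 ->
  exists2 b, star b = b & b + b - cmul b b = a.
Proof.
move=> aS a2; have [b bE b1] := exists_sqr_half_fixed a2; exists b.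
  apply: (@sqr_half_fixed_unique a) => //; first by rewrite norm_star.
  rewrite -{2}bE /sqr_half starZ starD starM aS.
  by congr (_ *: _); rewrite geC0_conj // invr_ge0.
rewrite -{1 2}bE /sqr_half -scalerDl.
have -> : 2^-1 + 2^-1 = 1 :> K by field.
by rewrite scale1r addrK.
Qed.

End cstar.

(** The axioms are algebraic and hold under the form; boundedness is deduced from them in
    [act_bound]. *)
Record rep (R : realType) (A : cstarType R) := Rep {
  rep_space :> preHilbert R[i];
  act : A -> rep_space -> rep_space;
  act_lin : forall (l : R[i]) a b x y,
    pf x (act (l *: a + b) y) = l * pf x (act a y) + pf x (act b y);
  actM : forall a b x y, pf x (act (cmul a b) y) = pf x (act a (act b y));
  act_adj : forall a x y, pf (act a x) y = pf x (act (star a) y)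
}.

Section rep.
Variables (R : realType) (A : cstarType R).
Local Notation K := R[i].
Implicit Types (H : rep A) (a b c : A).

Lemma act_adjr H a (x y : H) : pf x (act a y) = pf (act (star a) x) y.
Proof. by rewrite act_adj starK. Qed.

Lemma act_addl H a b (x y : H) : pf x (act (a + b) y) = pf x (act a y) + pf x (act b y).
Proof. by rewrite -[a]scale1r act_lin mul1r scale1r. Qed.

Lemma act0l H (x y : H) : pf x (act 0 y) = 0.
Proof. by apply: (addIr (pf x (act 0 y))); rewrite -act_addl !add0r. Qed.

Lemma actZl H l a (x y : H) : pf x (act (l *: a) y) = l * pf x (act a y).
Proof. by rewrite -[l *: a]addr0 act_lin act0l addr0. Qed.

Lemma actBl H a b (x y : H) : pf x (act (a - b) y) = pf x (act a y) - pf x (act b y).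
Proof. by rewrite act_addl -scaleN1r actZl mulN1r. Qed.

Lemma act_suml H (I : Type) (s : seq I) (F : I -> A) (x y : H) :
  pf x (act (\sum_(i <- s) F i) y) = \sum_(i <- s) pf x (act (F i) y).
Proof.
elim: s => [|i s IH]; first by rewrite !big_nil act0l.
by rewrite !big_cons act_addl IH.
Qed.

Lemma actZ H a l (x y : H) : pf x (act a (pZ l y)) = l * pf x (act a y).
Proof. by rewrite act_adjr pfZ -act_adjr. Qed.

Lemma actB H a (x y z : H) : pf x (act a (pB y z)) = pf x (act a y) - pf x (act a z).
Proof. by rewrite act_adjr pfB -!act_adjr. Qed.

Lemma act_comb H a (x : H) s :
  pf x (act a (pcomb s)) = \sum_(b <- s) b.1 * pf x (act a b.2).
Proof. by rewrite act_adjr pf_comb; apply: eq_bigr => b _; rewrite -act_adjr. Qed.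

Lemma act_peq H a (x y : H) : peq x y -> peq (act a x) (act a y).
Proof. by move=> xy z; rewrite act_adjr xy -act_adjr. Qed.

(** For c the quotient of the product of [star a] and [a] by [2 |a|^2], of norm at most 1/2, write
    [1 - c] as the square of [1 - b]; the square norm of [x - b x] is then [<x, x> - <x, c x>]. The
    factor 2 comes from the radius 1/2 in which the square root is available. *)
Lemma act_bound H a (x : H) : pf (act a x) (act a x) <= 2 * `|a| ^+ 2 * pf x x.
Proof.
have [->|a0] := eqVneq a 0; first by rewrite act0l normr0 expr0n mulr0 mul0r.
have n0 : 0 < 2 * `|a| ^+ 2 by rewrite mulr_gt0 // exprn_gt0 // normr_gt0.
pose c := (2 * `|a| ^+ 2)^-1 *: cmul (star a) a.
have cS : star c = c.
  rewrite starZ starM starK geC0_conj // invr_ge0; exact: ltW.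
have c2 : `|c| <= 2^-1.
  rewrite normrZ cstar_identity ger0_norm; last by rewrite invr_ge0 ltW.
  rewrite le_eqVlt; apply/orP; left; apply/eqP; field; by rewrite normr_eq0.
have [b bS bE] := exists_sqrt_one_minus cS c2.
have := pf_ge0 (pB x (act b x)).
rewrite pfB !pfBl [pf (act b x) x]act_adj [pf (act b x) (act b x)]act_adj bS -actM.
rewrite (_ : _ - _ = pf x x - pf x (act c x)); last first.
  by rewrite -bE actBl act_addl; ring.
rewrite subr_ge0 actZl ler_pdivrMl // => H1.
by rewrite act_adj -actM.
Qed.

Lemma act_form_bound H a (x : H) : `|pf x (act a x)| <= 2 * `|a| * pf x x.
Proof.
rewrite -(@ler_pXn2r _ 2) ?nnegrE ?mulr_ge0 ?pf_ge0 //.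
apply: le_trans (cauchy_schwarz _ _) _.
apply: le_trans (ler_wpM2l (pf_ge0 x) (act_bound a x)) _.
rewrite [leRHS](_ : _ = 4 * (pf x x * (`|a| ^+ 2 * pf x x))); last by ring.
rewrite [leLHS](_ : _ = 2 * (pf x x * (`|a| ^+ 2 * pf x x))); last by ring.
rewrite ler_wpM2r ?ler_nat // !mulr_ge0 ?pf_ge0 ?exprn_ge0 //.
Qed.

End rep.

Lemma exists_near_inf (R : realType) (I : Type) (i0 : I) (F : I -> R[i]) (e : R[i]) :
  (forall i, 0 <= F i) -> 0 < e -> exists i, forall j, F i <= F j + e.
Proof.
move=> F0; case: e => e e' /=; rewrite ltcE /= => /andP[/eqP -> e0].
pose E := [set complex.Re (F i) | i in [set: I]].
have FE i : F i = ((complex.Re (F i))%:C)%C.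
  by have := F0 i; case: (F i) => a b; rewrite lecE /= => /andP[/eqP -> _].
have Einf : has_inf E.
  split; first by exists (complex.Re (F i0)), i0.
  by exists 0 => _ [i _ <-]; have := F0 i; rewrite FE lecR.
have [_ [i _ <-] iE] := inf_adherent e0 Einf.
exists i => j; rewrite (FE i) (FE j) -(rmorphD (real_complex R)) lecR ltW //.
apply: lt_le_trans iE _; rewrite lerD2r; apply: ge_inf; first by case: Einf.
by exists j.
Qed.

Lemma ge0_of_approx (R : realType) (Q : R[i]) :
  (forall d, 0 < d -> - d <= Q) -> 0 <= Q.
Proof.
move=> H; have Qr : Q \is Num.real.
  have := H 1 ltr01; rewrite -subr_ge0 => /ger0_real; rewrite opprK => Q1.
  by rewrite -[Q](addrK 1) realB // real1.
rewrite real_leNgt ?real0 //; apply/negP => Q0.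
have d0 : 0 < - Q / 2 by rewrite divr_gt0 // oppr_gt0.
have := H _ d0; rewrite mulNr opprK -subr_ge0 (_ : _ - _ = Q / 2); last by field.
by rewrite pmulr_lge0 ?invr_gt0 // => /(lt_le_trans Q0); rewrite ltxx.
Qed.

Section hilbert_module.
Variables (R : realType) (A : cstarType R) (X : hilbertModuleType A).
Implicit Types x y z : X.

Lemma innerDr x y z : inner x (y + z) = inner x y + inner x z :> A.
Proof. by have := @inner_linearr _ _ X 1 x y z; rewrite !scale1r. Qed.

Lemma inner0r x : inner x (0 : X) = 0 :> A.
Proof. by apply: (addIr (inner x (0 : X))); rewrite -innerDr !add0r. Qed.

Lemma innerZr (l : R[i]) x y : inner x (l *: y) = l *: inner x y :> A.
Proof. by rewrite -[l *: y]addr0 inner_linearr inner0r addr0. Qed.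

(* Removing from one of the vectors [h i] a nearly closest point of the [A]-span
   of the others makes it nearly orthogonal to them, so that the cross terms
   are negligible and induction applies to the other vectors. *)
Lemma hilbert_module_cp (H : rep A) n (x : 'I_n -> X) (h : 'I_n -> H) :
  0 <= \sum_i \sum_j pf (h i) (act (inner (x i) (x j)) (h j)).
Proof.
elim: n x h => [|n IH] x h; first by rewrite big_ord0.
pose x0 := x ord0; pose h0 := h ord0.
pose x1 i := x (lift ord0 i); pose h1 i := h (lift ord0 i).
pose S (c : 'I_n -> A) : H := pcomb [seq (1, act (c i) (h1 i)) | i <- index_enum 'I_n].
have SE (z : H) c : pf z (S c) = \sum_i pf z (act (c i) (h1 i)).
  by rewrite pf_comb big_map; under eq_bigr do rewrite mul1r.
have actSE (z : H) a c : pf z (act a (S c)) = \sum_i pf z (act (cmul a (c i)) (h1 i)).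
  rewrite act_comb big_map; apply: eq_bigr => i _; by rewrite mul1r actM.
(* Coefficients are moved across the balanced tensor product: the sum of the x_i (x) h_i is x_0 (x)
   (h_0 - sum of c_i h_i) plus the sum of the (x_i + x_0 c_i) (x) h_i. The cross terms are expressed
   by [g c]. *)
pose h' c := pB h0 (S c).
pose x1' c i := x1 i + ract x0 (c i).
pose g c := S (fun i => inner x0 (x1' c i)).
pose p : A := inner x0 x0.
have step c : \sum_i \sum_j pf (h i) (act (inner (x i) (x j)) (h j)) =
    pf (h' c) (act p (h' c)) + (pf (h' c) (g c) + Num.conj (pf (h' c) (g c)))
    + \sum_i \sum_j pf (h1 i) (act (inner (x1' c i) (x1' c j)) (h1 j)).
  have colE z (k : H) : \sum_j pf k (act (inner z (x j)) (h j)) =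
      pf k (act (inner z x0) (h' c)) + \sum_j pf k (act (inner z (x1' c j)) (h1 j)).
    rewrite big_ord_recl actB actSE -addrA; congr (_ + _).
    rewrite addrC -sumrB; apply: eq_bigr => j _.
    by rewrite innerDr inner_ract act_addl addrK.
  under eq_bigr do rewrite colE.
  have rowE z (k : H) : \sum_i pf (h i) (act (inner (x i) z) k) =
      pf (h' c) (act (inner x0 z) k) + \sum_i pf (h1 i) (act (inner (x1' c i) z) k).
    have flip y (l : H) : pf l (act (inner y z) k) = Num.conj (pf k (act (inner z y) l)).
      by rewrite (inner_star z y) act_adjr starK -pfC.
    under eq_bigr do rewrite flip.
    rewrite -rmorph_sum colE rmorphD rmorph_sum /= -flip; congr (_ + _).
    by apply: eq_bigr => i _; rewrite -flip.
  rewrite big_split rowE /= exchange_big /=.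
  under [X in _ + X]eq_bigr do rewrite rowE.
  rewrite big_split /= -!addrA; congr (_ + _).
  rewrite addrCA; congr (_ + (_ + _)); last by rewrite exchange_big.
    rewrite SE rmorph_sum; apply: eq_bigr => i _ /=.
    by rewrite -pfC act_adj -inner_star.
  by rewrite SE.
apply: ge0_of_approx => d d0.
pose g1 := pD (S (fun i => inner x0 (x1 i))) (act p h0).
pose M := 2 * pf g1 g1 + 4 * `|p| ^+ 2 * (pf h0 h0 + 1) + 1.
have M0 : 0 < M.
  by rewrite ltr_wpDl // addr_ge0 // !mulr_ge0 ?addr_ge0 ?exprn_ge0 ?pf_ge0.
(* [M] will bound the square norm of [g c]. With [s * M = d / 2] and [e <= t = s * d / 2], comparing
   the nearly minimal [h' c] with [h' c + s g c] bounds the cross terms below by [- d]; [e <= 1] is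
   what makes [M] independent of [c]. *)
pose s := d / (2 * M); have s0 : 0 < s by rewrite divr_gt0 // mulr_gt0.
pose t := s * d / 2; have t0 : 0 < t by rewrite divr_gt0 // mulr_gt0.
pose e := t / (1 + t).
have t1 : 0 < 1 + t by rewrite addr_gt0.
have e0 : 0 < e by rewrite divr_gt0.
have e1 : e <= 1 by rewrite ler_pdivrMr // mul1r lerDr.
have et : e <= t by rewrite ler_pdivrMr // mulrDr mulr1 lerDl mulr_ge0 // ltW.
have [c cmin] := @exists_near_inf R _ (fun=> 0) (fun c => pf (h' c) (h' c)) e
   (fun=> pf_ge0 _) e0.
have h'0 : peq (h' (fun=> 0)) h0.
  by move=> z; rewrite pfB SE big1 ?subr0 // => i _; rewrite act0l.
have h'b : pf (h' c) (h' c) <= pf h0 h0 + 1.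
  apply: le_trans (cmin (fun=> 0)) _; rewrite h'0 (peql _ h'0).
  by rewrite lerD2l.
have gE : peq (g c) (pD g1 (pZ (-1) (act p (h' c)))).
  move=> z; rewrite !pfD pfZ actB actSE !SE.
  under eq_bigr do rewrite innerDr inner_ract act_addl.
  by rewrite big_split /=; ring.
have gM : pf (g c) (g c) <= M.
  apply: le_trans (norm_parallel gE) _; rewrite /M -addrA lerD2l.
  apply: (@le_trans _ _ (4 * `|p| ^+ 2 * (pf h0 h0 + 1))); last by rewrite lerDl.
  rewrite [leRHS](_ : _ = 2 * (2 * `|p| ^+ 2 * (pf h0 h0 + 1))); last by ring.
  rewrite ler_pM2l // pfZ pfZl rmorphN1 mulN1r mulN1r opprK.
  apply: le_trans (act_bound _ _) _.
  by rewrite ler_wpM2l // mulr_ge0 ?exprn_ge0.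
have cross : - d <= pf (h' c) (g c) + Num.conj (pf (h' c) (g c)).
  pose c' i := c i - s *: inner x0 (x1' c i).
  have h'E : peq (h' c') (pD (h' c) (pZ s (g c))).
    move=> z; rewrite pfB pfD pfZ pfB !SE mulr_sumr -addrA; congr (_ + _).
    rewrite -sumrN -sumrN -big_split; apply: eq_bigr => i _ /=.
    by rewrite actBl actZl opprB addrC.
  have := cmin c'; rewrite h'E (peql _ h'E).
  move: (g c) gM (h' c) => k kM w; rewrite pfD !pfDl !pfZ !pfZl.
  have -> : Num.conj s = s by rewrite geC0_conj // ltW.
  rewrite (pfC w k) -subr_ge0 => H1.
  rewrite -subr_ge0 -(pmulr_rge0 _ s0).
  have : 0 <= s * s * (M - pf k k) + (t - e).
    apply: addr_ge0; rewrite ?subr_ge0 //; apply: mulr_ge0; last by rewrite subr_ge0.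
    by rewrite mulr_ge0 // (ltW s0).
  move=> /(addr_ge0 H1) H2; apply: le_trans H2 _.
  rewrite le_eqVlt; apply/orP; left; apply/eqP.
  have sM : s * M = d / 2 by rewrite /s; field; rewrite gt_eqF.
  rewrite (_ : s * s * _ = s * (d / 2) - s * s * pf k k); last first.
    by rewrite -sM; ring.
  by rewrite /t; field.
rewrite (step c) -[- d]addr0 -[- d]add0r lerD ?IH // lerD //.
have [b bE] := inner_positive x0.
by rewrite /p bE actM act_adjr starK pf_ge0.
Qed.

End hilbert_module.

(** * Tensor products *)

Definition tform (R : realType) (A : cstarType R) (T : Type) (g : T -> T -> A)
    (H : rep A) (u v : seq (T * H)) : R[i] :=
  \sum_(a <- u) \sum_(b <- v) pf a.2 (act (g a.1 b.1) b.2).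

(* A set of generators of a right Hilbert module, not necessarily closed under
   linear combinations. *)
Record hmod (R : realType) (A : cstarType R) := Hmod {
  tcar :> Type;
  tin : tcar -> tcar -> A;
  trt : tcar -> A -> tcar;
  tinr : forall s t c, tin s (trt t c) = cmul (tin s t) c;
  tinC : forall s t, tin t s = star (tin s t);
  tin_cp : forall (H : rep A) (u : seq (tcar * H)), 0 <= tform tin u u
}.

Section tensor.
Variables (R : realType) (A : cstarType R).
Local Notation K := R[i].
Implicit Types (T : hmod A) (H : rep A).

Lemma tinl T (s t : T) c : tin (trt s c) t = cmul (star c) (tin s t).
Proof. by rewrite tinC tinr starM -tinC. Qed.

Section ht.
Variables (T : hmod A) (H : rep A).
Local Notation tf := (tform (@tin _ _ T) (H := H)).

Definition hscale (l : K) (u : seq (T * H)) := [seq (a.1, pZ l a.2) | a <- u].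

Fact ht_z u : tf u [::] = 0.
Proof. by rewrite /tform big1 // => a _; rewrite big_nil. Qed.
Fact ht_D u v w : tf u (v ++ w) = tf u v + tf u w.
Proof. by rewrite /tform -big_split; apply: eq_bigr => a _; rewrite big_cat. Qed.
Fact ht_Z u l v : tf u (hscale l v) = l * tf u v.
Proof.
rewrite /tform mulr_sumr; apply: eq_bigr => a _; rewrite big_map mulr_sumr.
by apply: eq_bigr => b _; rewrite actZ.
Qed.
Fact ht_C u v : tf v u = Num.conj (tf u v).
Proof.
rewrite /tform rmorph_sum exchange_big; apply: eq_bigr => a _ /=.
rewrite rmorph_sum; apply: eq_bigr => b _ /=.
by rewrite -pfC act_adj tinC.
Qed.

Definition ht : preHilbert K :=
  PreHilbert ht_z ht_D ht_Z ht_C (@tin_cp _ _ T H).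
End ht.

Definition simple T H (t : T) (h : H) : ht T H := [:: (t, h)].

Lemma pf_ht1 T H (t t' : T) (h h' : H) :
  pf (simple t h) (simple t' h') = pf h (act (tin t t') h').
Proof. by rewrite /= /tform !big_seq1. Qed.

Lemma pf_htE T H (u v : ht T H) :
  pf u v = \sum_(a <- u) \sum_(b <- v) pf a.2 (act (tin a.1 b.1) b.2).
Proof. by []. Qed.

Lemma pf_ht_simplel T H (t : T) (h : H) (v : ht T H) :
  pf (simple t h) v = \sum_(b <- v) pf h (act (tin t b.1) b.2).
Proof. by rewrite pf_htE big_seq1. Qed.

(* The adjoint of [h |-> t (x) h]. *)
Definition tadj T H (t : T) (v : ht T H) : H :=
  pcomb [seq (1, act (tin t b.1) b.2) | b <- v].

Lemma pf_tadj T H (t : T) (h : H) (v : ht T H) :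
  pf h (tadj t v) = pf (simple t h) v.
Proof.
by rewrite pf_ht_simplel pf_comb big_map; apply: eq_bigr => b _; rewrite mul1r.
Qed.

Lemma ht_simple_total T H (v : ht T H) :
  (forall t h, pf (simple t h) v = 0) -> pf v v = 0.
Proof.
move=> v0; rewrite {1}pf_htE big1 // => -[t h] _ /=.
by rewrite -pf_ht_simplel v0.
Qed.

Lemma ht_peq T H (u v : ht T H) :
  (forall t h, pf (simple t h) u = pf (simple t h) v) -> peq u v.
Proof.
move=> uv w; rewrite !pf_htE; apply: eq_bigr => -[t h] _ /=.
by rewrite -!pf_ht_simplel uv.
Qed.

(* The list of the (c, (s, t)) stands for the sum of the c * s <t, _>. *)
Definition operator T := seq (K * (T * T)).

Definition oact T H (k : operator T) (u : ht T H) : ht T H :=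
  [seq (b.2.1, pZ b.1 (act (tin b.2.2 a.1) a.2)) | b <- k, a <- u].

(* The matrix coefficient <s, k t> in A. *)
Definition oel T (k : operator T) (s t : T) : A :=
  \sum_(b <- k) b.1 *: cmul (tin s b.2.1) (tin b.2.2 t).

Lemma pf_oact T H (k : operator T) (u v : ht T H) :
  pf u (oact k v) = \sum_(a <- u) \sum_(c <- v) pf a.2 (act (oel k a.1 c.1) c.2).
Proof.
rewrite pf_htE; apply: eq_bigr => a _; rewrite big_allpairs_dep /=.
rewrite exchange_big; apply: eq_bigr => c _; rewrite /oel act_suml.
by apply: eq_bigr => b _; rewrite actZ actZl actM.
Qed.

Lemma pf_oact1 T H (k : operator T) (s t : T) (h h' : H) :
  pf (simple s h) (oact k (simple t h')) = pf h (act (oel k s t) h').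
Proof. by rewrite pf_oact !big_seq1. Qed.

Definition oD T (k k' : operator T) : operator T := k ++ k'.
Definition oZ T (l : K) (k : operator T) : operator T := [seq (l * b.1, b.2) | b <- k].
Definition oB T (k k' : operator T) := oD k (oZ (-1) k').
Definition oS T (k : operator T) : operator T :=
  [seq (Num.conj b.1, (b.2.2, b.2.1)) | b <- k].
Definition oM T (k k' : operator T) : operator T :=
  [seq (b.1 * c.1, (trt b.2.1 (tin b.2.2 c.2.1), c.2.2)) | b <- k, c <- k'].

Lemma oelD T (k k' : operator T) s t : oel (oD k k') s t = oel k s t + oel k' s t.
Proof. by rewrite /oel big_cat. Qed.

Lemma oelZ T l (k : operator T) s t : oel (oZ l k) s t = l *: oel k s t.
Proof.
by rewrite /oel big_map scaler_sumr; apply: eq_bigr => b _; rewrite scalerA.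
Qed.

Lemma oelB T (k k' : operator T) s t : oel (oB k k') s t = oel k s t - oel k' s t.
Proof. by rewrite oelD oelZ scaleN1r. Qed.

Lemma star_sum (I : Type) (s : seq I) (F : I -> A) :
  star (\sum_(i <- s) F i) = \sum_(i <- s) star (F i).
Proof. exact: (big_morph _ (@starD _ A) (@star0 _ A)). Qed.

Lemma cmul_suml (I : Type) (s : seq I) (F : I -> A) c :
  cmul (\sum_(i <- s) F i) c = \sum_(i <- s) cmul (F i) c.
Proof. exact: (big_morph (fun x => cmul x c) (fun a b => cmulDl a b c) (cmul0l c)). Qed.

Lemma cmul_sumr (I : Type) (s : seq I) (F : I -> A) c :
  cmul c (\sum_(i <- s) F i) = \sum_(i <- s) cmul c (F i).
Proof. exact: (big_morph _ (cmulDr c) (cmul0r c)). Qed.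

Lemma oelS T (k : operator T) s t : oel (oS k) s t = star (oel k t s).
Proof.
rewrite /oel big_map star_sum; apply: eq_bigr => b _ /=.
by rewrite starZ starM -!tinC.
Qed.

Lemma oelM T (k k' : operator T) s t :
  oel (oM k k') s t = \sum_(c <- k') c.1 *: cmul (oel k s c.2.1) (tin c.2.2 t).
Proof.
rewrite /oel big_allpairs_dep exchange_big /=; apply: eq_bigr => c _.
rewrite cmul_suml scaler_sumr; apply: eq_bigr => b _.
by rewrite tinr cmulZl scalerA mulrC -cmulA !cmulA.
Qed.

Lemma pf_oactM T H (k k' : operator T) (u v : ht T H) :
  pf u (oact (oM k k') v) = pf u (oact k (oact k' v)).
Proof.
rewrite !pf_oact; apply: eq_bigr => a _; rewrite big_allpairs_dep /= exchange_big.
apply: eq_bigr => c _; rewrite oelM act_suml; apply: eq_bigr => b _.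
by rewrite actZl actM actZ.
Qed.

Lemma oact_adj T H (k : operator T) (u v : ht T H) :
  pf (oact k u) v = pf u (oact (oS k) v).
Proof.
rewrite pfC !pf_oact rmorph_sum exchange_big; apply: eq_bigr => a _ /=.
rewrite rmorph_sum; apply: eq_bigr => c _ /=.
by rewrite -pfC act_adj -oelS.
Qed.

Lemma oSK T (k : operator T) s t : oel (oS (oS k)) s t = oel k s t.
Proof. by rewrite !oelS starK. Qed.

Lemma oact_el T H (k k' : operator T) (u v : ht T H) :
  (forall s t, oel k s t = oel k' s t) -> pf u (oact k v) = pf u (oact k' v).
Proof.
by move=> kk'; rewrite !pf_oact; do 2!(apply: eq_bigr => ? _); rewrite kk'.
Qed.

Lemma oact_adjr T H (k : operator T) (u v : ht T H) :
  pf u (oact k v) = pf (oact (oS k) u) v.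
Proof. by rewrite oact_adj; apply: oact_el => s t; rewrite oSK. Qed.

Lemma oactD T H (k k' : operator T) (u v : ht T H) :
  pf u (oact (oD k k') v) = pf u (oact k v) + pf u (oact k' v).
Proof.
rewrite !pf_oact -big_split; apply: eq_bigr => a _ /=; rewrite -big_split.
by apply: eq_bigr => b _; rewrite oelD act_addl.
Qed.

Lemma oactZ T H l (k : operator T) (u v : ht T H) :
  pf u (oact (oZ l k) v) = l * pf u (oact k v).
Proof.
rewrite !pf_oact mulr_sumr; apply: eq_bigr => a _ /=; rewrite mulr_sumr.
by apply: eq_bigr => b _; rewrite oelZ actZl.
Qed.

Lemma oactB T H (k k' : operator T) (u v : ht T H) :
  pf u (oact (oB k k') v) = pf u (oact k v) - pf u (oact k' v).
Proof. by rewrite oactD oactZ mulN1r. Qed.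

Lemma oact_pD T H (k : operator T) (u v w : ht T H) :
  pf u (oact k (pD v w)) = pf u (oact k v) + pf u (oact k w).
Proof. by rewrite oact_adjr pfD -!oact_adjr. Qed.

Lemma oact_pZ T H (k : operator T) l (u v : ht T H) :
  pf u (oact k (pZ l v)) = l * pf u (oact k v).
Proof. by rewrite oact_adjr pfZ -oact_adjr. Qed.

Lemma oact_peq T H (k : operator T) (v w : ht T H) :
  peq v w -> peq (oact k v) (oact k w).
Proof. by move=> vw u; rewrite oact_adjr vw -oact_adjr. Qed.

Definition theta T (t t' : T) : operator T := [:: (1, (t, t'))].

Lemma oel_theta T (t t' s s' : T) : oel (theta t t') s s' = cmul (tin s t) (tin t' s').
Proof. by rewrite /oel big_seq1 scale1r. Qed.

Definition ann H (c : A) := forall x y : H, pf x (act c y) = 0.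
Definition kills T H (k : operator T) := forall s t, ann H (oel k s t).

Lemma kills_oact T H (k : operator T) : kills H k ->
  forall u v : ht T H, pf u (oact k v) = 0.
Proof. by move=> k0 u v; rewrite pf_oact big1 // => a _; rewrite big1 // => c _; exact: k0. Qed.

Lemma oact_kills T H (k : operator T) :
  (forall u v : ht T H, pf u (oact k v) = 0) -> kills H k.
Proof. by move=> k0 s t x y; rewrite -pf_oact1. Qed.

Lemma annMl H a c : ann H c -> ann H (cmul a c).
Proof. by move=> c0 x y; rewrite actM act_adjr. Qed.

Lemma annMr H a c : ann H c -> ann H (cmul c a).
Proof. by move=> c0 x y; rewrite actM. Qed.

Lemma annS H c : ann H c -> ann H (star c).
Proof. by move=> c0 x y; rewrite act_adjr starK pfC c0 conjC0. Qed.

Lemma annD H a c : ann H a -> ann H c -> ann H (a + c).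
Proof. by move=> a0 c0 x y; rewrite act_addl a0 c0 addr0. Qed.

Lemma annZ H l c : ann H c -> ann H (l *: c).
Proof. by move=> c0 x y; rewrite actZl c0 mulr0. Qed.

Lemma ann0 H : ann H 0.
Proof. by move=> x y; rewrite act0l. Qed.

Lemma ann_sum H (I : Type) (s : seq I) (f : I -> A) :
  (forall j, ann H (f j)) -> ann H (\sum_(j <- s) f j).
Proof.
move=> f0; elim: s => [|j s IH]; rewrite ?big_nil ?big_cons; first exact: ann0.
exact: annD.
Qed.

Lemma ann_mulS H c : ann H (cmul c (star c)) -> ann H c.
Proof.
move=> c0 x y; rewrite act_adjr pfC null_pf ?conjC0 //.
by rewrite act_adj starK -actM.
Qed.

(** The operator [theta t t] gives [<v, t t^* v> = 0], so that [t^* v] is null for each [t] and [v]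
    is orthogonal to all simple tensors. *)
Lemma operators_nondegenerate T H (v : ht T H) :
  (forall k (u : ht T H), pf (oact k u) v = 0) -> pf v v = 0.
Proof.
move=> v0; apply: ht_simple_total => t h; rewrite -pf_tadj.
apply: null_pf; rewrite pf_tadj.
have : pf v (oact (theta t t) v) = 0 by rewrite oact_adjr v0.
rewrite pf_oact => E.
have : pf (tadj t v) (tadj t v) = \sum_(a <- v) pf a.2 (act (tin a.1 t) (tadj t v)).
  rewrite {1}pfC pf_comb rmorph_sum big_map; apply: eq_bigr => a _ /=.
  by rewrite mul1r -pfC act_adj -tinC.
rewrite pf_tadj pf_ht_simplel => ->; rewrite -[RHS]E; apply: eq_bigr => a _.
rewrite act_comb big_map; apply: eq_bigr => b _ /=.
by rewrite mul1r oel_theta actM.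
Qed.

(** Preserving coefficients is enough: [f] then commutes with the action modulo null vectors, by
    [rep_isometry_comm]. *)
Record rep_isometry H H' (f : H -> H') : Prop := RepIsometry {
  rep_iso : isometry f;
  rep_iso_act : forall c x y, pf (f x) (act c (f y)) = pf x (act c y)
}.

Definition hmap T H H' (f : H -> H') (u : ht T H) : ht T H' :=
  [seq (a.1, f a.2) | a <- u].

Lemma hmap_oact T H H' (f : H -> H') (k : operator T) (u v : ht T H) :
  rep_isometry f -> pf (hmap f u) (oact k (hmap f v)) = pf u (oact k v).
Proof.
move=> [_ fa]; rewrite !pf_oact big_map; apply: eq_bigr => a _; rewrite big_map.
by apply: eq_bigr => b _; rewrite fa.
Qed.

Lemma hmap_isometry T H H' (f : H -> H') : rep_isometry f -> isometry (hmap f : ht T H -> ht T H').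
Proof.
move=> [_ fa] u v; rewrite !pf_htE big_map; apply: eq_bigr => a _; rewrite big_map.
by apply: eq_bigr => b _; rewrite fa.
Qed.

(** The square norm of the difference has four terms of the same size, which cancel. *)
Lemma hmap_oact_comm T H H' (f : H -> H') (k : operator T) (v : ht T H) :
  rep_isometry f -> peq (hmap f (oact k v)) (oact k (hmap f v)).
Proof.
move=> ff; have fi := @hmap_isometry T _ _ _ ff; apply: null_peq.
have E (x y : ht T H) : pf (oact k (hmap f x)) (oact k (hmap f y)) = pf (oact k x) (oact k y).
  by rewrite !oact_adj -!pf_oactM hmap_oact.
have XY : pf (hmap f (oact k v)) (oact k (hmap f v)) = pf (oact k v) (oact k v).
  exact: hmap_oact.
by rewrite pfB !pfBl fi E XY [pf (oact k _) (hmap f _)]pfC XY -pfC !subrr.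
Qed.

Lemma ht_dense T H (V : preHilbert K) (f : V -> ht T H) : isometry f ->
  (forall t h, adherent f (simple t h)) -> dense f.
Proof.
move=> fi fs; elim=> [|[t h] u IH]; first exact: adherent_pz.
exact: (adherentD fi (fs t h) IH).
Qed.

Lemma pf_ht_simpleB T H (t : T) (h h' : H) (u : ht T H) :
  pf u (pB (simple t h) (simple t h')) = pf u (simple t (pB h h')).
Proof.
rewrite pfB !pf_htE -sumrB; apply: eq_bigr => a _.
by rewrite !big_seq1 /= actB.
Qed.

Lemma hmap_dense T H H' (f : H -> H') : rep_isometry f -> dense f ->
  dense (hmap f : ht T H -> ht T H').
Proof.
move=> ff fd; apply: ht_dense; first exact: hmap_isometry.
(* t (x) h depends continuously on h, and [act_form_bound] provides the constant. *)
move=> t h e e0; pose M := 2 * `|tin t t| + 1.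
have M0 : 0 < M by rewrite ltr_wpDl // mulr_ge0.
have eM : 0 < e / M by rewrite divr_gt0.
have [x xe] := fd h _ eM; exists (simple t x).
rewrite -[hmap _ _]/(simple t (f x)) pf_ht_simpleB (peql _ (pf_ht_simpleB _ _ _)) pf_ht1.
apply: (@le_lt_trans _ _ (M * pf (pB h (f x)) (pB h (f x)))); last by rewrite -ltr_pdivlMl // mulrC.
apply: (@le_trans _ _ `|pf (pB h (f x)) (act (tin t t) (pB h (f x)))|).
  by rewrite real_ler_norm // -pf_ht1 ger0_real // pf_ge0.
apply: le_trans (act_form_bound _ _) _.
by rewrite ler_wpM2r ?pf_ge0 // lerDl.
Qed.

End tensor.

Section correspondence.
Variables (R : realType) (A B : cstarType R) (X : correspondenceType B A).
Implicit Types (x y : X) (b : B).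

Lemma inner_eq (y z : X) : (forall x, inner x y = inner x z :> A) -> y = z.
Proof.
move=> yz; apply/eqP; rewrite -subr_eq0; apply/eqP/(@inner_definite _ A).
by rewrite innerDr -scaleN1r innerZr yz !scaleN1r subrr.
Qed.

Lemma inner_lactr x b y : inner x (lact b y) = inner (lact (star b) x) y :> A.
Proof. by rewrite lact_adjoint starK. Qed.

Lemma lactDl a b x : lact (a + b) x = lact a x + lact b x.
Proof. by have := @lact_linear _ _ _ X 1 a b x; rewrite !scale1r. Qed.

Lemma lact0l x : lact (0 : B) x = 0.
Proof. by apply: (addIr (lact (0 : B) x)); rewrite -lactDl !add0r. Qed.

Lemma lactZl (l : R[i]) b x : lact (l *: b) x = l *: lact b x.
Proof. by rewrite -[l *: b]addr0 lact_linear lact0l addr0. Qed.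

Lemma lact_sum (I : Type) (s : seq I) (F : I -> B) x :
  lact (\sum_(i <- s) F i) x = \sum_(i <- s) lact (F i) x.
Proof. exact: (big_morph (fun b => lact b x) (fun a b => lactDl a b x) (lact0l x)). Qed.

Lemma inner_sumr (I : Type) (s : seq I) (F : I -> X) x :
  inner x (\sum_(i <- s) F i) = \sum_(i <- s) inner x (F i) :> A.
Proof. exact: (big_morph _ (innerDr x) (inner0r x)). Qed.

Lemma lact_ract b x (a : A) : lact b (ract x a) = ract (lact b x) a.
Proof. by apply: inner_eq => z; rewrite inner_lactr !inner_ract inner_lactr. Qed.

End correspondence.

Section hmods.
Variables (R : realType) (A : cstarType R).
Local Notation K := R[i].

Section hilbert.
Variable X : hilbertModuleType A.

Fact hilbert_tin_cp (H : rep A) (u : seq (X * H)) :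
  0 <= tform (@inner _ _ X) u u.
Proof.
rewrite /tform big_tnth; under eq_bigr do rewrite big_tnth.
exact: (hilbert_module_cp (fun i => (tnth (in_tuple u) i).1) (fun i => (tnth (in_tuple u) i).2)).
Qed.

Definition hilbert_hmod : hmod A :=
  @Hmod _ _ X (@inner _ _ X) (@ract _ _ X) (@inner_ract _ _ X) (@inner_star _ _ X)
    hilbert_tin_cp.
End hilbert.

Fact unit_tinr (s t c : A) : cmul (star s) (cmul t c) = cmul (cmul (star s) t) c.
Proof. exact: cmulA. Qed.

Fact unit_tinC (s t : A) : cmul (star t) s = star (cmul (star s) t).
Proof. by rewrite starM starK. Qed.

Fact unit_tin_cp (H : rep A) (u : seq (A * H)) :
  0 <= tform (fun s t => cmul (star s) t) u u.
Proof.
pose w : H := pcomb [seq (1, act a.1 a.2) | a <- u].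
have wE z : pf z w = \sum_(a <- u) pf z (act a.1 a.2).
  by rewrite pf_comb big_map; under eq_bigr do rewrite mul1r.
suff -> : tform (fun s t => cmul (star s) t) u u = pf w w by exact: pf_ge0.
rewrite wE /tform exchange_big; apply: eq_bigr => b _ /=.
rewrite pfC wE rmorph_sum; apply: eq_bigr => a _ /=.
by rewrite -pfC actM act_adjr starK.
Qed.

Definition unit_hmod : hmod A := Hmod unit_tinr unit_tinC unit_tin_cp.

End hmods.

(** * Induced representations and associativity *)

Section tens.
Variables (R : realType) (A B : cstarType R).
Local Notation K := R[i].

Section tensor_rep.
Variables (X : correspondenceType B A) (H : rep A).
Local Notation XH := (ht (hilbert_hmod X) H).

Definition tens_act (b : B) (u : XH) : XH := [seq (lact b a.1, a.2) | a <- u].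

Lemma pf_tens_act b (u v : XH) :
  pf u (tens_act b v) = \sum_(a <- u) \sum_(c <- v)
    pf a.2 (act (inner a.1 (lact b c.1)) c.2).
Proof. by rewrite pf_htE; apply: eq_bigr => a _; rewrite big_map. Qed.

Fact tens_act_lin (l : K) (a b : B) (x y : XH) :
  pf x (tens_act (l *: a + b) y) = l * pf x (tens_act a y) + pf x (tens_act b y).
Proof.
rewrite !pf_tens_act mulr_sumr -big_split; apply: eq_bigr => c _ /=.
rewrite mulr_sumr -big_split; apply: eq_bigr => d _ /=.
by rewrite lact_linear inner_linearr act_lin.
Qed.

Fact tens_actM (a b : B) (x y : XH) :
  pf x (tens_act (cmul a b) y) = pf x (tens_act a (tens_act b y)).
Proof.
rewrite !pf_tens_act; apply: eq_bigr => c _; rewrite big_map.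
by apply: eq_bigr => d _; rewrite lactM.
Qed.

Fact tens_act_adj (a : B) (x y : XH) :
  pf (tens_act a x) y = pf x (tens_act (star a) y).
Proof.
rewrite pfC !pf_tens_act rmorph_sum exchange_big; apply: eq_bigr => c _ /=.
rewrite rmorph_sum; apply: eq_bigr => d _ /=.
by rewrite -pfC act_adj -inner_star lact_adjoint.
Qed.

Definition tens : rep B := Rep tens_act_lin tens_actM tens_act_adj.

Definition tsimple (x : X) (h : H) : tens := [:: (x, h)].
Definition tsadj (x : X) (u : tens) : H := tadj (T := hilbert_hmod X) x u.

Lemma pf_tsadj x h (u : tens) : pf h (tsadj x u) = pf (tsimple x h) u.
Proof. exact: pf_tadj. Qed.

Lemma pf_tsimple x h (u : tens) :
  pf (tsimple x h) u = \sum_(b <- u) pf h (act (inner x b.1) b.2).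
Proof. exact: pf_ht_simplel. Qed.

Lemma tsimple_total (u : tens) : (forall x h, pf (tsimple x h) u = 0) -> pf u u = 0.
Proof. exact: (@ht_simple_total _ _ (hilbert_hmod X)). Qed.
End tensor_rep.

Section tprod.
Variables (T : hmod B) (X : correspondenceType B A).

Definition tprod_in (p q : T * X) : A := inner p.2 (lact (tin p.1 q.1) q.2).
Definition tprod_rt (p : T * X) (c : A) : T * X := (p.1, ract p.2 c).

Fact tprod_inr p q c : tprod_in p (tprod_rt q c) = cmul (tprod_in p q) c.
Proof. by rewrite /tprod_in /= lact_ract inner_ract. Qed.

Fact tprod_inC p q : tprod_in q p = star (tprod_in p q).
Proof. by rewrite /tprod_in -inner_star lact_adjoint -tinC. Qed.

Definition assoc (H : rep A) (u : seq (T * X * H)) : ht T (tens X H) :=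
  [seq (a.1.1, [:: (a.1.2, a.2)]) | a <- u].

Lemma pf_assoc (H : rep A) (u v : seq (T * X * H)) :
  pf (assoc u) (assoc v) = tform tprod_in u v.
Proof.
rewrite pf_htE big_map; apply: eq_bigr => a _; rewrite big_map.
by apply: eq_bigr => b _; rewrite [LHS]pf_tens_act !big_seq1.
Qed.

Fact tprod_in_cp (H : rep A) (u : seq (T * X * H)) : 0 <= tform tprod_in u u.
Proof. by rewrite -pf_assoc pf_ge0. Qed.

Definition tprod : hmod A := Hmod tprod_inr tprod_inC tprod_in_cp.
End tprod.

End tens.

Section assoc.
Variables (R : realType) (A B : cstarType R).
Variables (T : hmod B) (X : correspondenceType B A) (H : rep A).

Lemma assoc_isometry : isometry (assoc (H := H) : ht (tprod T X) H -> ht T (tens X H)).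
Proof. by move=> u v; exact: pf_assoc. Qed.

Lemma assoc_dense : dense (assoc (H := H) : ht (tprod T X) H -> ht T (tens X H)).
Proof.
apply: ht_dense; first exact: assoc_isometry.
move=> t xs.
pose x : ht (tprod T X) H := [seq ((t, a.1), a.2) | a <- (xs : seq (X * H))].
apply: (adherent_peq (x := x)).
move=> u; rewrite !pf_htE; apply: eq_bigr => -[s ys] _ /=.
rewrite big_seq1 big_map big_map /=.
rewrite [LHS]pf_tens_act exchange_big; apply: eq_bigr => a _ /=.
by rewrite /tform; apply: eq_bigr => b _; rewrite big_seq1.
Qed.

End assoc.

Section tensor_map.
Variables (R : realType) (A B D : cstarType R) (X : correspondenceType A B).
Local Notation K := R[i].
Variables (Y : correspondenceType B D) (Z : correspondenceType A D) (t : X -> Y -> Z).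
Hypothesis tt : is_tensor_map t.
Variable H : rep D.

(** The map x (x) (y (x) h) -> t(x, y) (x) h, flattened because an element of Y (x) H is itself a
    list. *)
Definition tensor_rep_map (u : tens X (tens Y H)) : tens Z H :=
  flatten [seq [seq (t a.1 b.1, b.2) | b <- a.2] | a <- (u : seq (X * seq (Y * H)))].

Lemma tensor_rep_mapE (F : Z * H -> K) (u : seq (X * seq (Y * H))) :
  \sum_(a <- tensor_rep_map u) F a = \sum_(a <- u) \sum_(b <- a.2) F (t a.1 b.1, b.2).
Proof.
by rewrite big_flatten big_map; apply: eq_bigr => a _; rewrite big_map.
Qed.

Lemma pf_tensor_rep_map (c : A) (u v : tens X (tens Y H)) :
  pf (tensor_rep_map u) (act c (tensor_rep_map v)) = pf u (act c v).
Proof.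
rewrite [LHS]pf_tens_act [RHS]pf_tens_act tensor_rep_mapE; apply: eq_bigr => a _.
under eq_bigr do rewrite tensor_rep_mapE.
rewrite exchange_big; apply: eq_bigr => b _ /=.
rewrite [RHS]pf_tens_act; apply: eq_bigr => a' _; apply: eq_bigr => b' _ /=.
by rewrite -(tensor_lact tt) (tensor_inner tt).
Qed.

Lemma tensor_rep_map_isometry : rep_isometry tensor_rep_map.
Proof.
split=> [u v|c u v]; last exact: pf_tensor_rep_map.
rewrite !pf_htE tensor_rep_mapE; apply: eq_bigr => a _.
under eq_bigr do rewrite tensor_rep_mapE.
rewrite exchange_big; apply: eq_bigr => b _ /=.
rewrite [RHS]pf_tens_act; apply: eq_bigr => a' _; apply: eq_bigr => b' _ /=.
by rewrite (tensor_inner tt).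
Qed.

(** The span of the [t x y] is dense for the norm of [Z], and z (x) h depends continuously on z. The
    scalars are put on [h] so as to have simple tensors. *)
Lemma tensor_simple_approx (z : Z) (h : H) (e : K) : 0 < e ->
  exists n (c : 'I_n -> K) (x : 'I_n -> X) (y : 'I_n -> Y),
  let d : ht (hilbert_hmod Z) H := pB (simple (T := hilbert_hmod Z) z h)
    [seq (t (x i) (y i), pZ (c i) h) | i <- index_enum 'I_n] in pf d d < e.
Proof.
move=> e0; pose M := 2 * (pf h h + 1).
have M0 : 0 < M by rewrite mulr_gt0 // ltr_wpDl // pf_ge0.
have [r r0 re] : exists2 r : K, 0 < r & r ^+ 2 * M <= e.
  exists (sqrtC (e / M)); first by rewrite sqrtC_gt0 divr_gt0.
  by rewrite sqrtCK divfK // gt_eqF.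
have : closure (linear_span [set t p.1 p.2 | p in [set: X * Y]]) z.
  by rewrite (tensor_dense tt).
move=> /(_ (ball z r)) [|z' [[n [c [w [wt ->]]]] zr]]; first exact: nbhsx_ballx.
have {wt} [x [y wE]] : exists x y, forall i, w i = t (x i) (y i).
  have /choice[f fE] i : exists p, w i = t p.1 p.2.
    by have [p _ <-] := wt i; exists p.
  by exists (fun i => (f i).1), (fun i => (f i).2).
exists n, c, x, y; pose d := z - \sum_(i < n) c i *: w i.
move=> u; have {}uE : peq u (simple (T := hilbert_hmod Z) d h).
  apply: ht_peq => s k; rewrite pfB !pf_ht_simplel !big_seq1 big_map /=.
  rewrite /d /= innerDr -scaleN1r innerZr scaleN1r inner_sumr actBl act_suml.
  congr (_ - _); apply: eq_bigr => i _; by rewrite innerZr actZl actZ wE.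
rewrite (uE _) (peql _ uE) pf_ht1.
apply: (@le_lt_trans _ _ `|pf h (act (inner d d) h)|).
  rewrite real_ler_norm // ger0_real // -(pf_ht1 (T := hilbert_hmod Z)) pf_ge0 //.
apply: le_lt_trans (act_form_bound _ _) _.
rewrite -normr_inner; apply: lt_le_trans re.
have dr : `|d| < r by move: zr; rewrite -ball_normE.
apply: (@le_lt_trans _ _ (`|d| ^+ 2 * M)).
  rewrite /M [leLHS](_ : _ = `|d| ^+ 2 * (2 * pf h h)); last by ring.
  by rewrite ler_wpM2l ?exprn_ge0 // ler_wpM2l // lerDl.
by rewrite ltr_pM2r // ltrXn2r ?nnegrE // ltW.
Qed.

Lemma tensor_rep_map_dense : dense tensor_rep_map.
Proof.
apply: ht_dense; first exact: (rep_iso tensor_rep_map_isometry).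
move=> z h e /(tensor_simple_approx z h)[n [c [x [y zE]]]].
exists [seq (x i, [:: (y i, pZ (c i) h)]) | i <- index_enum 'I_n].
suff -> : tensor_rep_map [seq (x i, [:: (y i, pZ (c i) h)]) | i <- index_enum 'I_n] =
  [seq (t (x i) (y i), pZ (c i) h) | i <- index_enum 'I_n] by exact: zE.
by rewrite /tensor_rep_map -map_comp /=; elim: index_enum => //= i s ->.
Qed.

(** The error [d] of a close approximation of z (x) h would have the same nonzero product [a] with
    [v], against Cauchy-Schwarz. *)
Lemma tensor_simple_orth (z : Z) (h : H) (v : ht (hilbert_hmod Z) H) :
  (forall x y, pf (simple (T := hilbert_hmod Z) (t x y) h) v = 0) ->
  pf (simple (T := hilbert_hmod Z) z h) v = 0.
Proof.
move=> v0; apply/eqP/negPn/negP; set a := pf _ v => a0.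
have e0 : 0 < `|a| ^+ 2 / (pf v v + 1).
  by rewrite divr_gt0 ?exprn_gt0 ?normr_gt0 // ltr_wpDl // pf_ge0.
have [n [c [x [y]]]] := tensor_simple_approx z h e0; cbv zeta; set d := pB _ _ => de.
have dv : pf d v = a.
  rewrite pfBl -[RHS]subr0; congr (_ - _).
  rewrite pf_htE big_map big1 // => i _ /=.
  have := v0 (x i) (y i); rewrite pf_ht_simplel => E.
  under eq_bigr do rewrite pfZl.
  by rewrite -mulr_sumr E mulr0.
have := cauchy_schwarz d v; rewrite dv => /le_lt_trans H1.
suff /H1 : pf d d * pf v v < `|a| ^+ 2 by rewrite ltxx.
apply: (@le_lt_trans _ _ (pf d d * (pf v v + 1))).
  by rewrite ler_wpM2l ?pf_ge0 // lerDl.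
by rewrite -ltr_pdivlMr // ltr_wpDl // pf_ge0.
Qed.

End tensor_map.

(** * Chains of correspondences *)

Section invariance.
Variables (R : realType) (A : cstarType R).
Local Notation K := R[i].
Implicit Types (H : rep A).

Lemma rep_isometry_comm H H' (f : H -> H') c x :
  rep_isometry f -> peq (f (act c x)) (act c (f x)).
Proof.
move=> [fi fa]; apply: null_peq.
have E : pf (act c (f x)) (act c (f x)) = pf (act c x) (act c x).
  by rewrite !act_adj -!actM fa.
by rewrite pfB !pfBl fi fa E [pf (act c (f x)) _]pfC fa -pfC !subrr.
Qed.

(** This is what allows a tensor product to be replaced by any of its models. *)
Lemma ann_dense H H' (f : H -> H') c : rep_isometry f -> dense f ->
  ann H c <-> ann H' c.
Proof.
move=> ff fd; split=> [c0 x y|c0 x y]; last by rewrite -(rep_iso_act ff) c0.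
apply: null_pf; apply: (dense_orth fd) => z.
rewrite act_adjr -(peql _ (rep_isometry_comm _ _ ff)) pfC null_pf ?conjC0 //.
by rewrite (rep_iso ff) act_adj starK.
Qed.

Lemma ann_tens (B : cstarType R) (X : correspondenceType B A) H b :
  ann (tens X H) b <-> forall x x' : X, ann H (inner x (lact b x')).
Proof.
split=> [b0 x x' h h'|b0 u v].
  have := b0 (tsimple x h) (tsimple x' h').
  by rewrite [LHS]pf_tens_act !big_seq1.
by rewrite [LHS]pf_tens_act big1 // => a _; rewrite big1 // => c _; exact: b0.
Qed.

(** The kernel of an induced representation is a function of the kernel of [H], so that replacements
    can be made under any number of tensor factors. *)
Lemma ann_tens_eq (B : cstarType R) (X : correspondenceType B A) H H' :
  (forall c, ann H c <-> ann H' c) -> forall b, ann (tens X H) b <-> ann (tens X H') b.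
Proof.
move=> HH' b; rewrite !ann_tens.
by split=> b0 x x'; apply/HH'.
Qed.

End invariance.

(* An identification of [A] with the functions on ['I_n], [unitv v] being the
   indicator of [v]. *)
Record fin_coordinates (R : realType) (A : cstarType R) (n : nat) := FinCoordinates {
  coord : 'I_n -> A -> R[i];
  unitv : 'I_n -> A;
  coord_lin : forall v l a b, coord v (l *: a + b) = l * coord v a + coord v b;
  coordM : forall v a b, coord v (cmul a b) = coord v a * coord v b;
  coordS : forall v a, coord v (star a) = Num.conj (coord v a);
  coord_inj : forall a, (forall v, coord v a = 0) -> a = 0;
  coord_unitv : forall v w, coord v (unitv w) = (v == w)%:R
}.

(* [X] is isomorphic to the graph correspondence of [M], whose elements are the
   functions on the edges. *)
Record graph_basis (R : realType) (A : cstarType R) n (F : fin_coordinates A n)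
    (X : correspondenceType A A) (M : 'M[nat]_n) := GraphBasis {
  edgev : edge M -> X;
  edgev_inner : forall e f,
    inner (edgev e) (edgev f) = (e == f)%:R *: unitv F (erange e);
  edgev_lact : forall v e, lact (unitv F v) (edgev e) = (v == esource e)%:R *: edgev e;
  edgev_expand : forall y, y = \sum_e ract (edgev e) (inner (edgev e) y)
}.

Section fin_coordinates.
Variables (R : realType) (A : cstarType R) (n : nat) (F : fin_coordinates A n).
Local Notation coord := (coord F).
Local Notation unitv := (unitv F).

Lemma coordD v a b : coord v (a + b) = coord v a + coord v b.
Proof. by rewrite -[a]scale1r coord_lin mul1r scale1r. Qed.

Lemma coord0 v : coord v 0 = 0.
Proof. by apply: (addIr (coord v 0)); rewrite -coordD !add0r. Qed.

Lemma coordZ v l a : coord v (l *: a) = l * coord v a.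
Proof. by rewrite -[l *: a]addr0 coord_lin coord0 addr0. Qed.

Lemma coord_sum v (I : Type) (s : seq I) (G : I -> A) :
  coord v (\sum_(i <- s) G i) = \sum_(i <- s) coord v (G i).
Proof. exact: (big_morph _ (coordD v) (coord0 v)). Qed.

Lemma coord_eq a b : (forall v, coord v a = coord v b) -> a = b.
Proof.
move=> ab; apply/eqP; rewrite -subr_eq0 -scaleN1r; apply/eqP/(@coord_inj _ _ _ F) => v.
by rewrite coordD coordZ ab mulN1r subrr.
Qed.

Lemma coord_expand a : a = \sum_v coord v a *: unitv v.
Proof.
apply: coord_eq => v; rewrite coord_sum (bigD1 v) //= coordZ coord_unitv eqxx mulr1.
rewrite big1 ?addr0 // => w wv.
by rewrite coordZ coord_unitv eq_sym (negPf wv) mulr0.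
Qed.

Definition fin_unit : A := \sum_v unitv v.

Lemma coord_fin_unit v : coord v fin_unit = 1.
Proof.
rewrite coord_sum (bigD1 v) //= coord_unitv eqxx big1 ?addr0 // => w wv.
by rewrite coord_unitv eq_sym (negPf wv).
Qed.

Lemma fin_unitl a : cmul fin_unit a = a.
Proof. by apply: coord_eq => v; rewrite coordM coord_fin_unit mul1r. Qed.

Lemma fin_unitr a : cmul a fin_unit = a.
Proof. by apply: coord_eq => v; rewrite coordM coord_fin_unit mulr1. Qed.

Lemma fin_unitS : star fin_unit = fin_unit.
Proof. by apply: coord_eq => v; rewrite coordS coord_fin_unit conjC1. Qed.

Lemma unitvS v : star (unitv v) = unitv v.
Proof.
by apply: coord_eq => w; rewrite coordS coord_unitv; case: eqP; rewrite ?conjC0 ?conjC1.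
Qed.

Lemma unitvM v a : cmul (unitv v) a = coord v a *: unitv v.
Proof.
apply: coord_eq => w; rewrite coordM coordZ coord_unitv.
by case: eqP => [->|_]; rewrite ?mul1r ?mulr1 ?mul0r ?mulr0.
Qed.

Lemma unitvMr v a : cmul a (unitv v) = coord v a *: unitv v.
Proof. by apply: coord_eq => w; rewrite -unitvM !coordM mulrC. Qed.

Section point.
Variable v : 'I_n.

Definition point_space : preHilbert R[i].
Proof.
refine (@PreHilbert _ R[i] 0 +%R *%R (fun x y => Num.conj x * y) _ _ _ _ _).
- by move=> x; rewrite mulr0.
- by move=> x y z; rewrite mulrDr.
- by move=> x l y; rewrite mulrCA.
- by move=> x y; rewrite rmorphM /= conjCK mulrC.
- by move=> x; rewrite mulrC mul_conjC_ge0.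
Defined.

Definition point_rep : rep A.
Proof.
refine (@Rep _ _ point_space (fun a x => coord v a * x) _ _ _).
- by move=> l a b x y /=; rewrite coord_lin; ring.
- by move=> a b x y /=; rewrite coordM; ring.
- by move=> a x y /=; rewrite coordS rmorphM /=; ring.
Defined.
End point.

Definition std_space : preHilbert R[i].
Proof.
refine (@PreHilbert _ ('I_n -> R[i]) (fun=> 0) (fun x y v => x v + y v)
  (fun l x v => l * x v) (fun x y => \sum_v Num.conj (x v) * y v) _ _ _ _ _).
- by move=> x; rewrite big1 // => v _; rewrite mulr0.
- by move=> x y z; rewrite -big_split; apply: eq_bigr => v _ /=; rewrite mulrDr.
- by move=> x l y; rewrite mulr_sumr; apply: eq_bigr => v _; rewrite mulrCA.
- move=> x y; rewrite rmorph_sum; apply: eq_bigr => v _ /=.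
  by rewrite rmorphM /= conjCK mulrC.
- by move=> x; apply: sumr_ge0 => v _; rewrite mulrC mul_conjC_ge0.
Defined.

Definition std_rep : rep A.
Proof.
refine (@Rep _ _ std_space (fun a x v => coord v a * x v) _ _ _).
- move=> l a b x y /=; rewrite mulr_sumr -big_split; apply: eq_bigr => v _ /=.
  by rewrite coord_lin; ring.
- by move=> a b x y /=; apply: eq_bigr => v _; rewrite coordM; ring.
- by move=> a x y /=; apply: eq_bigr => v _; rewrite coordS rmorphM /=; ring.
Defined.

Lemma ann_point v a : ann (point_rep v) a <-> coord v a = 0.
Proof.
split=> [a0|a0 x y /=]; last by rewrite a0 mul0r mulr0.
by have /= := a0 1 1; rewrite conjC1 mul1r mulr1.
Qed.

Lemma ann_std a : ann std_rep a -> a = 0.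
Proof.
move=> a0; apply: (@coord_inj _ _ _ F) => v.
have /= := a0 (fun w => (w == v)%:R) (fun w => (w == v)%:R).
rewrite (bigD1 v) //= eqxx conjC1 mul1r mulr1 big1 ?addr0 // => w wv.
by rewrite (negPf wv) mulr0 mulr0.
Qed.

End fin_coordinates.

Lemma tsimple_fin_unit (R : realType) (A B : cstarType R) n (F : fin_coordinates A n)
    (X : correspondenceType B A) (H : rep A) (y : X) (h : H) (u : tens X H) :
  pf (tsimple y (act (fin_unit F) h)) u = pf (tsimple y h) u.
Proof.
rewrite !pf_tsimple; apply: eq_bigr => a _.
by rewrite act_adj fin_unitS -actM fin_unitl.
Qed.

Section graph_basis.
Variables (R : realType) (A : cstarType R) (n : nat) (F : fin_coordinates A n).
Variables (X : correspondenceType A A) (M : 'M[nat]_n) (gb : graph_basis F X M).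

Lemma lact_fin_unit (y : X) : lact (fin_unit F) y = y.
Proof.
rewrite (edgev_expand gb (lact _ y)) [RHS](edgev_expand gb).
apply: eq_bigr => e _; congr ract; rewrite inner_lactr fin_unitS; congr inner.
rewrite /fin_unit lact_sum (bigD1 (esource e)) //= (edgev_lact gb) eqxx scale1r.
by rewrite big1 ?addr0 // => v ve; rewrite (edgev_lact gb) (negPf ve) scale0r.
Qed.

Lemma pf_graph_basis (H : rep A) (y : X) (h : H) (u : tens X H) :
  pf (tsimple y h) u = \sum_e pf (act (inner (edgev gb e) y) h) (tsadj (edgev gb e) u).
Proof.
rewrite pf_tsimple; under [RHS]eq_bigr do rewrite pf_tsadj pf_tsimple.
rewrite exchange_big; apply: eq_bigr => a _ /=.
rewrite {1}[a.1](edgev_expand gb) inner_sumr act_suml; apply: eq_bigr => e _.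
by rewrite inner_ract actM act_adj -inner_star.
Qed.

Lemma graph_basis_total (H : rep A) (u : tens X H) :
  (forall e h, pf (tsimple (edgev gb e) h) u = 0) -> pf u u = 0.
Proof.
move=> u0; apply: tsimple_total => y h; rewrite pf_graph_basis big1 // => e _.
by rewrite pf_tsadj u0.
Qed.

End graph_basis.

Section chain.
Variables (R : realType) (C : nat -> cstarType R).
Local Notation K := R[i].
Variables (P : forall i, correspondenceType (C i) (C i.+1))
  (Q : forall i, correspondenceType (C i.+1) (C i))
  (Y : forall i, correspondenceType (C i) (C i)) (k : nat).
Hypothesis hPQ : forall i, (i <= k)%N -> is_interior_tensor (P i) (Q i) (Y i).
Hypothesis hQP : forall i, (i <= k)%N -> is_interior_tensor (Q i) (P i) (Y i.+1).

(* [Tm i] is P_0 (x) ... (x) P_(i-1), [Nm i G] is Q_(i-1) (x) ... (x) Q_0 (x) G,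
   [Pm i H] is P_0 (x) ... (x) P_(i-1) (x) H, and [Ym n H] is the tensor product
   of n copies of Y_i with H. *)
Fixpoint Tm i : hmod (C i) :=
  match i with 0%N => unit_hmod (C 0%N) | j.+1 => tprod (Tm j) (P j) end.

Fixpoint Nm i (G : rep (C 0%N)) : rep (C i) :=
  match i with 0%N => G | j.+1 => tens (Q j) (Nm j G) end.

Fixpoint Pm i : rep (C i) -> rep (C 0%N) :=
  match i return rep (C i) -> rep (C 0%N) with
  | 0%N => fun H => H | j.+1 => fun H => Pm (tens (P j) H) end.

Fixpoint Ym (i : nat) (n : nat) (H : rep (C i)) : rep (C i) :=
  if n is m.+1 then tens (Y i) (Ym m H) else H.

Lemma annPQ i (H : rep (C i)) c : (i <= k)%N ->
  ann (tens (P i) (tens (Q i) H)) c <-> ann (tens (Y i) H) c.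
Proof.
move=> /hPQ[t tt].
exact: ann_dense (tensor_rep_map_isometry tt H) (tensor_rep_map_dense tt (H := H)).
Qed.

Lemma annQP i (H : rep (C i.+1)) c : (i <= k)%N ->
  ann (tens (Q i) (tens (P i) H)) c <-> ann (tens (Y i.+1) H) c.
Proof.
move=> /hQP[t tt].
exact: ann_dense (tensor_rep_map_isometry tt H) (tensor_rep_map_dense tt (H := H)).
Qed.

(** Both are the kernel of Q_i (x) P_i (x) Q_i (x) H, bracketed in two ways. *)
Lemma annQY i (H : rep (C i)) c : (i <= k)%N ->
  ann (tens (Q i) (tens (Y i) H)) c <-> ann (tens (Y i.+1) (tens (Q i) H)) c.
Proof.
move=> ik; rewrite -annQP //; apply: ann_tens_eq => d.
by rewrite annPQ.
Qed.

Lemma annYN i (G : rep (C 0%N)) c : (i <= k.+1)%N ->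
  ann (tens (Y i) (Nm i G)) c <-> ann (Nm i (tens (Y 0%N) G)) c.
Proof.
elim: i c => [//|i IH] c ik; rewrite /= -annQY //.
by apply: ann_tens_eq => d; apply: IH; exact: ltnW.
Qed.

Lemma annQYm i n (H : rep (C i)) c : (i <= k)%N ->
  ann (tens (Q i) (Ym n H)) c <-> ann (Ym n (tens (Q i) H)) c.
Proof.
move=> ik; elim: n c => [//|n IH] c /=; rewrite annQY //.
exact: ann_tens_eq.
Qed.

Lemma ann_Ym_eq i n (H H' : rep (C i)) : (forall c, ann H c <-> ann H' c) ->
  forall c, ann (Ym n H) c <-> ann (Ym n H') c.
Proof. by move=> HH'; elim: n => [//|n IH]; exact: ann_tens_eq. Qed.

Lemma YmS i n (H : rep (C i)) : Ym n (tens (Y i) H) = tens (Y i) (Ym n H).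
Proof. by elim: n => //= n ->. Qed.

(** From [i] to [i.+1], the [i] copies of Y_i standing between Q_i and P_i are carried across Q_i
    and become copies of Y_(i+1); the remaining Q_i (x) P_i is one more copy. *)
Lemma annNP i (H : rep (C i)) c : (i <= k.+1)%N ->
  ann (Nm i (Pm H)) c <-> ann (Ym i H) c.
Proof.
elim: i H c => [//|i IH] H c ik /=.
rewrite -YmS -(ann_Ym_eq i (fun d => annQP H d ik)) -annQYm //.
by apply: ann_tens_eq => d; apply: IH; exact: ltnW.
Qed.

(* The forms of [Pm H] are those of the inner products of [Tm i] on [H]. *)
Lemma ann_Pm i (H : rep (C i)) :
  (forall s t : Tm i, ann H (tin s t)) -> forall a b, ann (Pm H) (cmul (star a) b).
Proof.
elim: i H => [|i IH] H H0 a b; first exact: H0.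
apply: IH => s t; apply/ann_tens => x x'.
exact: (H0 (s, x) (t, x')).
Qed.

(* The matrix coefficients of [Nm i G] factor through those of [G]. *)
Lemma ann_Nm i c (G G' : rep (C 0%N)) : (forall a, ann G a -> ann G' a) ->
  ann (Nm i G) c -> ann (Nm i G') c.
Proof.
move=> GG'; elim: i c => [|i IH] c /=; first exact: GG'.
by move=> /ann_tens c0; apply/ann_tens => x x'; exact: IH.
Qed.

Section finite_level0.
Variables (p : nat) (F : fin_coordinates (C 0%N) p) (M : 'M[nat]_p).
Hypothesis gb : graph_basis F (Y 0%N) M.

(** T_0 (x) H amounts to the range of [one] on H, by way of [ev]; tensoring a basis of it with the
    finitely many edges gives a total family. *)
Lemma findim_TY0 (H : rep (C 0%N)) :
  findim (ht (Tm 0) H) -> findim (ht (Tm 0) (tens (Y 0%N) H)).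
Proof.
move=> [n [w [_ _ wt]]]; set one := fin_unit F.
have oneE : cmul (star one) one = one by rewrite /one fin_unitS fin_unitl.
pose ev (u : ht (Tm 0) H) : H := pcomb [seq (1, act a.1 a.2) | a <- (u : seq (C 0%N * H))].
have evE u z : pf (ev u) z = pf u (simple (T := Tm 0) one z).
  rewrite pfC pf_comb big_map rmorph_sum; apply: eq_bigr => a _ /=.
  by rewrite mul1r -pfC big_seq1 /= act_adj fin_unitr.
pose u (i : 'I_n * edge M) : ht (Tm 0) (tens (Y 0%N) H) :=
  simple (T := Tm 0) one (tsimple (edgev gb i.2) (ev (w i.1))).
apply: (findim_total (u := u)) => v v0.
pose yv : tens (Y 0%N) H := tadj (T := Tm 0) one v.
suff yv0 : pf yv yv = 0.
  apply: ht_simple_total => a h; rewrite pf_ht_simplel -[RHS](null_pf (act a h) yv0).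
  rewrite pf_comb big_map; apply: eq_bigr => b _.
  by rewrite mul1r act_adj -actM /= /one fin_unitS fin_unitl.
apply: (graph_basis_total (gb := gb)) => e h; rewrite -pf_tsadj.
pose z := tsadj (edgev gb e) yv.
have z1 x : pf x (act one z) = pf x z.
  by rewrite act_adjr fin_unitS !pf_tsadj tsimple_fin_unit.
rewrite -z1; apply: null_pf; rewrite act_adj -actM oneE.
suff : pf (simple (T := Tm 0) one z) (simple (T := Tm 0) one z) = 0.
  by rewrite pf_ht1 -[tin _ _]/(cmul (star one) one) oneE.
apply: wt => // i; rewrite -evE pf_tsadj pf_tadj; exact: (v0 (i, e)).
Qed.

(** T_(i+1) (x) Y_(i+1) (x) H is, up to density, T_i (x) P_i (x) Q_i (x) P_i (x) H, which embeds in
    T_i (x) Y_i (x) (P_i (x) H), where induction applies. *)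
Lemma findim_TY i (H : rep (C i)) : (i <= k.+1)%N ->
  findim (ht (Tm i) H) -> findim (ht (Tm i) (tens (Y i) H)).
Proof.
elim: i H => [|i IH] H ik; first by move=> *; exact: findim_TY0.
move=> fH; have [t tt] := hPQ ik; have [t' tt'] := hQP ik.
have gi := hmap_isometry (T := Tm i) (tensor_rep_map_isometry tt (tens (P i) H)).
have f1 := hmap_isometry (T := Tm i.+1) (tensor_rep_map_isometry tt' H).
apply: (findim_dense f1).
  exact: hmap_dense (tensor_rep_map_isometry tt' H) (tensor_rep_map_dense tt' (H := H)).
apply: (findim_isometry (@assoc_isometry _ _ _ (Tm i) (P i) _)).
apply: (findim_isometry gi); apply: IH; first exact: ltnW.
exact: findim_dense (@assoc_isometry _ _ _ (Tm i) (P i) H)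
    (@assoc_dense _ _ _ (Tm i) (P i) H) fH.
Qed.

(* <T Y, T Y> is contained in the closed ideal generated by <T, T>. *)
Lemma TY_total i (H : rep (C i)) (v : ht (Tm i) (tens (Y i) H)) : (i <= k.+1)%N ->
  findim (ht (Tm i) (tens (Y i) H)) ->
  (forall (t : Tm i) y (t1 t2 : Tm i) h,
    pf (simple t (tsimple y (act (tin t1 t2) h))) v = 0) -> pf v v = 0.
Proof.
elim: i H v => [|i IH] H v ik fv v0.
  apply: ht_simple_total => t u; rewrite -pf_tadj; apply: null_pf.
  apply: tsimple_total => y h; rewrite -(tsimple_fin_unit F) pf_tadj.
  by have := v0 t y (fin_unit F) (fin_unit F) h; rewrite /= fin_unitS fin_unitl.
have [t tt] := hPQ ik; have [t' tt'] := hQP ik.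
(* Unfolding Y into its factors gives a space with dense isometries to both levels; finite dimension
   lets [v] be represented by an element [d] of it. *)
pose D := ht (Tm i.+1) (tens (Q i) (tens (P i) H)).
pose f1 : D -> ht (Tm i.+1) (tens (Y i.+1) H) := hmap (tensor_rep_map t' (H := H)).
pose f2 : D -> ht (Tm i) (tens (Y i) (tens (P i) H)) :=
  hmap (tensor_rep_map t (H := tens (P i) H)) \o assoc (H := tens (Q i) (tens (P i) H)).
have f1i : isometry f1 := hmap_isometry (tensor_rep_map_isometry tt' H).
have f1d : dense f1.
  exact: hmap_dense (tensor_rep_map_isometry tt' H) (tensor_rep_map_dense tt' (H := H)).
have gi := hmap_isometry (T := Tm i) (tensor_rep_map_isometry tt (tens (P i) H)).
have f2i : isometry f2.
  by move=> x y; exact: etrans (gi _ _) (assoc_isometry _ _).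
have f2d : dense f2.
  apply: (dense_comp gi); first exact: assoc_dense.
  exact: hmap_dense (tensor_rep_map_isometry tt (tens (P i) H)) (tensor_rep_map_dense tt (H := _)).
have fD : findim D := findim_isometry f1i fv.
have [d vd] := findim_dense_surj v f1i f1d fD.
suff v20 : pf (f2 d) (f2 d) = 0 by rewrite vd (peql _ vd) f1i -(f2i d) v20.
have claim (s : Tm i) y r (s1 s2 : Tm i.+1) h :
    pf (simple s (tsimple y (tsimple r (act (tin s1 s2) h)))) (f2 d) = 0.
  rewrite -pf_tadj; apply: (tensor_simple_orth tt) => a b.
  set h' := tsimple r _; transitivity (pf (simple s (tsimple (t a b) h')) (f2 d)).
    exact: (pf_tadj s (tsimple (t a b) h') (f2 d)).
  rewrite -[simple s _]/(f2 (simple (T := Tm i.+1) (s, a) (tsimple b h'))).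
  by rewrite f2i -f1i -vd; exact: v0.
apply: IH => //; [exact: ltnW|exact: findim_dense f2i f2d fD|] => s y t1 t2 h.
rewrite -pf_tadj -pf_tsadj; set z := tsadj y _; set c := tin t1 t2.
rewrite pf_htE big_map big1 // => -[r h0] _ /=; rewrite -pf_tsimple -pf_tsadj.
set u := tsadj _ z; apply: null_pf.
have uE x : pf x u = pf (simple s (tsimple y (tsimple (lact c r) x))) (f2 d).
  by rewrite !pf_tsadj pf_tadj.
rewrite uE pfC null_pf ?conjC0 //; set X := inner y (lact (tin s s) y).
rewrite pf_ht1 [LHS]pf_tens_act !big_seq1 /= -/X /tform !big_seq1 /=.
(* As [c] is an inner product of T_i, the square norm of s (x) y (x) c r (x) u is a coefficient of
   [u] at an inner product of T_(i+1), and [claim] makes it vanish. *)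
have -> : inner (lact c r) (lact X (lact c r)) =
    tin ((t2, r) : Tm i.+1) (trt t1 (cmul X c), r) :> C i.+1.
  by rewrite /= /tprod_in /= tinr lactM lactM lact_adjoint -tinC.
by rewrite pfC uE claim conjC0.
Qed.

Local Notation G0 := (std_rep F).

(* The second condition says that the finite rank operators on [Tm i] act on
   [Tm i (x) H] through a single finite dimensional algebra. *)
Definition good i (H : rep (C i)) := findim (ht (Tm i) H) /\
  forall o : operator (Tm i), kills (Nm i G0) o -> kills H o.

Lemma good_isometry i (H H' : rep (C i)) (f : H -> H') :
  rep_isometry f -> good H' -> good H.
Proof.
move=> ff [fd dom]; split.
  exact: findim_isometry (hmap_isometry (T := Tm i) ff) fd.
by move=> o /dom o0 s t x y; rewrite -(rep_iso_act ff) o0.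
Qed.

Lemma ht_unit (H : rep (C 0%N)) a (h : H) (v : ht (Tm 0) H) :
  pf (simple (T := Tm 0) a h) v = pf (act a h) (tadj (T := Tm 0) (fin_unit F) v).
Proof.
rewrite pf_ht_simplel pf_comb big_map; apply: eq_bigr => b _.
by rewrite mul1r act_adj -actM /= fin_unitS fin_unitl.
Qed.

Lemma findim_T0 (H : rep (C 0%N)) : findim H -> findim (ht (Tm 0) H).
Proof.
move=> [n [w [_ _ wt]]].
pose u a : ht (Tm 0) H := simple (T := Tm 0) (fin_unit F) (w a).
apply: (findim_total (u := u)) => v v0; apply: ht_simple_total => t h.
rewrite ht_unit; apply: null_pf; apply: wt => // a.
by rewrite pf_tadj; exact: v0.
Qed.

Lemma good_unit (H : rep (C 0%N)) : findim H -> good H.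
Proof.
move=> fH; split; first exact: findim_T0.
by move=> o o0 s t x y; rewrite (ann_std (o0 s t)) act0l.
Qed.

Lemma findim_std (B : cstarType R) n (F' : fin_coordinates B n) : findim (std_rep F').
Proof.
pose u (v w : 'I_n) : K := (w == v)%:R.
apply: (@findim_total _ (std_rep F') _ u) => x x0.
apply: null_pf => /=; rewrite big1 // => v _.
have := x0 v; rewrite /= (bigD1 v) //= /u eqxx conjC1 mul1r big1 ?addr0.
  by move=> ->; rewrite mulr0.
by move=> w wv; rewrite (negPf wv) conjC0 mul0r.
Qed.

(** P_i (x) Q_i acts as Y_i, which [annYN] carries down to level 0, where [G0] has zero kernel. *)
Lemma ann_tensPN i c : (i <= k)%N -> ann (Nm i G0) c ->
  ann (tens (P i) (Nm i.+1 G0)) c.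
Proof.
move=> ik c0; apply/annPQ/annYN => //; first exact: leqW.
by apply: ann_Nm c0 => a /ann_std ->; exact: ann0.
Qed.

Lemma good_P i (H : rep (C i.+1)) : (i <= k)%N -> good H -> good (tens (P i) H).
Proof.
move=> ik [fH dom]; split.
  exact: findim_dense (@assoc_isometry _ _ _ (Tm i) (P i) H)
    (@assoc_dense _ _ _ (Tm i) (P i) H) fH.
move=> o o0 t1 t2; apply/ann_tens => r r'; set g := inner r _.
have gs (s s' : Tm i.+1) : ann H (cmul g (tin s s')).
  (* This operator sends s' to (o t2 (x) r') <s, s'>. Its coefficient between (t1, r) and s' is
     [cmul g (tin s s')], and it kills [Nm i.+1] because [o] kills [Nm i]. *)
  pose o' : operator (Tm i.+1) := [seq (b.1, ((trt b.2.1 (tin b.2.2 t2), r'), s)) | b <- o].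
  have o'E u (q : P i) s'' : oel o' (u, q) s'' = cmul (inner q (lact (oel o u t2) r')) (tin s s'').
    rewrite /oel big_map lact_sum inner_sumr cmul_suml; apply: eq_bigr => b _.
    by rewrite lactZl innerZr cmulZl /= /tprod_in /= tinr.
  rewrite -o'E; apply: dom => -[u q] s''; rewrite o'E; apply: annMr.
  have /ann_tens := ann_tensPN ik (o0 u t2); exact.
(* [star g] is itself a combination of inner products of T_(i+1), so that [gs] applies to
   [cmul g (star g)]. *)
apply: ann_mulS.
have -> : star g = \sum_(b <- o) Num.conj b.1 *:
    tin ((t2, r') : Tm i.+1) (trt b.2.2 (tin b.2.1 t1), r).
  rewrite /g -inner_star lact_adjoint -oelS /oel big_map lact_sum inner_sumr.
  by apply: eq_bigr => b _; rewrite lactZl innerZr /= /tprod_in /= tinr.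
rewrite cmul_sumr; apply: ann_sum => b; rewrite cmulZr; apply: annZ; exact: gs.
Qed.

(** [TY_total], read through P_i (x) Q_i = Y_i: of H, the product T_(i+1) (x) Q_i (x) H sees only
    what the inner products of T_i generate. *)
Lemma TQ_total i (H : rep (C i)) (v : ht (Tm i.+1) (tens (Q i) H)) : (i <= k)%N ->
  findim (ht (Tm i) H) ->
  (forall (s : Tm i.+1) q (t1 t2 : Tm i) h,
    pf (simple s (tsimple q (act (tin t1 t2) h))) v = 0) -> pf v v = 0.
Proof.
move=> ik fH v0; have [t tt] := hPQ ik.
have ff := tensor_rep_map_isometry tt H.
pose f : ht (Tm i.+1) (tens (Q i) H) -> ht (Tm i) (tens (Y i) H) :=
  hmap (tensor_rep_map t (H := H)) \o assoc (H := tens (Q i) H).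
have fi : isometry f.
  by move=> x y; exact: etrans (hmap_isometry ff _ _) (assoc_isometry _ _).
rewrite -fi; apply: TY_total => //; [exact: leqW|apply: findim_TY => //; exact: leqW|].
move=> s y t1 t2 h; rewrite -pf_tadj; apply: (tensor_simple_orth tt) => a b.
transitivity (pf (simple s (tsimple (t a b) (act (tin t1 t2) h))) (f v)).
  exact: (pf_tadj s (tsimple (t a b) (act (tin t1 t2) h)) (f v)).
rewrite -[simple s _]/(f (simple (T := Tm i.+1) (s, a) (tsimple b (act (tin t1 t2) h)))).
by rewrite fi.
Qed.

Lemma good_Q i (H : rep (C i)) : (i <= k)%N -> good H -> good (tens (Q i) H).
Proof.
move=> ik [fH dom]; split.
  have [t tt] := hPQ ik.
  apply: (findim_isometry (@assoc_isometry _ _ _ (Tm i) (P i) _)).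
  apply: (findim_isometry (hmap_isometry (T := Tm i) (tensor_rep_map_isometry tt H))).
  by apply: findim_TY => //; exact: leqW.
move=> o o0; apply: oact_kills => u v; apply: null_pf.
apply: TQ_total => // s q t1 t2 h; rewrite oact_adjr pfC null_pf ?conjC0 //.
apply: TQ_total => // s' q' t3 t4 h'; rewrite pf_oact1.
rewrite [LHS]pf_tens_act !big_seq1 /= act_adj -!actM oelS -tinC.
set a := inner q' _.
have a0 : ann (Nm i G0) a.
  by have /annS/ann_tens := o0 s s'; exact.
(* The domination of [H] concerns operators on T_i, not elements such as [a]. The use of [TQ_total]
   has surrounded [a] by inner products, and <t4, t3> a <t1, t2> is a coefficient of a rank one
   operator, which kills [Nm i] as [a] does. *)
have := dom (theta (trt t3 a) t1); rewrite /kills; move=> /(_ _ t4 t2).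
rewrite oel_theta tinr -cmulA; apply => s'' t''.
by rewrite oel_theta tinr; apply: annMr; exact: annMl.
Qed.

Lemma good_N i : (i <= k.+1)%N -> good (Nm i G0).
Proof.
elim: i => [|i IH] ik; first by apply: good_unit; exact: findim_std.
by apply: good_Q => //; apply: IH; exact: ltnW.
Qed.

End finite_level0.
End chain.

(** * Decomposition of representations *)

Section pullback.
Variables (R : realType) (A : cstarType R) (T : hmod A).
Local Notation K := R[i].

Lemma pf_tadjl (H : rep A) t (w : ht T H) y : pf (tadj t w) y = pf w (simple t y).
Proof. by rewrite pfC pf_tadj -pfC. Qed.

Lemma pf_tadj2 (H : rep A) c s t (w w' : ht T H) :
  pf (tadj s w) (act c (tadj t w')) = pf w (oact (theta (trt s c) t) w').
Proof.
rewrite pf_tadjl pf_htE pf_oact; apply: eq_bigr => a _.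
rewrite big_seq1 /= -actM act_comb big_map; apply: eq_bigr => b _.
by rewrite mul1r -actM oel_theta tinr.
Qed.

Lemma pf_tadj_theta (H : rep A) s t (w w' : ht T H) :
  pf (tadj s w) (tadj t w') = pf w (oact (theta s t) w').
Proof.
rewrite pf_tadjl pf_htE pf_oact; apply: eq_bigr => a _.
rewrite big_seq1 /= act_comb big_map; apply: eq_bigr => b _.
by rewrite mul1r -actM oel_theta.
Qed.

Section cyclic.
Variables (H : rep A) (w : ht T H).

Definition cyclic_map (u : seq (K * T)) : H := pcomb [seq (a.1, tadj a.2 w) | a <- u].

Lemma pf_cyclic_map z u : pf z (cyclic_map u) = \sum_(a <- u) a.1 * pf z (tadj a.2 w).
Proof. by rewrite pf_comb big_map. Qed.

Lemma pf_act_cyclic_map c z u :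
  pf z (act c (cyclic_map u)) = \sum_(a <- u) a.1 * pf z (act c (tadj a.2 w)).
Proof. by rewrite act_comb big_map. Qed.

Definition cyclic_space : preHilbert K.
Proof.
refine (@PreHilbert _ (seq (K * T)) [::] cat (fun l u => [seq (l * a.1, a.2) | a <- u])
  (fun u v => pf (cyclic_map u) (cyclic_map v)) _ _ _ _ _).
- by move=> u; rewrite pfz.
- by move=> u v v'; rewrite !pf_cyclic_map big_cat.
- move=> u l v; rewrite !pf_cyclic_map big_map mulr_sumr.
  by apply: eq_bigr => a _; rewrite mulrA.
- by move=> u v; exact: pfC.
- by move=> u; exact: pf_ge0.
Defined.

(** [c] times the adjoint of [t] is the adjoint of [trt t (star c)]. *)
Definition cyclic_act (c : A) (u : cyclic_space) : cyclic_space :=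
  [seq (a.1, trt a.2 (star c)) | a <- (u : seq (K * T))].

Lemma cyclic_actE c u : peq (cyclic_map (cyclic_act c u)) (act c (cyclic_map u)).
Proof.
move=> z; rewrite pf_cyclic_map pf_act_cyclic_map big_map.
apply: eq_bigr => a _ /=; congr (_ * _).
rewrite pf_tadj pf_ht_simplel act_comb big_map; apply: eq_bigr => b _ /=.
by rewrite mul1r tinl starK actM.
Qed.

(* The closure of [{t ^* w}] in [H], as a representation on the set of
   generators. *)
Definition cyclic_rep : rep A.
Proof.
refine (@Rep _ _ cyclic_space cyclic_act _ _ _).
- by move=> l a b x y; rewrite /= !cyclic_actE act_lin.
- move=> a b x y; rewrite /= !cyclic_actE actM.
  by apply: act_peq => z; rewrite cyclic_actE.
- by move=> a x y; rewrite /= cyclic_actE (peql _ (cyclic_actE _ _)) act_adj.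
Defined.

Lemma cyclic_map_isometry : rep_isometry (cyclic_map : cyclic_rep -> H).
Proof. by split=> // c x y /=; rewrite cyclic_actE. Qed.

End cyclic.

Definition rng (H : rep A) (p : operator T) (v : ht T H) := peq (oact p v) v.

Lemma rng_subspace (H : rep A) (p : operator T) : subspace (@rng H p).
Proof.
split.
- by move=> z; rewrite oact_adjr !pfz.
- by move=> x y xp yp z; rewrite oact_pD pfD xp yp.
- by move=> l x xp z; rewrite oact_pZ pfZ xp.
Qed.

Definition oproj (H : rep A) (p : operator T) :=
  kills H (oB (oS p) p) /\ kills H (oB (oM p p) p).

Lemma oproj_adj (H : rep A) (p : operator T) (u v : ht T H) : oproj H p ->
  pf (oact p u) v = pf u (oact p v).
Proof.
move=> [/kills_oact p0 _]; rewrite oact_adj; apply/eqP.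
by rewrite -subr_eq0 -oactB p0.
Qed.

Lemma oproj_rng (H : rep A) (p : operator T) (u : ht T H) : oproj H p ->
  rng p (oact p u).
Proof.
move=> [_ /kills_oact p0] z; rewrite -pf_oactM; apply/eqP.
by rewrite -subr_eq0 -oactB p0.
Qed.

Definition osum (s : seq (operator T)) : operator T := foldr (@oD _ _ T) [::] s.

Lemma oact_osum (H : rep A) s (u v : ht T H) :
  pf u (oact (osum s) v) = \sum_(o <- s) pf u (oact o v).
Proof.
elim: s => [|o s IH]; last by rewrite big_cons oactD IH.
by rewrite big_nil pf_oact big1 // => a _; rewrite big1 // => c _; rewrite /oel big_nil act0l.
Qed.

Lemma pf_oact_simple (H : rep A) (u : ht T H) (o : operator T) t y :
  pf u (oact o (simple t y)) =
  \sum_(b <- o) b.1 * pf u (simple (trt b.2.1 (tin b.2.2 t)) y).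
Proof.
rewrite pf_oact; under [RHS]eq_bigr do rewrite pf_htE mulr_sumr.
rewrite [RHS]exchange_big; apply: eq_bigr => a _ /=; rewrite big_seq1 act_suml.
by apply: eq_bigr => b _; rewrite big_seq1 actZl tinr.
Qed.

(** The sum [e] of the a p b is a left unit for the operators, which act non-degenerately, so that
    [z] may be replaced by [e z]; moving each a to the simple tensor leaves products with the ranges
    of the [p l]. *)
Lemma ideal_unit_total (L : Type) (p : L -> operator T) (H : rep A)
    (sg : seq (operator T * L * operator T)) :
  (forall o, kills H (oB (oM (osum [seq oM (oM a.1.1 (p a.1.2)) a.2 | a <- sg]) o) o)) ->
  forall (z : ht T H) y t,
  (forall l s (g : ht T H), pf (oact (p l) g) (simple s y) = 0) -> pf z (simple t y) = 0.
Proof.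
move=> gen z y t H0; pose e := osum [seq oM (oM a.1.1 (p a.1.2)) a.2 | a <- sg].
have eE (g : ht T H) : pf z g = pf (oact e z) g.
  pose g' := pB g (oact (oS e) g).
  suff g0 : pf g' g' = 0.
    have := null_pf z g0; rewrite pfB oact_adjr => /eqP; rewrite subr_eq0 => /eqP ->.
    by apply: peql => x; apply: oact_el => s s'; rewrite oSK.
  apply: operators_nondegenerate => o u; rewrite pfB [X in _ - X]oact_adjr.
  have -> : pf (oact (oS (oS e)) (oact o u)) g = pf (oact e (oact o u)) g.
    by apply: peql => x; apply: oact_el => s s'; rewrite oSK.
  rewrite pfC [X in _ - X]pfC -rmorphB -pf_oactM.
  have /kills_oact E := gen o.
  by rewrite -opprB -oactB E oppr0 rmorph0.
rewrite eE pfC oact_osum big_map big1 ?conjC0 // => a _.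
rewrite !pf_oactM oact_adjr pfC pf_oact_simple big1 ?conjC0 // => b _.
by rewrite H0 mulr0.
Qed.

(* On good representations the [sp l] are inequivalent minimal projections of
   the algebra of finite rank operators, and generate it as an ideal; [sw l] is a
   vector in the range of [sp l]. *)
Record system (good : rep A -> Prop) := System {
  sn : nat;
  sp : 'I_sn -> operator T;
  sH : 'I_sn -> rep A;
  sw : forall l, ht T (sH l);
  s_good : forall l, good (sH l);
  s_min : forall H l o, good H ->
    kills H (oB (oM (oM (sp l) o) (sp l)) (oZ (pf (sw l) (oact o (sw l))) (sp l)));
  s_orth : forall H l l' o, good H -> l != l' -> kills H (oM (oM (sp l) o) (sp l'));
  s_proj : forall H l, good H -> oproj H (sp l);
  s_total : forall H (z : ht T H) y t, good H ->
    (forall l s (g : ht T H), pf (oact (sp l) g) (simple s y) = 0) ->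
    pf z (simple t y) = 0
}.

Arguments sp {good} s l.
Arguments sH {good} s l.
Arguments sw {good} s l.
Arguments s_min {good} s {H} l o _.
Arguments s_orth {good} s {H l l'} o _ _.
Arguments s_proj {good} s {H} l _.
Arguments s_total {good} s {H}.

(** The L_b. Only a cyclic part of [sH S l] is kept, as [sH S l] may contain it several times, and
    others as well. *)
Definition sL good (S : system good) l : rep A := cyclic_rep (sw S l).
Arguments sL {good} S l.

Section system.
Variables (good : rep A -> Prop) (S : system good) (H : rep A).
Hypothesis gH : good H.

Lemma rng_form l o (w w' : ht T H) : rng (sp S l) w -> rng (sp S l) w' ->
  pf w (oact o w') = pf (sw S l) (oact o (sw S l)) * pf w w'.
Proof.
move=> wp wp'; have /kills_oact/(_ w w') := s_min S l o gH.
rewrite oactB oactZ !pf_oactM wp' => /eqP; rewrite subr_eq0 => /eqP <-.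
rewrite -(oproj_adj _ _ (s_proj S l gH)) (peql _ wp).
by apply/esym/oact_peq.
Qed.

Lemma rng_orth l l' o (w w' : ht T H) : l != l' ->
  rng (sp S l) w -> rng (sp S l') w' -> pf w (oact o w') = 0.
Proof.
move=> ll' wp wp'; have /kills_oact/(_ w w') := s_orth S o gH ll'.
rewrite !pf_oactM => <-.
rewrite -(oproj_adj _ _ (s_proj S l gH)) (peql _ wp).
by apply/esym/oact_peq.
Qed.

(** The products <s^* w, c t^* w> are values <w, o w> for rank one operators o; by minimality these
    depend on [l] only, not on the good representation or the unit vector [w]. *)
Lemma rng_cyclic_isometry l (w : ht T H) : rng (sp S l) w -> pf w w = 1 ->
  rep_isometry (cyclic_map w : sL S l -> H).
Proof.
move=> wp w1.
have E c x y : pf (cyclic_map w x) (act c (cyclic_map w y)) =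
    pf (cyclic_map (sw S l) x) (act c (cyclic_map (sw S l) y)).
  rewrite !pf_act_cyclic_map; apply: eq_bigr => b _; congr (_ * _).
  rewrite pfC [RHS]pfC !pf_cyclic_map; congr (Num.conj _); apply: eq_bigr => a _.
  rewrite pfC [pf _ (tadj a.2 (sw S l))]pfC; congr (_ * Num.conj _).
  by rewrite !pf_tadj2 (rng_form _ wp wp) w1 mulr1.
split=> [x y|c x y]; last by rewrite E /= cyclic_actE.
rewrite /= !pf_cyclic_map; apply: eq_bigr => b _; congr (_ * _).
rewrite pfC [RHS]pfC !pf_cyclic_map; congr (Num.conj _); apply: eq_bigr => a _.
rewrite pfC [pf _ (tadj a.2 (sw S l))]pfC; congr (_ * Num.conj _).
by rewrite !pf_tadj_theta (rng_form _ wp wp) w1 mulr1.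
Qed.

Lemma rng_cyclic_orth l l' (w w' : ht T H) c x y :
  rng (sp S l) w -> rng (sp S l') w' -> (l != l') || (pf w w' == 0) ->
  pf (cyclic_map w x) (act c (cyclic_map w' y)) = 0.
Proof.
move=> wp wp' ww'; rewrite pf_act_cyclic_map big1 // => b _.
rewrite pfC pf_cyclic_map big1 ?conjC0 ?mulr0 // => a _.
rewrite pfC pf_tadj2 //; have [ll'|] := eqVneq l l'; last first.
  by move=> ll'; rewrite (rng_orth _ ll' wp wp') conjC0 mulr0.
move: ww'; rewrite ll' eqxx orFb => /eqP w0.
by rewrite ll' in wp; rewrite (rng_form _ wp wp') w0 mulr0 conjC0 mulr0.
Qed.

End system.
End pullback.

Arguments sp {R A T good} s l.
Arguments sH {R A T good} s l.
Arguments sw {R A T good} s l.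
Arguments sL {R A T good} S l.
Arguments s_min {R A T good} s {H} l o _.
Arguments s_orth {R A T good} s {H l l'} o _ _.
Arguments s_proj {R A T good} s {H} l _.
Arguments s_total {R A T good} s {H}.

(** The multiplicity of an L_b in H, as a relation because the range may be infinite dimensional in
    general. *)
Definition range_dim (R : realType) (A : cstarType R) (T : hmod A) (H : rep A)
  (p : operator T) n := sdim (@rng _ _ T H p) n.

(** * Additivity of multiplicities *)

Section additivity.
Variables (R : realType) (A B : cstarType R) (T : hmod A) (T' : hmod B).
Variables (X : correspondenceType B A) (good : rep A -> Prop) (S : system T good).
Variables (H : rep A) (p : operator T').
Hypotheses (gH : good H).
Hypothesis total : forall v : ht T' (tens X H),
  (forall t x (t1 t2 : T) h, pf (simple t (tsimple x (act (tin t1 t2) h))) v = 0) ->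
  pf v v = 0.
Hypothesis pH : oproj (tens X H) p.
Hypothesis pL : forall l, oproj (tens X (sL S l)) p.

Definition tmap (H1 H2 : rep A) (f : H1 -> H2) (u : tens X H1) : tens X H2 :=
  hmap (T := hilbert_hmod X) f u.

Lemma tmap_isometry (H1 H2 : rep A) (f : H1 -> H2) :
  rep_isometry f -> rep_isometry (tmap f).
Proof.
move=> ff; split=> [|b u v]; first exact: (hmap_isometry (T := hilbert_hmod X) ff).
rewrite [LHS]pf_tens_act [RHS]pf_tens_act big_map; apply: eq_bigr => a _.
by rewrite big_map; apply: eq_bigr => c _; rewrite (rep_iso_act ff).
Qed.

Lemma tmap_orth (H1 H2 H3 : rep A) (f : H1 -> H3) (g : H2 -> H3) :
  (forall c x y, pf (f x) (act c (g y)) = 0) ->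
  forall b u v, pf (tmap f u) (act b (tmap g v)) = 0.
Proof.
move=> fg b u v; rewrite [LHS]pf_tens_act big_map big1 // => a _.
by rewrite big_map big1 // => c _; rewrite fg.
Qed.

Lemma hmap_orth (H1 H2 H3 : rep B) (f : H1 -> H3) (g : H2 -> H3) :
  (forall c x y, pf (f x) (act c (g y)) = 0) ->
  forall (u : ht T' H1) (v : ht T' H2), pf (hmap f u : ht T' H3) (hmap g v) = 0.
Proof.
move=> fg u v; rewrite pf_htE big_map big1 // => a _.
by rewrite big_map big1 // => c _; rewrite fg.
Qed.

(* [H] is, up to vectors which [X] and [T'] do not see, an orthogonal sum of
   copies of the [sL S l]. *)
Lemma range_dim_additive (M m : 'I_(sn S) -> nat) :
  (forall l, range_dim (tens X (sL S l)) p (M l)) -> (forall l, range_dim H (sp S l) (m l)) ->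
  range_dim (tens X H) p (\sum_l M l * m l).
Proof.
move=> /(_ _)/cid-/all_sig[W Wo] /(_ _)/cid-/all_sig[w wo].
have wp l b : rng (sp S l) (w l b) by case: (wo l).
have Wp l c : rng p (W l c) by case: (Wo l) => W1 _ _; exact: W1.
pose phi l b : sL S l -> H := cyclic_map (w l b).
have phii l b : rep_isometry (phi l b).
  apply: rng_cyclic_isometry => //; case: (wo l) => _ -> _; by rewrite eqxx.
(* The embedding of T' (x) X (x) L_l given by the copy of L_l that [w l b] generates in H. *)
pose iota l b : ht T' (tens X (sL S l)) -> ht T' (tens X H) := hmap (tmap (phi l b)).
have iotai l b : isometry (iota l b) := hmap_isometry (tmap_isometry (phii l b)).
pose J := {l : 'I_(sn S) & 'I_(m l) * 'I_(M l)}%type.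
pose V (j : J) := iota (tag j) (tagged j).1 (W (tag j) (tagged j).2).
have -> : (\sum_l M l * m l = #|{: J}|)%N.
  rewrite card_tagged sumnE big_map big_enum /=; apply: eq_bigr => l _.
  by rewrite card_prod !card_ord mulnC.
apply: (onb_sdim (w := V)); split.
- move=> [l [b c]]; rewrite /V /= => z.
  rewrite -(hmap_oact_comm p (W l c) (tmap_isometry (phii l b))).
  exact: (isometry_peq (iotai l b) (Wp l c)).
- move=> [l [b c]] [l' [b' c']].
  change (pf (iota l b (W l c)) (iota l' b' (W l' c')) =
    ((Tagged _ (b, c) : J) == (Tagged _ (b', c') : J))%:R).
  have [ll'|ll'] := eqVneq l l'; last first.
    rewrite (_ : pf _ _ = 0); last first.
      apply: hmap_orth; apply: tmap_orth => d x y.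
      by apply: rng_cyclic_orth (wp _ _) (wp _ _) _ => //; rewrite ll'.
    case: eqP => // E; move/eqP: ll' => []; exact: (congr1 tag E).
  case: l' / ll' in b' c' *.
  have -> : ((Tagged _ (b, c) : J) == (Tagged _ (b', c') : J)) = (b == b') && (c == c').
    by rewrite eq_Tagged.
  have [bb'|bb'] := eqVneq b b'; last first.
    apply: hmap_orth; apply: tmap_orth => d x y; apply: rng_cyclic_orth (wp _ _) (wp _ _) _ => //.
    by apply/orP; right; case: (wo l) => _ -> _; rewrite (negPf bb').
  by rewrite -bb' iotai; case: (Wo l) => _ -> _.
move=> v vp v0.
(* [p] fixes [v] and commutes with [iota l b], so that orthogonality to a basis of the range of [p]
   extends to the whole copy. *)
have iota0 l b u : pf (iota l b u) v = 0.
  have -> : pf (iota l b u) v = pf (iota l b (oact p u)) v.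
    rewrite -vp -(oproj_adj _ _ pH); apply/esym/peql.
    exact: hmap_oact_comm (tmap_isometry (phii l b)).
  have := onb_expand (rng_subspace _ p) (Wo l) (oproj_rng u (pL l)) => E.
  rewrite pfC (isometry_comb (s := [seq (pf (W l c) (oact p u), W l c) | c <- index_enum 'I_(M l)]) (iotai l b)).
    rewrite big_map big1 ?conjC0 // => c _; rewrite [X in _ * X]pfC.
    by rewrite (_ : pf _ v = 0) ?conjC0 ?mulr0 //; exact: (v0 (Tagged _ (b, c))).
  by move=> z; rewrite big_map E.
apply: total => t x t1 t2 h; rewrite -pf_tadj -pf_tsadj.
set y := tsadj x (tadj t v).
have -> : pf (act (tin t1 t2) h) y = pf (simple t2 h) (simple t1 y).
  by rewrite pf_ht1 act_adj -tinC.
(* It remains to test the ranges of the [sp S l]; a basis vector [w l b] of such a range leads to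
   the generator [e] of a copy, where [iota0] applies. *)
apply: (s_total S) => // l s g.
rewrite pfC (onb_expand (rng_subspace _ _) (wo l) (oproj_rng g (s_proj S l gH))).
rewrite big1 ?conjC0 // => b _; rewrite [X in _ * X]pfC -pf_tadjl.
pose e : sL S l := [:: (1, s)].
have : pf (phi l b e) y = 0 by rewrite pf_tsadj pf_tadj; exact: (iota0 l b (simple t (tsimple x e))).
rewrite pfC pf_cyclic_map big_seq1 mul1r -pfC => ->.
by rewrite conjC0 mulr0.
Qed.

End additivity.

(** * Existence of systems of minimal projections *)

Section matrix_system.
Local Open Scope sesquilinear_scope.
Variables (R : realType) (A : cstarType R) (T : hmod A) (good : rep A -> Prop).
Variable H0 : rep A.
Local Notation K := R[i].
Hypothesis gH0 : good H0.
Hypothesis dom : forall H, good H -> forall o : operator T, kills H0 o -> kills H o.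
Variables (n : nat) (w : 'I_n -> ht T H0).
Hypothesis wo : onb (@full _ (ht T H0)) w.

Definition opmx (o : operator T) : 'M[K]_n := \matrix_(a, b) pf (w a) (oact o (w b)).
Definition mxvect (v : 'cV[K]_n) : ht T H0 := pcomb [seq (v b 0, w b) | b <- index_enum 'I_n].

Lemma onb_expandl (u v : ht T H0) : pf u v = \sum_a pf u (w a) * pf (w a) v.
Proof.
rewrite (onb_expand (@subspace_full _ _) wo (v := v)) //.
by apply: eq_bigr => a _; rewrite mulrC.
Qed.

Lemma pf_mxvect u v : pf u (mxvect v) = \sum_b v b 0 * pf u (w b).
Proof. by rewrite pf_comb big_map. Qed.

Lemma pf_oact_mxvect u o v : pf u (oact o (mxvect v)) = \sum_b v b 0 * pf u (oact o (w b)).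
Proof.
by rewrite oact_adjr pf_mxvect; apply: eq_bigr => b _; rewrite -oact_adjr.
Qed.

Lemma opmxM o o' : opmx (oM o o') = opmx o *m opmx o'.
Proof.
apply/matrixP => a b; rewrite !mxE pf_oactM oact_adjr onb_expandl.
by apply: eq_bigr => c _; rewrite !mxE -oact_adjr.
Qed.

Lemma opmxD o o' : opmx (oD o o') = opmx o + opmx o'.
Proof. by apply/matrixP => a b; rewrite !mxE oactD. Qed.

Lemma opmxZ l o : opmx (oZ l o) = l *: opmx o.
Proof. by apply/matrixP => a b; rewrite !mxE oactZ. Qed.

Lemma opmxB o o' : opmx (oB o o') = opmx o - opmx o'.
Proof. by rewrite opmxD opmxZ scaleN1r. Qed.

Lemma opmxS o : opmx (oS o) = (opmx o)^t*.
Proof. by apply/matrixP => a b; rewrite !mxE -oact_adj pfC. Qed.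

Lemma opmx0 o : opmx o = 0 -> kills H0 o.
Proof.
move=> o0; apply: oact_kills => u v; rewrite onb_expandl big1 // => a _.
rewrite (_ : pf (w a) _ = 0) ?mulr0 // oact_adjr onb_expandl big1 // => b _.
rewrite -oact_adjr.
by have /matrixP/(_ a b) := o0; rewrite !mxE => ->; rewrite mul0r.
Qed.

Lemma opmx_nil : opmx [::] = 0.
Proof.
apply/matrixP => a b; rewrite !mxE pf_oact big1 // => c _; rewrite big1 // => d _.
by rewrite /oel big_nil act0l.
Qed.

Lemma pf_opmx o v v' : pf (mxvect v) (oact o (mxvect v')) = (v^t* *m opmx o *m v') 0 0.
Proof.
rewrite mxE pf_oact_mxvect; apply: eq_bigr => b _; rewrite mulrC; congr (_ * _).
rewrite pfC pf_mxvect rmorph_sum mxE; apply: eq_bigr => a _.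
by rewrite !mxE rmorphM [X in _ = _ * X]pfC.
Qed.

Definition opmx_image (x : 'M[K]_n) := exists o, x = opmx o.

Lemma opmx_star_algebra : star_algebra opmx_image.
Proof.
split.
- by exists nil; rewrite opmx_nil.
- by move=> a b [k ->] [k' ->]; exists (oD k k'); rewrite opmxD.
- by move=> l a [k ->]; exists (oZ l k); rewrite opmxZ.
- by move=> a b [k ->] [k' ->]; exists (oM k k'); rewrite opmxM.
- by move=> a [k ->]; exists (oS k); rewrite opmxS.
Qed.

Lemma opmx_one : opmx_image 1%:M.
Proof.
apply: (star_algebra_one opmx_star_algebra) => v v0.
have {}v0 o u : pf u (oact o (mxvect v)) = 0.
  rewrite onb_expandl big1 // => a _; rewrite pf_oact_mxvect.
  have /matrixP/(_ a 0) : opmx o *m v = 0 by apply: v0; exists o.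
  rewrite !mxE => E; rewrite (_ : \sum_b _ = 0) ?mulr0 // -[RHS]E.
  by apply: eq_bigr => b _; rewrite mxE mulrC.
have n0 : pf (mxvect v) (mxvect v) = 0.
  by apply: operators_nondegenerate => o u; rewrite oact_adj v0.
apply/matrixP => a j; rewrite ord1 [RHS]mxE -[RHS](null_pf (w a) n0) pf_mxvect.
have [_ won _] := wo; rewrite (bigD1 a) // won eqxx mulr1 big1 => [|b ba].
  exact: esym (addr0 _).
by rewrite won eq_sym (negPf ba) mulr0.
Qed.

Lemma ideal_operator (L : Type) (p : L -> operator T) x :
  in_ideal opmx_image (fun l => opmx (p l)) x ->
  exists s : seq (operator T * L * operator T),
    x = opmx (osum [seq oM (oM a.1.1 (p a.1.2)) a.2 | a <- s]).
Proof.
elim=> [|_ _ l y [k ->] [k' ->] _ [s ->]]; first by exists nil; rewrite opmx_nil.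
by exists ((k, l, k') :: s); rewrite /= opmxD !opmxM.
Qed.

(** Minimal projections of the matrix algebra are lifted to operators. Their relations, and the
    expression of the unit in the ideal that they generate, say that certain operators kill [H0]; by
    [dom] these kill every good representation. *)
Lemma matrix_system : inhabited (system T good).
Proof.
have [L [p [v [[pA pv pmin porth] J1]]]] := exists_minimal_projections opmx_star_algebra opmx_one.
have /choice[f oE] l : exists k, p l = opmx k by case: (pA l).
have pE : p = fun l => opmx (f l) by apply/funext.
have [sg sgE] := ideal_operator (eq_ind _ (fun p => in_ideal _ p _) J1 _ pE).
pose q (l : 'I_#|L|) := f (enum_val l).
pose sw (l : 'I_#|L|) := mxvect (v (enum_val l)).
constructor; apply: (@System _ _ T good #|L| q (fun=> H0) sw).
- by [].
- move=> H l x gH; apply: dom => //; apply: opmx0.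
  rewrite opmxB opmxZ !opmxM -!oE pf_opmx pmin ?subrr //; by exists x.
- move=> H l l' x gH ll'; apply: dom => //; apply: opmx0.
  by rewrite !opmxM -!oE porth ?(inj_eq enum_val_inj) //; exists x.
- move=> H l gH; have [_ pS pp] := pA (enum_val l).
  split; apply: dom => //; apply: opmx0.
    by rewrite opmxB opmxS -!oE pS subrr.
  by rewrite opmxB opmxM -!oE pp subrr.
move=> H z y t gH H1; apply: (@ideal_unit_total _ _ T _ f _ sg) => [x|l s g].
  by apply: dom => //; apply: opmx0; rewrite opmxB opmxM -sgE mul1mx subrr.
by have := H1 (enum_rank l) s g; rewrite /q enum_rankK.
Qed.

End matrix_system.

Section point_system.
Variables (R : realType) (A : cstarType R) (T : hmod A) (good : rep A -> Prop).
Variables (n : nat) (F : fin_coordinates A n) (t : 'I_n -> T).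
Hypothesis gp : forall v, good (point_rep F v).
Hypothesis tt : forall v, tin (t v) (t v) = unitv F v.
Hypothesis tv : forall s v, cmul (tin s (t v)) (unitv F v) = tin s (t v).

Definition point_vec v : ht T (point_rep F v) :=
  simple (H := point_rep F v) (t v) (1 : R[i]).

Lemma oel_thetaM (a b : T) o s s' :
  oel (oM (theta a b) o) s s' = cmul (tin s a) (oel o b s').
Proof.
rewrite oelM /oel cmul_sumr; apply: eq_bigr => c _.
by rewrite -/(oel _ _ _) oel_theta cmulZr -cmulA.
Qed.

Lemma oel_Mtheta (a b : T) o s s' :
  oel (oM o (theta a b)) s s' = cmul (oel o s a) (tin b s').
Proof. by rewrite oelM big_seq1 scale1r. Qed.

Lemma tvl s v : cmul (unitv F v) (tin (t v) s) = tin (t v) s.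
Proof. by rewrite tinC -[in LHS](unitvS F v) -starM tv. Qed.

Definition point_system : system T good.
Proof.
apply: (@System _ _ T good n (fun v => theta (t v) (t v)) (point_rep F) point_vec gp).
- move=> H v o _ s s'; rewrite oelB oelZ oel_Mtheta oel_thetaM oel_theta pf_oact1.
  rewrite /= conjC1 mul1r mulr1 -{1}(tv s v) -(cmulA (tin s (t v))) unitvM.
  rewrite cmulZr cmulZl tv subrr; exact: ann0.
- move=> H v v' o _ vv' s s'; rewrite oel_Mtheta oel_thetaM.
  rewrite -(tv s v) -(cmulA (tin s (t v))) unitvM -(tvl s' v') cmulZr cmulZl.
  rewrite -!cmulA (cmulA (unitv F v)) unitvM coord_unitv (negPf vv') scale0r.
  by rewrite cmul0l cmul0r scaler0; exact: ann0.
- move=> H v _; split=> s s'; rewrite oelB.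
    by rewrite oelS !oel_theta starM -!tinC subrr; exact: ann0.
  by rewrite oel_Mtheta !oel_theta tt tv subrr; exact: ann0.
move=> H z y t1 _ H1; apply/eqP; rewrite pf_htE big1 // => -[t2 h] _ /=.
rewrite big_seq1 /= -(fin_unitr F (tin t2 t1)) actM act_adjr -[act _ h]/(act _ h).
rewrite /fin_unit act_suml big1 // => v _; set h' := act _ h.
have := H1 v (t v) (simple (t v) h').
rewrite oact_adj pf_oact1 oelS oel_theta starM -!tinC tt.
by rewrite unitvM coord_unitv eqxx scale1r.
Defined.

End point_system.

(** * Counting *)

Section essential.
Variables (R : realType) (A : cstarType R) (n : nat) (F : fin_coordinates A n).
Variables (X : correspondenceType A A) (M : 'M[nat]_n) (gb : graph_basis F X M).

(** For an edge [e] leaving [v], the coefficient <e, v e> is the indicator of the range of [e]. *)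
Lemma not_ann_tens (H : rep A) : (forall v, exists e : edge M, esource e = v) ->
  (forall v, ~ ann H (unitv F v)) -> forall v, ~ ann (tens X H) (unitv F v).
Proof.
move=> rows H0 v /ann_tens v0; have [e ev] := rows v.
apply: (H0 (erange e)); have := v0 (edgev gb e) (edgev gb e).
by rewrite (edgev_lact gb) ev eqxx scale1r (edgev_inner gb) eqxx scale1r.
Qed.

Lemma ann_all_tens (H : rep A) : (forall v, exists e : edge M, erange e = v) ->
  (forall c, ann (tens X H) c) -> forall c, ann H c.
Proof.
move=> cols H0 c x y; rewrite (coord_expand F c) act_suml big1 // => v _.
have [e ev] := cols v; apply: annZ.
have /ann_tens/(_ (edgev gb e) (edgev gb e)) := H0 (fin_unit F).
by rewrite (lact_fin_unit gb) (edgev_inner gb) eqxx scale1r ev.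
Qed.

End essential.

(** * The far end of the chain *)

Section top.
Variables (R : realType) (C : nat -> cstarType R).
Local Notation K := R[i].
Variables (P : forall i, correspondenceType (C i) (C i.+1))
  (Q : forall i, correspondenceType (C i.+1) (C i))
  (Y : forall i, correspondenceType (C i) (C i)) (k : nat).
Hypothesis hPQ : forall i, (i <= k)%N -> is_interior_tensor (P i) (Q i) (Y i).
Hypothesis hQP : forall i, (i <= k)%N -> is_interior_tensor (Q i) (P i) (Y i.+1).
Variables (p : nat) (F : fin_coordinates (C 0%N) p) (MA : 'M[nat]_p).
Hypothesis gb : graph_basis F (Y 0%N) MA.
Variables (q : nat) (F' : fin_coordinates (C k.+1) q) (MB : 'M[nat]_q).
Hypothesis gb' : graph_basis F' (Y k.+1) MB.
Hypothesis rows : forall v, exists e : edge MB, esource e = v.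
Hypothesis cols : forall v, exists e : edge MB, erange e = v.

(** As [std_rep F] is faithful, [Pm] of l^2(W) may take its place; [annNP] turns the result into
    copies of Y_(k+1) in front of l^2(W), and there [rows] leaves no vertex annihilated. *)
Lemma not_ann_Nm w : ~ ann (Nm Q k.+1 (std_rep F)) (unitv F' w).
Proof.
move=> w0.
have {}w0 : ann (Nm Q k.+1 (Pm P (std_rep F'))) (unitv F' w).
  by apply: ann_Nm w0 => a /ann_std ->; exact: ann0.
move/(annNP hPQ hQP (std_rep F') (unitv F' w) (leqnn _)): w0.
suff : forall n v, ~ ann (Ym Y n (std_rep F')) (unitv F' v) by move=> /[apply].
elim=> [v /ann_std v0|n IH]; last exact: not_ann_tens gb' _ rows IH.
by have := coord_unitv F' v v; rewrite v0 coord0 eqxx => /esym/eqP; rewrite oner_eq0.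
Qed.

(** A unit vector in the range of [unitv F' w] on the good [Nm Q k.+1 (std_rep F)] spans a copy of
    the evaluation at [w]. *)
Lemma good_point w : good P Q F (point_rep F' w).
Proof.
pose H := Nm Q k.+1 (std_rep F).
have [n0 n00] : exists x : H, pf x (act (unitv F' w) x) != 0.
  apply: contra_notP (@not_ann_Nm w) => H1 h h'.
  have {}H1 (x : H) : pf x (act (unitv F' w) x) = 0.
    by apply/eqP/negPn/negP => x0; apply: H1; exists x.
  have nx (y : H) : pf (act (unitv F' w) y) (act (unitv F' w) y) = 0.
    by rewrite act_adj -actM unitvS unitvM coord_unitv eqxx scale1r H1.
  exact: null_pf.
pose e := unitv F' w; set s := pf n0 (act e n0) in n00.
have ee : cmul e e = e by rewrite /e unitvM coord_unitv eqxx scale1r.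
have sE : pf (act e n0) (act e n0) = s by rewrite act_adj -actM unitvS ee.
pose u : H := pZ (sqrtC s)^-1 (act e n0).
have s0 : 0 <= s by rewrite -sE pf_ge0.
have u1 c : pf u (act c u) = coord F' w c.
  rewrite actZ pfZl act_adj unitvS -actM -actM -cmulA unitvMr -/e cmulZr ee.
  rewrite actZl -/s geC0_conj ?invr_ge0 ?sqrtC_ge0 // mulrA -invfM -expr2 sqrtCK.
  by rewrite mulrCA mulVf ?mulr1.
pose f (z : point_rep F' w) : H := pZ (z : K) u.
have fact c x y : pf (f x) (act c (f y)) = pf x (act c y).
  by rewrite actZ pfZl u1 /=; ring.
apply: (good_isometry (f := f)); last exact: (good_N hPQ hQP gb (leqnn k.+1)).
split=> // x y.
have u11 : pf u u = 1.
  have <- : pf u (act e u) = 1 by rewrite u1 coord_unitv eqxx.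
  by rewrite [RHS]actZ -actM ee -pfZ.
by rewrite /f pfZ pfZl u11 /=; ring.
Qed.

(** If all coordinates at [w] vanished, the inner products of T_(k+1) would annihilate the
    evaluation at [w]; so [Pm] of it, [Nm] of that, and the copies of Y_(k+1) in front of it would
    be zero, and [cols] would carry this back to the evaluation. A vector found in this way is then
    normalized and cut down to [w]. *)
Lemma top_generator w : exists t : Tm P k.+1, tin t t = unitv F' w /\
  forall s, cmul (tin s t) (unitv F' w) = tin s t.
Proof.
pose H := point_rep F' w.
have [t0 t00] : exists t : Tm P k.+1, coord F' w (tin t t) != 0.
  apply: contrapT => H1.
  have {}H1 (t : Tm P k.+1) : coord F' w (tin t t) = 0.
    by apply/eqP/negPn/negP => t0; apply: H1; exists t.
  have ann0' (s t : Tm P k.+1) : ann H (tin s t).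
    apply/ann_point; pose e (t : Tm P k.+1) := simple (H := H) t (1 : K).
    have := @null_pf _ _ (e t) (e s); rewrite !pf_ht1 /= H1 conjC1 !mul1r !mulr1.
    exact.
  have annP a : ann (Pm P H) a.
    by rewrite -(fin_unitl F a) -(fin_unitS F); exact: ann_Pm.
  have annN : forall i c, ann (Nm Q i (Pm P H)) c.
    elim=> [|i IH] c; first exact: annP.
    by apply/ann_tens => x x'; exact: IH.
  have annY : forall c, ann (Ym Y k.+1 H) c.
    by move=> c; apply/(annNP hPQ hQP H c (leqnn _)).
  have annH : forall c, ann H c.
    have step : forall i, (forall c, ann (Ym Y i H) c) -> forall c, ann H c.
      by elim=> [//|i IH] iH; apply: IH; apply: (ann_all_tens gb' cols iH).
    exact: step annY.
  have /ann_point := annH (unitv F' w); rewrite coord_unitv eqxx => /eqP.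
  by rewrite oner_eq0.
set r := coord F' w (tin t0 t0) in t00.
have r0 : 0 <= r.
  have := pf_ge0 (simple (H := H) t0 (1 : K)).
  by rewrite pf_ht1 /= conjC1 mul1r mulr1.
exists (trt t0 ((sqrtC r)^-1 *: unitv F' w)); split=> [|s].
  rewrite tinr tinl starZ unitvS cmulZr !cmulZl unitvM cmulZl unitvM coord_unitv eqxx.
  rewrite scale1r !scalerA -/r geC0_conj ?invr_ge0 ?sqrtC_ge0 //.
  by rewrite -invfM -expr2 sqrtCK mulVf ?scale1r.
by rewrite tinr -cmulA cmulZl unitvM coord_unitv eqxx scale1r.
Qed.

End top.

Section range_dimension.
Variables (R : realType) (A : cstarType R) (T : hmod A) (p : operator T).

Lemma range_dim_exists (H : rep A) : findim (ht T H) -> exists n, range_dim H p n.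
Proof.
move=> [n fH].
apply: (sdim_sub (@rng_subspace R A T H p) (@subspace_full _ (ht T H)) _ fH).
by [].
Qed.

Lemma range_dim_dense (H H' : rep A) (f : H -> H') n : rep_isometry f -> dense f ->
  oproj H p -> range_dim H p n -> range_dim H' p n.
Proof.
move=> ff fd pH [w wo]; have [wp won wt] := wo.
have pH' : oproj H' p.
  by case: pH => pS pM; split=> s t; apply/(ann_dense _ ff fd); [exact: pS|exact: pM].
have fi := hmap_isometry (T := T) ff.
exists (fun a => hmap f (w a)); split.
- move=> a z; rewrite -(hmap_oact_comm p (w a) ff); exact: (isometry_peq fi (wp a)).
- by move=> a b; rewrite fi won.
move=> v vp v0; apply: (dense_orth (hmap_dense (T := T) ff fd)) => u.
rewrite -vp -(oproj_adj _ _ pH') -(peql v (hmap_oact_comm p u ff)) pfC.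
have E := onb_expand (@rng_subspace R A T H p) wo (oproj_rng u pH).
rewrite (isometry_comb (s := [seq (pf (w c) (oact p u), w c) | c <- index_enum 'I_n]) fi).
  rewrite big_map big1 ?conjC0 // => c _; rewrite [X in _ * X]pfC.
  by rewrite (_ : pf _ v = 0) ?conjC0 ?mulr0 //; exact: v0.
by move=> z; rewrite big_map E.
Qed.

End range_dimension.

Lemma edge_between m n (M : 'M[nat]_(m, n)) v w (f : edge M) :
  v = esource f -> w = erange f ->
  exists c, f = @Tagged _ (v, w) (fun p => 'I_(M p.1 p.2)) c.
Proof. by case: f => -[v' w'] c -> ->; exists c. Qed.

Section point_dimension.
Variables (R : realType) (A : cstarType R) (T : hmod A) (good : rep A -> Prop).
Variables (n : nat) (F : fin_coordinates A n) (t : 'I_n -> T).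
Hypothesis gp : forall v, good (point_rep F v).
Hypothesis tt : forall v, tin (t v) (t v) = unitv F v.
Hypothesis tv : forall s v, cmul (tin s (t v)) (unitv F v) = tin s (t v).
Variables (X : correspondenceType A A) (M : 'M[nat]_n) (gb : graph_basis F X M).
Local Notation K := R[i].

(** The edges from [v] to [w] give a basis: the left action of [unitv F v] selects the source, the
    evaluation at [w] selects the range. [phi] identifies [L] with the scalars. *)
Lemma point_range_dim (v w : 'I_n) :
  range_dim (tens X (sL (point_system gp tt tv) w)) (sp (point_system gp tt tv) v) (M v w).
Proof.
pose L := cyclic_rep (point_vec F t w).
change (range_dim (tens X L) (theta (t v) (t v)) (M v w)).
pose phi (x : L) : K := cyclic_map (point_vec F t w) x.
have phiE c x y : pf x (act c y) = Num.conj (phi x) * (coord F w c * phi y) :> K.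
  by rewrite -(rep_iso_act (cyclic_map_isometry _)).
have pfE x y : pf x y = Num.conj (phi x) * phi y :> K by [].
pose l : L := [:: (1, t w)].
have phil : phi l = 1.
  have -> : phi l = pf (1 : point_rep F w) (cyclic_map (point_vec F t w) l).
    by rewrite /= conjC1 mul1r.
  rewrite pf_cyclic_map big_seq1 mul1r pf_tadj pf_ht1 /= tt coord_unitv eqxx.
  by rewrite conjC1 !mul1r.
have gE e f h h' : pf (simple (T := T) (H := tens X L) (t v) (tsimple (edgev gb e) h))
    (simple (T := T) (H := tens X L) (t v) (tsimple (edgev gb f) h')) =
    ((v == esource f) && (e == f) && (w == erange e))%:R * (Num.conj (phi h) * phi h').
  rewrite pf_ht1 tt [LHS]pf_tens_act !big_seq1; cbn [fst snd].
  rewrite (edgev_lact gb) innerZr (edgev_inner gb).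
  rewrite scalerA -natrM mulnb phiE coordZ coord_unitv -!mulrA [RHS]mulrCA; congr (_ * _).
  by rewrite mulrA -natrM mulnb.
pose e (c : 'I_(M v w)) : edge M := @Tagged _ (v, w) (fun p => 'I_(M p.1 p.2)) c.
exists (fun c => simple (T := T) (H := tens X L) (t v) (tsimple (edgev gb (e c)) l)).
split=> [c|c c'|z zp z0].
- apply: ht_peq => s h; rewrite pf_oact1 pf_ht1 oel_theta tt tv //.
- rewrite gE phil conjC1 !mulr1 (_ : esource (e c') = v) // (_ : erange (e c) = w) //.
  rewrite !eqxx andbT; congr (_%:R); congr nat_of_bool.
  exact: eq_Tagged.
rewrite -zp -pf_tadj_theta; apply: (graph_basis_total (gb := gb)) => f h.
rewrite pf_tadj.
have [/andP[/eqP fv /eqP fw]|fvw] := boolP ((v == esource f) && (w == erange f)).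
  have {fv fw} [c fE] : exists c, f = e c.
    exact: edge_between.
  rewrite -pf_tadj -pf_tsadj pfC.
  have -> : pf (tsadj (edgev gb f) (tadj (t v) z)) h =
      phi h * pf (tsadj (edgev gb f) (tadj (t v) z)) l.
    by rewrite !pfE phil mulr1 mulrC.
  rewrite [X in _ * X]pfC pf_tsadj pf_tadj fE.
  by rewrite (_ : pf _ z = 0) ?conjC0 ?mulr0 ?conjC0 //; exact: z0.
rewrite pfC null_pf ?conjC0 // gE eqxx andbT (negPf fvw) mul0r //.
Qed.

End point_dimension.

Lemma cast_matrix_sse_lag k (d : nat -> nat) (P : forall i, 'M[nat]_(d i, d i.+1))
    (Q : forall i, 'M[nat]_(d i.+1, d i)) p q (MA : 'M[nat]_p) (MB : 'M[nat]_q)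
    (e0 : d 0%N = p) (e1 : d k.+1 = q) :
  (forall v w, (P 0%N *m Q 0%N) v w = MA (cast_ord e0 v) (cast_ord e0 w)) ->
  (forall i, (i < k)%N -> Q i *m P i = P i.+1 *m Q i.+1) ->
  (forall v w, (Q k *m P k) v w = MB (cast_ord e1 v) (cast_ord e1 w)) ->
  matrix_sse_lag k.+1 MA MB.
Proof.
case: p / e0 MA => MA; case: q / e1 MB => MB E0 Ei E1.
apply: MatrixSSELag Ei _; apply/matrixP => v w.
  by rewrite E0 !cast_ord_id.
by rewrite E1 !cast_ord_id.
Qed.

Section total.
Variables (R : realType) (A B : cstarType R) (T : hmod B) (X : correspondenceType B A).

(** With [y] the component of [v] along t (x) x, the assumption makes the inner square [b] of t (x)
    x kill [y], so that t (x) x (x) y is null. *)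
Lemma tprod_total (H : rep A) (v : ht T (tens X H)) :
  (forall t x (t1 t2 : tprod T X) h,
    pf (simple t (tsimple x (act (tin t1 t2) h))) v = 0) -> pf v v = 0.
Proof.
move=> v0; apply: ht_simple_total => t u; rewrite -pf_tadj; apply: null_pf.
apply: tsimple_total => x h; rewrite -pf_tsadj; apply: null_pf.
set y := tsadj x _; pose b : A := tin ((t, x) : tprod T X) (t, x).
have bS : star b = b by rewrite /b -tinC.
have y0 h' : pf (act b h') y = 0 by rewrite pf_tsadj pf_tadj; exact: v0.
rewrite pf_tsadj pf_tadj pfC null_pf ?conjC0 //.
rewrite pf_ht1 [LHS]pf_tens_act !big_seq1; cbn [fst snd].
by rewrite -[inner _ _]/b act_adjr bS y0.
Qed.

End total.

Section count.
Variables (R : realType) (C : nat -> cstarType R).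
Local Notation K := R[i].
Variables (P : forall i, correspondenceType (C i) (C i.+1))
  (Q : forall i, correspondenceType (C i.+1) (C i))
  (Y : forall i, correspondenceType (C i) (C i)) (k : nat).
Hypothesis hPQ : forall i, (i <= k)%N -> is_interior_tensor (P i) (Q i) (Y i).
Hypothesis hQP : forall i, (i <= k)%N -> is_interior_tensor (Q i) (P i) (Y i.+1).
Variables (p : nat) (F : fin_coordinates (C 0%N) p) (MA : 'M[nat]_p).
Hypothesis gb : graph_basis F (Y 0%N) MA.
Variables (q : nat) (F' : fin_coordinates (C k.+1) q) (MB : 'M[nat]_q).
Hypothesis gb' : graph_basis F' (Y k.+1) MB.
Hypothesis rows : forall v, exists e : edge MB, esource e = v.
Hypothesis cols : forall v, exists e : edge MB, erange e = v.

(** Beyond [k.+1] nothing is good, so that the empty system serves there and the family of systems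
    is total. *)
Let good' i (H : rep (C i)) := (i <= k.+1)%N /\ good P Q F H.

(** Once systems are chosen their sizes are opaque; [e] retains the identification of their indices
    with the vertices. *)
Definition counts i (S : system (Tm P i) (@good' i)) n (M : 'M[nat]_n) :=
  exists e : sn S = n, forall v w,
    range_dim (tens (Y i) (sL S w)) (sp S v) (M (cast_ord e v) (cast_ord e w)).

Lemma exists_system0 : exists S : system (Tm P 0) (@good' 0), counts S MA.
Proof.
have gp v : good' (point_rep F v).
  split=> //; apply: good_unit.
  pose u (_ : unit) : point_rep F v := (1 : K).
  apply: (@findim_total _ (point_rep F v) _ u) => z z0.
  by have /= := z0 tt; rewrite conjC1 mul1r => ->; rewrite mulr0.
have tt v : tin (unitv F v : Tm P 0) (unitv F v : Tm P 0) = unitv F v.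
  by rewrite /= unitvS unitvM coord_unitv eqxx scale1r.
have tv (s : Tm P 0) v : cmul (tin s (unitv F v : Tm P 0)) (unitv F v) = tin s (unitv F v : Tm P 0).
  by rewrite /= -cmulA unitvM coord_unitv eqxx scale1r.
exists (point_system gp tt tv), erefl => v w; rewrite !cast_ord_id.
exact: point_range_dim gb v w.
Qed.

Lemma exists_system_top : exists S : system (Tm P k.+1) (@good' k.+1), counts S MB.
Proof.
have /choice[t tP] := top_generator hPQ hQP F gb' cols.
have gp v : good' (point_rep F' v) by split=> //; exact: (good_point hPQ hQP gb gb' rows v).
pose tt v := (tP v).1; pose tv s v := (tP v).2 s.
exists (point_system gp tt tv), erefl => v w; rewrite !cast_ord_id.
exact: point_range_dim gb' v w.
Qed.

Lemma exists_system i : exists S : system (Tm P i) (@good' i),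
  (i = 0%N -> counts S MA) /\ (i = k.+1 -> counts S MB).
Proof.
have [->|i0] := eqVneq i 0%N.
  by have [S SA] := exists_system0; exists S.
have [->|ik] := eqVneq i k.+1.
  by have [S SA] := exists_system_top; exists S.
suff [S] : inhabited (system (Tm P i) (@good' i)).
  by exists S; split=> E; [rewrite E eqxx in i0|rewrite E eqxx in ik].
have [ilek|kltI] := leqP i k.+1; last first.
  constructor; apply: (@System _ _ (Tm P i) (@good' i) 0 (fun=> [::])
    (fun=> Nm Q i (std_rep F)) (fun=> pz)) => [[]//|? []//|? []//|? []//|].
  by move=> H z y t [ik1]; move: kltI; rewrite ltnNge ik1.
have gN := good_N hPQ hQP gb ilek; have [n [w wo]] := gN.1.
apply: (matrix_system (H0 := Nm Q i (std_rep F)) _ _ wo); first by split.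
by move=> H [_ [_ dom]].
Qed.

Lemma good_sL i (S : system (Tm P i) (@good' i)) l : good' (sL S l).
Proof.
have [ik gl] := s_good l; split=> //.
exact: good_isometry (cyclic_map_isometry (sw S l)) gl.
Qed.

Theorem count_sse : matrix_sse_lag k.+1 MA MB.
Proof.
have /(_ _)/cid-/all_sig[S SP] := exists_system.
have gL i l : (i <= k.+1)%N -> good P Q F (sL (S i) l) by case: (good_sL l).
have gPL i l : (i <= k)%N -> good P Q F (tens (P i) (sL (S i.+1) l)).
  by move=> ik; apply: (good_P hPQ hQP ik); exact: gL.
have gQL i l : (i <= k)%N -> good P Q F (tens (Q i) (sL (S i) l)).
  by move=> ik; apply: (good_Q hPQ hQP gb ik); apply: gL; exact: leqW.
have /(_ _)/cid-/all_sig[mR mRP] : forall i, exists m, forall a b, (i <= k)%N ->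
    range_dim (tens (P i) (sL (S i.+1) b)) (sp (S i) a) (m a b).
  move=> i; have [ik|] := leqP i k; last by exists (fun _ _ => 0%N).
  have /choice[m mP] (ab : 'I_(sn (S i)) * 'I_(sn (S i.+1))) :=
    range_dim_exists (sp (S i) ab.1) (gPL i ab.2 ik).1.
  by exists (fun a b => m (a, b)) => a b _; exact: (mP (a, b)).
have /(_ _)/cid-/all_sig[mS mSP] : forall i, exists m, forall a b, (i <= k)%N ->
    range_dim (tens (Q i) (sL (S i) b)) (sp (S i.+1) a) (m a b).
  move=> i; have [ik|] := leqP i k; last by exists (fun _ _ => 0%N).
  have /choice[m mP] (ab : 'I_(sn (S i.+1)) * 'I_(sn (S i))) :=
    range_dim_exists (sp (S i.+1) ab.1) (gQL i ab.2 ik).1.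
  by exists (fun a b => m (a, b)) => a b _; exact: (mP (a, b)).
have proj i l (H : rep (C i)) : (i <= k.+1)%N -> good P Q F H -> oproj H (sp (S i) l).
  by move=> ik gH; apply: s_proj.
(* The multiplicities in Y_i (x) L_b are computed through P_i (x) Q_i here and through Q_(i-1) (x)
   P_(i-1) in [YS]; uniqueness of dimension equates the two. *)
have YR i a b : (i <= k)%N -> range_dim (tens (Y i) (sL (S i) b)) (sp (S i) a)
    (\sum_j mR i a j * mS i j b).
  move=> ik; have [t tt] := hPQ ik.
  have gPQ := good_P hPQ hQP ik (gQL i b ik).
  have iL := leqW ik.
  apply: (range_dim_dense (tensor_rep_map_isometry tt (sL (S i) b))
    (tensor_rep_map_dense tt (H := _))); first exact: proj.
  apply: (range_dim_additive (good := @good' i.+1) (S := S i.+1)) => [|||l|l|l].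
  - by split=> //; exact: gQL.
  - exact: tprod_total.
  - exact: proj.
  - by apply: proj => //; exact: gPL.
  - exact: mRP.
  - exact: mSP.
have YS i a b : (i <= k)%N -> range_dim (tens (Y i.+1) (sL (S i.+1) b)) (sp (S i.+1) a)
    (\sum_j mS i a j * mR i j b).
  move=> ik; have [t tt] := hQP ik.
  have gP := gPL i b ik.
  have gQP := good_Q hPQ hQP gb ik gP.
  apply: (range_dim_dense (tensor_rep_map_isometry tt (sL (S i.+1) b))
    (tensor_rep_map_dense tt (H := _))); first exact: proj.
  apply: (range_dim_additive (good := @good' i) (S := S i)) => [|||l|l|l].
  - by split=> //; exact: leqW.
  - by move=> v; apply: (TQ_total hPQ hQP gb ik gP.1).
  - exact: proj.
  - by apply: proj => //; exact: gQL.
  - exact: mSP.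
  - exact: mRP.
have [e0 A0] := (SP 0%N).1 erefl.
have [e1 B1] := (SP k.+1).2 erefl.
have uniq i (H : rep (C i)) a n m :
    range_dim H (sp (S i) a) n -> range_dim H (sp (S i) a) m -> n = m.
  by apply: sdim_unique; exact: rng_subspace.
pose PP i := \matrix_(a, j) mR i a j; pose QQ i := \matrix_(j, b) mS i j b.
apply: (@cast_matrix_sse_lag k (fun i => sn (S i)) PP QQ _ _ MA MB e0 e1).
- move=> v w; rewrite mxE; apply: uniq (A0 v w).
  by under eq_bigr do rewrite !mxE; exact: YR.
- move=> i ik; apply/matrixP => a b; rewrite !mxE.
  under eq_bigr do rewrite !mxE; under [RHS]eq_bigr do rewrite !mxE.
  apply: uniq (YR i.+1 a b ik); apply: YS; exact: ltnW.
- move=> v w; rewrite mxE; apply: uniq (B1 v w).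
  by under eq_bigr do rewrite !mxE; exact: YS.
Qed.

End count.

(** * Graph correspondences *)

Section unitary.
Variables (R : realType) (A B : cstarType R).
Implicit Types X Y Z : correspondenceType A B.

Lemma unitarily_isomorphic_sym X Y :
  unitarily_isomorphic X Y -> unitarily_isomorphic Y X.
Proof.
move=> [U [Ul Ua Ur Ui /choice[V UV]]].
have Uinj x y : U x = U y -> x = y.
  move=> xy; apply: inner_eq => z; by rewrite -!Ui xy.
exists V; split=> [l x y|a x|x b|x y|x]; try by apply: Uinj; rewrite ?Ul ?Ua ?Ur !UV.
- by rewrite -Ui !UV.
- by exists (U x); apply: Uinj; rewrite UV.
Qed.

Section map.
Variables (X Y : correspondenceType A B) (U : X -> Y).
Hypothesis hU : Defs.is_unitary U.

Lemma unitaryD x y : U (x + y) = U x + U y.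
Proof. by rewrite -[x]scale1r (unitary_linear hU) !scale1r. Qed.

Lemma unitary0 : U 0 = 0.
Proof. by apply: (addIr (U 0)); rewrite -unitaryD !add0r. Qed.

Lemma unitaryZ l x : U (l *: x) = l *: U x.
Proof. by rewrite -[l *: x]addr0 (unitary_linear hU) unitary0 addr0. Qed.

Lemma unitary_sum (I : Type) (s : seq I) (f : I -> X) :
  U (\sum_(i <- s) f i) = \sum_(i <- s) U (f i).
Proof. exact: (big_morph _ unitaryD unitary0). Qed.

Lemma unitary_norm x : `|U x| = `|x|.
Proof.
by apply/eqP; rewrite -(@eqrXn2 _ 2) // !normr_inner (unitary_inner hU).
Qed.

End map.

End unitary.

Lemma interior_tensor_unitary (R : realType) (A B D : cstarType R)
    (X : correspondenceType A B) (Y : correspondenceType B D)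
    (Z Z' : correspondenceType A D) :
  is_interior_tensor X Y Z -> unitarily_isomorphic Z Z' -> is_interior_tensor X Y Z'.
Proof.
move=> [t tt] [U hU]; exists (fun x y => U (t x y)).
split=> [l x x' y|l x y y'|x b y|a x y|x y d|x y x' y'|].
- by rewrite (tensor_linearl tt) (unitary_linear hU).
- by rewrite (tensor_linearr tt) (unitary_linear hU).
- by rewrite (tensor_balanced tt).
- by rewrite (tensor_lact tt) (unitary_lact hU).
- by rewrite (tensor_ract tt) (unitary_ract hU).
- by rewrite (unitary_inner hU) (tensor_inner tt).
rewrite -subTset => z' _; have [z <-] := unitary_surjective hU z'.
move=> V /nbhs_ballP[e e0 eV].
have : closure (linear_span [set t p.1 p.2 | p in [set: X * Y]]) z.
  by rewrite (tensor_dense tt).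
move=> /(_ _ (nbhsx_ballx z e e0))[w [[n [c [x [xt ->]]]] ze]].
exists (U (\sum_i c i *: x i)); split.
  exists n, c, (U \o x); split=> [i|].
    by have [p _ xE] := xt i; exists p => //=; rewrite xE.
  by rewrite (unitary_sum hU); apply: eq_bigr => i _; rewrite (unitaryZ hU).
apply: eV; move: ze; rewrite -!ball_normE /=.
by rewrite -(unitary_norm hU) (unitaryD hU) -scaleN1r (unitaryZ hU) scaleN1r.
Qed.

Lemma graph_basis_unitary (R : realType) (A : cstarType R) n (F : fin_coordinates A n)
    (X Y : correspondenceType A A) (M : 'M[nat]_n) :
  unitarily_isomorphic X Y -> graph_basis F X M -> inhabited (graph_basis F Y M).
Proof.
move=> [U hU] gb; constructor.
refine (@GraphBasis _ _ _ F Y M (fun e => U (edgev gb e)) _ _ _).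
- by move=> e f; rewrite (unitary_inner hU) (edgev_inner gb).
- by move=> v e; rewrite -(unitary_lact hU) (edgev_lact gb) (unitaryZ hU).
move=> y; have [x <-] := unitary_surjective hU y.
rewrite {1}(edgev_expand gb x) (unitary_sum hU); apply: eq_bigr => e _.
by rewrite (unitary_ract hU) (unitary_inner hU).
Qed.

Lemma matrix_of_correspondence_sse_lag (R : realType) m (A B : cstarType R)
    (X : correspondenceType A A) (Y : correspondenceType B B) p q
    (F : fin_coordinates A p) (F' : fin_coordinates B q)
    (MA : 'M[nat]_p) (MB : 'M[nat]_q) :
  correspondence_sse_lag m X Y -> graph_basis F X MA -> graph_basis F' Y MB ->
  (forall v, exists e : edge MB, esource e = v) ->
  (forall v, exists e : edge MB, erange e = v) -> matrix_sse_lag m MA MB.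
Proof.
move=> sse; case: m A B X Y / sse F F' => k C P Q PQ QP X Y.
move=> hPQ hQP X0 Xi Yk F F' gb gb' rows cols.
(* One model per level: Q_(i-1) (x) P_(i-1), except at level 0, where only P_0 (x) Q_0 exists. *)
pose YY i : correspondenceType (C i) (C i) :=
  match i with 0%N => PQ 0%N | j.+1 => QP j end.
have hPY i : (i <= k)%N -> is_interior_tensor (P i) (Q i) (YY i).
  case: i => [|i] ik; first exact: hPQ.
  by apply: interior_tensor_unitary (hPQ _ ik) _; apply: unitarily_isomorphic_sym; exact: Xi.
have hQY i : (i <= k)%N -> is_interior_tensor (Q i) (P i) (YY i.+1) by exact: hQP.
have [gb0] := graph_basis_unitary X0 gb.
have [gbk] := graph_basis_unitary (unitarily_isomorphic_sym Yk) gb'.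
exact: (count_sse hPY hQY (gb0 : graph_basis F (YY 0%N) MA)
  (gbk : graph_basis F' (YY k.+1) MB)).
Qed.

Section graph.
Variable R : realType.
Local Notation K := R[i].

Definition cfun_coordinates n : fin_coordinates (cfun R 'I_n) n.
Proof.
refine (@FinCoordinates _ (cfun R 'I_n) n (fun v a => a v) (fun v => [ffun w => (w == v)%:R])
  _ _ _ _ _).
- by move=> v l a b; rewrite !ffunE.
- by move=> v a b; rewrite ffunE.
- by move=> v a; rewrite ffunE.
- by move=> a a0; apply/ffunP => v; rewrite a0 ffunE.
- by move=> v w; rewrite ffunE.
Defined.

Lemma graph_correspondence_basis n (M : 'M[nat]_n) :
  inhabited (graph_basis (cfun_coordinates n) (graph_correspondence R M) M).
Proof.
constructor; refine (@GraphBasis _ _ _ (cfun_coordinates n) (graph_correspondence R M) M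
  (fun e => [ffun f => (f == e)%:R]) _ _ _).
- move=> e f; apply/ffunP => w; rewrite !ffunE -[RHS]/(_ * _).
  have [->|ew] := eqVneq w (erange e).
    rewrite (bigD1 e) //= !ffunE eqxx conjC1 mul1r big1 ?addr0 ?mulr1 // => g /andP[_ ge].
    by rewrite !ffunE (negPf ge) conjC0 mul0r.
  rewrite mulr0 big1 // => g /eqP gw; rewrite !ffunE; case: eqP => [ge|_].
    by rewrite -gw ge eqxx in ew.
  by rewrite conjC0 mul0r.
- move=> v e; apply/ffunP => f; rewrite !ffunE -[RHS]/(_ * _); have [->|fe] := eqVneq f e.
    by rewrite eq_sym.
  by rewrite !mulr0.
move=> y; apply/ffunP => f; rewrite sum_ffunE (bigD1 f) //= !ffunE eqxx mul1r.
rewrite (bigD1 f) //= !ffunE eqxx conjC1 mul1r !big1 ?addr0 //.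
  by move=> e ef; rewrite !ffunE eq_sym (negPf ef) mul0r.
by move=> g /andP[_ gf]; rewrite !ffunE (negPf gf) conjC0 mul0r.
Qed.

End graph.

Lemma essential_edge_out m n (M : 'M[nat]_(m, n)) v :
  row v M <> 0 -> exists e : edge M, esource e = v.
Proof.
move=> r0; apply: contrapT => H; apply: r0; apply/rowP => w; rewrite !mxE.
apply/eqP; rewrite -leqn0 leqNgt; apply/negP => vw; apply: H.
by exists (Tagged (fun p => 'I_(M p.1 p.2)) (Ordinal vw : 'I_(M (v, w).1 (v, w).2))).
Qed.

Lemma essential_edge_in m n (M : 'M[nat]_(m, n)) w :
  col w M <> 0 -> exists e : edge M, erange e = w.
Proof.
move=> r0; apply: contrapT => H; apply: r0; apply/colP => v; rewrite !mxE.
apply/eqP; rewrite -leqn0 leqNgt; apply/negP => vw; apply: H.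
by exists (Tagged (fun p => 'I_(M p.1 p.2)) (Ordinal vw : 'I_(M (v, w).1 (v, w).2))).
Qed.

Lemma matrix_sse_of_correspondence (R : realType) p q (A : 'M[nat]_p) (B : 'M[nat]_q) :
  essential_matrix B ->
  correspondence_sse (graph_correspondence R A) (graph_correspondence R B) -> matrix_sse A B.
Proof.
move=> [rB cB] [m m1 sse]; exists m => //.
have [gA] := graph_correspondence_basis R A; have [gB] := graph_correspondence_basis R B.
apply: (matrix_of_correspondence_sse_lag sse gA gB) => v.
  exact: essential_edge_out.
exact: essential_edge_in.
Qed.

(** * The graph correspondence of a product of matrices *)

Section graph_tensor.
Variables (R : realType) (m n l : nat) (P : 'M[nat]_(m, n)) (Q : 'M[nat]_(n, l)).
Local Notation K := R[i].

Definition composable (p : edge P * edge Q) := erange p.1 == esource p.2.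

Definition paths v w : {set edge P * edge Q} :=
  [set p | [&& esource p.1 == v, composable p & erange p.2 == w]].

Lemma count_edges m' n' (M : 'M[nat]_(m', n')) v w :
  (\sum_(e : edge M | (esource e == v) && (erange e == w)) 1 = M v w)%N.
Proof.
transitivity (\sum_(p : 'I_m' * 'I_n' | p == (v, w)) \sum_(c : 'I_(M p.1 p.2)) 1)%N.
  by rewrite sig_big_dep; apply: eq_bigl => e; rewrite andbT.
by rewrite big_pred1_eq sum1_card card_ord.
Qed.

Lemma card_paths v w : #|paths v w| = (P *m Q) v w.
Proof.
rewrite mxE -sum1_card.
transitivity (\sum_u \sum_(e : edge P | (esource e == v) && (erange e == u))
    \sum_(f : edge Q | (esource f == u) && (erange f == w)) 1)%N; last first.
  apply: eq_bigr => u _; under eq_bigr do rewrite count_edges.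
  by rewrite sum_nat_const -sum1_card count_edges.
rewrite (exchange_big_dep (fun e => esource e == v)) /=; last by move=> u e _ /andP[].
rewrite (eq_bigl (fun p : edge P * edge Q =>
  (esource p.1 == v) && ((esource p.2 == erange p.1) && (erange p.2 == w)))); last first.
  by move=> p; rewrite inE /composable (eq_sym (erange p.1)).
rewrite -(pair_big_dep (fun e => esource e == v)
  (fun e f => (esource f == erange e) && (erange f == w)) (fun _ _ => 1%N)).
apply: eq_bigr => e ev; rewrite (big_pred1 (erange e)) // => u.
by rewrite ev eq_sym.
Qed.

(** Any bijection preserving the endpoints would do; this one comes from [card_paths] and an
    enumeration. *)
Definition path_of_edge (g : edge (P *m Q)) : edge P * edge Q :=
  enum_val (cast_ord (esym (card_paths (tag g).1 (tag g).2)) (tagged g)).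

Lemma path_of_edgeP g : [/\ esource (path_of_edge g).1 = esource g,
  erange (path_of_edge g).1 = esource (path_of_edge g).2 &
  erange (path_of_edge g).2 = erange g].
Proof.
have := enum_valP (cast_ord (esym (card_paths (tag g).1 (tag g).2)) (tagged g)).
by rewrite inE => /and3P[/eqP ? /eqP ? /eqP ?].
Qed.

Lemma path_of_edge_inj : injective path_of_edge.
Proof.
move=> g g' gg'.
have [s1 _ r1] := path_of_edgeP g; have [s2 _ r2] := path_of_edgeP g'.
have : tag g = tag g'.
  have : (esource g, erange g) = (esource g', erange g').
    by rewrite -s1 -s2 -r1 -r2 gg'.
  by rewrite /esource /erange -!surjective_pairing.
case: g g' gg' {s1 r1 s2 r2} => [i c] [i' c'] gg' /= ii'; case: i' / ii' c' gg' => c' gg'.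
congr (Tagged _ _); apply: (@cast_ord_inj _ _ (esym (card_paths i.1 i.2))).
exact: enum_val_inj gg'.
Qed.

Lemma path_of_edge_surj p : composable p -> exists g, path_of_edge g = p.
Proof.
move=> pc; pose i := (esource p.1, erange p.2).
have pS : p \in paths i.1 i.2 by rewrite inE !eqxx pc.
exists (Tagged (fun i => 'I_((P *m Q) i.1 i.2))
  (cast_ord (card_paths i.1 i.2) (enum_rank_in pS p))).
rewrite /path_of_edge /= cast_ordK; exact: enum_rankK_in.
Qed.

Definition graph_tensor (x : edge_fun R P) (y : edge_fun R Q) : edge_fun R (P *m Q) :=
  [ffun g => x (path_of_edge g).1 * y (path_of_edge g).2].

Lemma graph_tensor_inner x y x' y' :
  inner (graph_tensor x y) (graph_tensor x' y') =
  inner y (lact (inner x x' : cfun R 'I_n) y') :> cfun R 'I_l.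
Proof.
apply/ffunP => w; rewrite !ffunE.
transitivity (\sum_(p : edge P * edge Q | composable p && (erange p.2 == w))
    Num.conj (x p.1 * y p.2) * (x' p.1 * y' p.2)).
  rewrite [RHS](reindex_omap path_of_edge (fun p => [pick g | path_of_edge g == p])).
    apply: eq_big => g; last by rewrite !ffunE.
    have [_ /eqP rs rg] := path_of_edgeP g; rewrite /composable rs rg.
    case: pickP => [g' /eqP/path_of_edge_inj ->|/(_ g)]; last by rewrite eqxx.
    by rewrite eqxx andbT.
  move=> p /andP[/path_of_edge_surj[g gp] _].
  by case: pickP => [g' /eqP /= ->|/(_ g)] //; rewrite gp eqxx.
rewrite (eq_bigl (fun p : edge P * edge Q => (erange p.2 == w) && composable p)); last first.
  by move=> p; rewrite andbC.
transitivity (\sum_(f : edge Q | erange f == w) \sum_(e : edge P | erange e == esource f)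
    Num.conj (x e * y f) * (x' e * y' f)).
  rewrite pair_big_dep /= (reindex (fun p : edge P * edge Q => (p.2, p.1))) //=.
  by exists (fun p => (p.2, p.1)) => -[].
apply: eq_bigr => f _; rewrite !ffunE mulr_suml mulr_sumr; apply: eq_bigr => e _.
by rewrite rmorphM /=; ring.
Qed.

Lemma graph_interior_tensor : is_interior_tensor (graph_correspondence R P)
  (graph_correspondence R Q) (graph_correspondence R (P *m Q)).
Proof.
exists graph_tensor; split.
- by move=> s x x' y; apply/ffunP => g; rewrite !ffunE mulrDl scalerAl.
- by move=> s x y y'; apply/ffunP => g; rewrite !ffunE mulrDr scalerAr.
- move=> x b y; apply/ffunP => g; rewrite !ffunE.
  by have [_ -> _] := path_of_edgeP g; rewrite mulrA.
- move=> a x y; apply/ffunP => g; rewrite !ffunE.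
  by have [-> _ _] := path_of_edgeP g; rewrite mulrA.
- move=> x y d; apply/ffunP => g; rewrite !ffunE.
  by have [_ _ ->] := path_of_edgeP g; rewrite mulrA.
- exact: graph_tensor_inner.
rewrite -subTset => z _; apply: subset_closure.
pose g (i : 'I_#|{: edge (P *m Q)}|) := enum_val i.
pose x i : edge_fun R P := [ffun e => (e == (path_of_edge (g i)).1)%:R].
pose y i : edge_fun R Q := [ffun f => (f == (path_of_edge (g i)).2)%:R].
exists #|{: edge (P *m Q)}|, (fun i => z (g i)), (fun i => graph_tensor (x i) (y i)).
split=> [i|]; first by exists (x i, y i).
apply/ffunP => h; rewrite sum_ffunE (bigD1 (enum_rank h)) //= big1 => [|i ih].
  by rewrite !ffunE /g enum_rankK !eqxx mulr1 addr0 -[RHS]/(_ * _) mulr1.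
rewrite !ffunE -natrM mulnb -xpair_eqE -!surjective_pairing (inj_eq path_of_edge_inj).
rewrite (_ : h == g i = false) ?scaler0 //; apply/negbTE; apply: contra ih => /eqP ->.
by rewrite enum_valK.
Qed.

End graph_tensor.

Lemma unitarily_isomorphic_refl (R : realType) (A B : cstarType R)
    (X : correspondenceType A B) : unitarily_isomorphic X X.
Proof. by exists id; split=> // y; exists y. Qed.

Lemma correspondence_sse_of_matrix (R : realType) p q (A : 'M[nat]_p) (B : 'M[nat]_q) :
  matrix_sse A B ->
  correspondence_sse (graph_correspondence R A) (graph_correspondence R B).
Proof.
move=> [m m1 sse]; exists m => //; case: m p q A B / sse m1 => k d P Q A B -> PQ <- _.
pose C i : cstarType R := cfun R 'I_(d i).
apply: (@CorrespondenceSSELag R k C (fun i => graph_correspondence R (P i))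
  (fun i => graph_correspondence R (Q i)) (fun i => graph_correspondence R (P i *m Q i))
  (fun i => graph_correspondence R (Q i *m P i))).
- by move=> i _; exact: graph_interior_tensor.
- by move=> i _; exact: graph_interior_tensor.
- exact: unitarily_isomorphic_refl.
- by move=> i ik; rewrite PQ //; exact: unitarily_isomorphic_refl.
- exact: unitarily_isomorphic_refl.
Qed.

Theorem theorem3 (R : realType) (p q : nat)
    (A : 'M[nat]_p) (B : 'M[nat]_q)
    (hA : essential_matrix A) (hB : essential_matrix B) :
  matrix_sse A B <->
  correspondence_sse (graph_correspondence R A) (graph_correspondence R B).
Proof.
split; first exact: correspondence_sse_of_matrix.
exact: matrix_sse_of_correspondence.
Qed.
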